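(* Let $E_0$ be a Banach space, let $E_1$ be a UMD Banach space and let $p\in(1,\infty)$. Suppose $\varphi:E_0\to E_1$ is Fréchet differentiable with continuous and bounded derivative $\varphi':E_0\to\mathscr L(E_0,E_1)$. If $F\in\mathbb D^{1,p}(E_0)$, then $\varphi(F)\in\mathbb D^{1,p}(E_1)$ and $$D(\varphi(F))=\varphi'(F)\,DF ,$$ where $\varphi'(F)DF$ denotes, pointwise in $\Omega$, the composition of $DF(\omega)\in\gamma(H,E_0)$ with $\varphi'(F(\omega))\in\mathscr L(E_0,E_1)$.
   Context: All vector spaces are real. $\mathscr L(E_0,E_1)$ is the space of bounded linear operators. $H$ is a separable Hilbert space, $(\Omega,\mathscr F,\mathbb P)$ is a probability space, and $W=\{W(h):h\in H\}$ is an isonormal Gaussian process on it: a (jointly) centered Gaussian family with $\mathbb E[W(h_1)W(h_2)]=\langle h_1,h_2\rangle$; $\mathscr F$ is generated by $W$. UMD: a Banach space $E$ is UMD if for some (equivalently all) $p\in(1,\infty)$ there is a constant $\beta$ such that $(\mathbb E\|\sum_{n=1}^N\varepsilon_nd_n\|^p)^{1/p}\le\beta(\mathbb E\|\sum_{n=1}^N d_n\|^p)^{1/p}$ for every $N\geq 1$, every $E$-valued $L^p$-martingale difference sequence $(d_n)_{n=1}^N$ and all signs $\varepsilon_n\in\{-1,1\}$. $\gamma$-radonifying operators: for $h\in H$, $x\in E$ ($E$ a Banach space), $h\otimes x$ is the operator $h'\mapsto\langle h,h'\rangle x$. For orthonormal $h_1,\dots,h_n$ put $\|\sum_j h_j\otimes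 x_j\|_{\gamma(H,E)}=(\mathbb E\|\sum_j\gamma_jx_j\|^2)^{1/2}$ with $(\gamma_j)$ independent standard Gaussians; $\gamma(H,E)$ is the closure of the finite rank operators in this norm. Malliavin derivative: $\mathscr S\otimes E$ is the linear span of the random variables $F=f(W(h_1),\dots,W(h_n))\otimes x$ with $f\in C_b^\infty(\mathbb R^n)$, $h_i\in H$, $x\in E$, and $DF=\sum_{i=1}^n\partial_if(W(h_1),\dots,W(h_n))\otimes(h_i\otimes x)$, with values in $\gamma(H,E)$. $D$ is closable from $L^p(\Omega;E)$ to $L^p(\Omega;\gamma(H,E))$ for $1\le p<\infty$; its closure is again denoted $D$, and its domain is $\mathbb D^{1,p}(E)$ with norm $(\|F\|^p_{L^p(\Omega;E)}+\|DF\|^p_{L^p(\Omega;\gamma(H,E))})^{1/p}$. *)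

(* Defs.v *)
From HB Require Import structures.
From mathcomp Require Import all_boot all_order all_algebra.
From mathcomp Require Import all_classical all_reals all_analysis.

Set Implicit Arguments.
Unset Strict Implicit.
Unset Printing Implicit Defensive.

Import Order.TTheory GRing.Theory Num.Theory.
Import numFieldNormedType.Exports.

Local Open Scope classical_set_scope.
Local Open Scope ring_scope.

Definition separable_space (T : topologicalType) : Prop :=
  exists A : set T, countable A /\ dense A.

(* In the L^p notions below the norm of the target space is passed as an
   extended-real valued function N, infinite off the space of interest.  This
   covers both a normed space E with N := enorm and the space gamma(H, E),
   carried by functions H -> E, with N := gamma_norm ip.  G is a sigma-algebra.
   Elements of L^p are represented by functions, and the notions used below are
   invariant under modification on a null set. *)

Definition enorm (R : realType) (E : normedModType R) (x : E) : \bar R :=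
  `|x|%:E.

Definition simple_function (R : realType) (d : measure_display)
    (S : measurableType d) (V : zmodType) (N : V -> \bar R)
    (G : set (set S)) (s : S -> V) : Prop :=
  [/\ finite_set (range s),
      forall v, G (s @^-1` [set v]) &
      forall w, (N (s w) < +oo)%E].

Definition strongly_measurable (R : realType) (d : measure_display)
    (S : measurableType d) (Q : probability S R) (V : zmodType)
    (N : V -> \bar R) (G : set (set S)) (f : S -> V) : Prop :=
  exists s : nat -> S -> V,
    (forall k, simple_function N G (s k)) /\
    {ae Q, forall w, (fun k => N (s k w - f w)) @ \oo --> 0%E}.

Definition in_Lp (R : realType) (d : measure_display)
    (S : measurableType d) (Q : probability S R) (V : zmodType)
    (N : V -> \bar R) (G : set (set S)) (p : R) (f : S -> V) : Prop :=
  strongly_measurable Q N G f /\ ('N[Q]_p%:E[N \o f] < +oo)%E.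

Definition cvg_Lp (R : realType) (d : measure_display)
    (S : measurableType d) (Q : probability S R) (V : zmodType)
    (N : V -> \bar R) (p : R) (u : nat -> S -> V) (f : S -> V) : Prop :=
  (fun k => 'N[Q]_p%:E[(fun w => N (u k w - f w)%R)])%E @ \oo --> 0%E.

Definition simple_integral (R : realType) (d : measure_display)
    (S : measurableType d) (Q : probability S R) (E : normedModType R)
    (s : S -> E) : E :=
  \sum_(v \in range s) fine (Q (s @^-1` [set v])) *: v.

Definition is_bochner_integral (R : realType) (d : measure_display)
    (S : measurableType d) (Q : probability S R) (E : normedModType R)
    (f : S -> E) (y : E) : Prop :=
  exists s : nat -> S -> E,
    [/\ forall k, simple_function (@enorm R E) measurable (s k),
        {ae Q, forall w, (fun k => s k w) @ \oo --> f w},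
        (fun k => \int[Q]_w (`|s k w - f w|%:E))%E @ \oo --> 0%E &
        (fun k => simple_integral Q (s k)) @ \oo --> y].

Definition filtration (d : measure_display) (S : measurableType d)
    (G : nat -> set (set S)) : Prop :=
  [/\ forall k, sigma_algebra setT (G k),
      forall k, G k `<=` measurable &
      forall k, G k `<=` G k.+1].

(* The differences are D 0, ..., D (N - 1).  Centering of D (k + 1) given G k is
   the defining property of conditional expectation, tested on the sets of G k;
   nothing is required of the mean of D 0. *)
Definition Lp_martingale_difference (R : realType) (d : measure_display)
    (S : measurableType d) (Q : probability S R) (E : normedModType R)
    (p : R) (N : nat) (G : nat -> set (set S)) (D : nat -> S -> E) : Prop :=
  [/\ filtration G,
      forall k, (k < N)%N -> in_Lp Q (@enorm R E) (G k) p (D k) &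
      forall k, (k.+1 < N)%N -> forall A, G k A ->
        is_bochner_integral Q (fun w => (\1_A w : R) *: D k.+1 w) 0].

Definition UMD (R : realType) (E : completeNormedModType R) : Prop :=
  exists p : R, 1 < p /\ exists beta : R,
  forall (d : measure_display) (S : measurableType d) (Q : probability S R)
    (N : nat) (G : nat -> set (set S)) (D : nat -> S -> E) (eps : nat -> R),
    (0 < N)%N ->
    Lp_martingale_difference Q p N G D ->
    (forall k, eps k = 1 \/ eps k = -1) ->
    ('N[Q]_p%:E[(fun w => `|\sum_(k < N) eps k *: D k w|%:E)] <=
     beta%:E * 'N[Q]_p%:E[(fun w => `|\sum_(k < N) D k w|%:E)])%E.

(* Expectation of f (g_1, ..., g_n) for independent standard Gaussian variables
   g_1, ..., g_n, as an iterated integral against N(0, 1). *)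
Fixpoint gauss_expectation (R : realType) (n : nat) :
    (n.-tuple R -> \bar R) -> \bar R :=
  match n return (n.-tuple R -> \bar R) -> \bar R with
  | 0%N => fun f => f [tuple]
  | m.+1 => fun f => (\int[normal_prob (0 : R) 1]_t
                       gauss_expectation (fun u => f (cons_tuple t u)))%E
  end.

Section Gamma.
Context (R : realType) (H : completeNormedModType R).
Context (ip : {dot H for (@idfun R)}).
Context (E : normedModType R).

Definition tensor (h : H) (x : E) : H -> E := fun h' => ip h h' *: x.

Definition orthonormal_system (n : nat) (h : 'I_n -> H) : Prop :=
  forall i j, ip (h i) (h j) = (i == j)%:R.

Definition finite_rank (T : H -> E) : Prop :=
  exists (n : nat) (h : 'I_n -> H) (x : 'I_n -> E),
    orthonormal_system h /\ T = \sum_(j < n) tensor (h j) (x j).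

(* All orthonormal representations of T give the same value, so the infimum
   only selects that value. *)
Definition finite_rank_gamma_norm (T : H -> E) : \bar R :=
  ereal_inf [set r | exists (n : nat) (h : 'I_n -> H) (x : 'I_n -> E),
    [/\ orthonormal_system h, T = \sum_(j < n) tensor (h j) (x j) &
        r = ((gauss_expectation (fun u : n.-tuple R =>
               (`|\sum_(j < n) tnth u j *: x j| ^+ 2)%:E)) `^ 2^-1)%E]].

(* The abstract completion of the finite rank operators embeds in the bounded
   operators since the gamma-norm dominates the operator norm: a Cauchy sequence
   is identified with its pointwise limit T, whose norm is the limit r of the
   norms.  The value r depends only on T. *)
Definition gamma_limit (T : H -> E) (r : \bar R) : Prop :=
  exists Tn : nat -> H -> E,
    [/\ forall k, finite_rank (Tn k),
        forall e : R, 0 < e -> exists k0, forall k l,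
          (k0 <= k)%N -> (k0 <= l)%N ->
          (finite_rank_gamma_norm (Tn k - Tn l)%R <= e%:E)%E,
        forall h, (fun k => Tn k h) @ \oo --> T h &
        (fun k => finite_rank_gamma_norm (Tn k)) @ \oo --> r].

(* gamma(H, E) is the set of T with [gamma_norm T < +oo]: the infimum is over a
   singleton if T is in gamma(H, E), and over the empty set otherwise. *)
Definition gamma_norm (T : H -> E) : \bar R := ereal_inf (gamma_limit T).

End Gamma.

(* [normal_prob 0 0] is not the Dirac mass, hence the case distinction. *)
Definition centered_gaussian (R : realType) (d : measure_display)
    (S : measurableType d) (Q : probability S R) (X : S -> R) : Prop :=
  exists2 s : R, 0 <= s & forall B : set R, measurable B ->
    Q (X @^-1` B) =
      if s == 0 then dirac (0 : R) B else normal_prob (0 : R) s B.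

Section Malliavin.
Context (R : realType) (H : completeNormedModType R).
Context (ip : {dot H for (@idfun R)}).
Context (d : measure_display) (Omega : measurableType d).
Context (P : probability Omega R) (W : H -> {RV P >-> R}).

Definition isonormal : Prop :=
  (forall (n : nat) (h : 'I_n -> H) (a : 'I_n -> R),
     centered_gaussian P (fun w => \sum_(i < n) a i * W (h i) w)) /\
  (forall h1 h2 : H,
     'E_P[(fun w => W h1 w * W h2 w)%R]%E = (ip h1 h2)%:E).

Definition generated_by_process : Prop :=
  (measurable : set (set Omega)) =
  <<s [set A | exists (h : H) (B : set R), measurable B /\ A = W h @^-1` B] >>.

Definition partial (n : nat) (i : 'I_n) (f : 'rV[R]_n -> R) : 'rV[R]_n -> R :=
  fun x => 'D_(delta_mx 0 i) f x.

(* The case s = [::] bounds f itself. *)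
Definition Cb_infty (n : nat) (f : 'rV[R]_n -> R) : Prop :=
  forall s : seq 'I_n, let g := foldr (@partial n) f s in
    (forall x, differentiable g x) /\ exists M : R, forall x, `|g x| <= M.

Definition process_vector (n : nat) (h : 'I_n -> H) (w : Omega) : 'rV[R]_n :=
  \row_i W (h i) w.

(* The linear span of the pairs (F, DF) with F = f(W(h_1), ..., W(h_n)) x: the
   graph of D on the space of E-valued smooth random variables. *)
Inductive smooth_derivative (E : normedModType R) :
    (Omega -> E) -> (Omega -> H -> E) -> Prop :=
| SmoothElementary (n : nat) (f : 'rV[R]_n -> R) (h : 'I_n -> H) (x : E) :
    Cb_infty f ->
    smooth_derivative
      (fun w => f (process_vector h w) *: x)
      (fun w => \sum_(i < n)
         partial i f (process_vector h w) *: tensor ip (h i) x)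
| SmoothLinear (a : R) (F F' : Omega -> E) (DF DF' : Omega -> H -> E) :
    smooth_derivative F DF -> smooth_derivative F' DF' ->
    smooth_derivative (fun w => a *: F w + F' w) (fun w => a *: DF w + DF' w).

(* [malliavin_derivative p F DF] states that (F, DF) is in the graph of the
   closure of D as an operator from L^p(Omega; E) to L^p(Omega; gamma(H, E)),
   i.e. F is in D^{1,p}(E) and DF is a representative of its derivative. *)
Definition malliavin_derivative (E : normedModType R) (p : R)
    (F : Omega -> E) (DF : Omega -> H -> E) : Prop :=
  [/\ in_Lp P (@enorm R E) measurable p F,
      in_Lp P (@gamma_norm R H ip E) measurable p DF &
      exists (Fn : nat -> Omega -> E) (DFn : nat -> Omega -> H -> E),
        [/\ forall k, smooth_derivative (Fn k) (DFn k),
            cvg_Lp P (@enorm R E) p Fn F &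
            cvg_Lp P (@gamma_norm R H ip E) p DFn DF]].

Definition malliavin_domain (E : normedModType R) (p : R)
    (F : Omega -> E) : Prop :=
  exists DF : Omega -> H -> E, malliavin_derivative p F DF.

End Malliavin.

(* Main.v *)
Require Import Defs.
From HB Require Import structures.
From mathcomp Require Import all_boot all_order all_algebra.
From mathcomp Require Import all_classical all_reals all_analysis.
From mathcomp Require Import measurable_realfun ring lra.

(* Idea.  For a smooth F = sum_j u_j x_j with bounded smooth scalars u_j, the map
   t |-> phi (y + sum_j t_j x_j) is replaced, one variable t_j at a time, by its
   Bernstein polynomials.  These converge together with their first derivatives,
   uniformly on a compact box, and a polynomial in u_j with coefficients of the
   form phi (...) is again of the same form with one variable less; hence phi(F)
   lies in the closure of D, with derivative phi'(F) DF.  For a general F, take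
   smooth F_n -> F with F_n -> F almost surely and write
     phi'(F_n) DF_n - phi'(F) DF
       = phi'(F_n) (DF_n - DF) + (phi'(F_n) - phi'(F)) DF:
   the first term is controlled by the bound on phi', the second by dominated
   convergence, because phi' is continuous in operator norm.

   What is used of gamma(H, E) is the triangle inequality and the ideal property.
   The former needs that the Gaussian norm does not depend on the orthonormal
   representation; this follows from the invariance of iterated Gaussian
   integrals under plane rotations, which are products of shears. *)

Set Implicit Arguments.
Unset Strict Implicit.
Unset Printing Implicit Defensive.

Import Order.TTheory GRing.Theory Num.Theory.
Import numFieldNormedType.Exports.

Local Open Scope classical_set_scope.
Local Open Scope ring_scope.

(** * Simple maps and their pointwise limits *)

(** Even for smooth [F] the variable [phi (F)] is usually not smooth: [phi] is only continuously
    differentiable, and its values need not span a finite dimensional space. Bernstein polynomials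
    fit this situation because they are convex combinations of values of [phi]. Their derivatives
    are Bernstein polynomials of difference quotients, which the mean value inequality compares with
    the derivative of [phi], so that one second moment estimate controls every error, uniformly in
    [Omega]. After one variable has been replaced, the coefficients are still random. The induction
    therefore runs over a class closed under multiplication by smooth scalars,
    [module_approximable]. The spaces [E] and [gamma(H, E)] carry no sigma-algebra, and norms of
    random variables need not be measurable. Measurability is thus handled through limits of simple
    maps, and L^p estimates through measurable majorants, [small]. *)

Section SimpleMaps.
Context (d : measure_display) (S : measurableType d).

Definition simple_map (T : Type) (s : S -> T) : Prop :=
  finite_set (range s) /\ forall v, measurable (s @^-1` [set v]).

(** Arbitrary sets [A] are allowed because the preimage is a finite union of fibres; hence simple
    maps can be composed with arbitrary functions. *)
Lemma simple_map_preimage (T : Type) (s : S -> T) (A : set T) :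
  simple_map s -> measurable (s @^-1` A).
Proof.
move=> [fs ms].
have -> : s @^-1` A = \bigcup_(v in A `&` range s) s @^-1` [set v].
  apply/seteqP; split=> [w Aw|w [v [Av _] /= ->]] //=.
  by exists (s w) => //; split => //; exists w.
apply: fin_bigcup_measurable => [|v _]; last exact: ms.
exact: sub_finite_set fs.
Qed.

Lemma simple_map_comp (T U : Type) (g : T -> U) (s : S -> T) :
  simple_map s -> simple_map (g \o s).
Proof.
move=> ss; split=> [|v]; last first.
  by rewrite comp_preimage; exact: simple_map_preimage.
by rewrite -(image_comp s g); apply: finite_image; exact: ss.1.
Qed.

Lemma simple_map_cst (T : Type) (t : T) : simple_map (fun=> t).
Proof.
split=> [|v].
  by apply: (@sub_finite_set _ _ [set t]) => [_ [w _ <-]|] //; exact: finite_set1.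
by rewrite preimage_cst; case: ifP.
Qed.

Lemma simple_map_pair (T U : Type) (s : S -> T) (s' : S -> U) :
  simple_map s -> simple_map s' -> simple_map (fun w => (s w, s' w)).
Proof.
move=> ss ss'; split=> [|[a b]].
  apply: (@sub_finite_set _ _ (range s `*` range s')).
    by move=> _ [w _ <-]; split => /=; exists w.
  by apply: finite_setX; [case: ss|case: ss'].
rewrite (_ : _ @^-1` _ = s @^-1` [set a] `&` s' @^-1` [set b]).
  by apply: measurableI; exact: simple_map_preimage.
by apply/seteqP; split=> w /= => [[-> ->]|[-> ->]].
Qed.

Lemma simple_map_seq (I T : Type) (s : I -> S -> T) (l : seq I) :
  (forall i, simple_map (s i)) -> simple_map (fun w => [seq s i w | i <- l]).
Proof.
move=> ss; elim: l => [|i l IH]; first exact: simple_map_cst.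
exact: (simple_map_comp (fun p => p.1 :: p.2) (simple_map_pair (ss i) IH)).
Qed.

Lemma simple_map_row (R : realType) n (s : 'I_n -> S -> R) :
  (forall i, simple_map (s i)) -> simple_map (fun w => \row_i s i w : 'rV_n).
Proof.
move=> ss; pose g (l : seq R) : 'rV[R]_n := \row_i l`_i.
have := simple_map_comp g (simple_map_seq (enum 'I_n) ss).
congr simple_map; apply/funext => w; apply/rowP => i; rewrite !mxE.
by rewrite (nth_map i) ?size_enum_ord// nth_ord_enum.
Qed.

(* The target carries no sigma-algebra, so measurability is expressed by
   approximation with simple maps, here at every point. *)
Definition simple_limit (T : topologicalType) (f : S -> T) : Prop :=
  exists s : nat -> S -> T,
    (forall k, simple_map (s k)) /\ forall w, (fun k => s k w) @ \oo --> f w.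

Lemma simple_limit_comp (T U : topologicalType) (g : T -> U) (f : S -> T) :
  continuous g -> simple_limit f -> simple_limit (g \o f).
Proof.
move=> cg [s [ss sf]]; exists (fun k => g \o s k); split=> [k|w].
  exact: simple_map_comp.
by apply: continuous_cvg; [exact: cg|exact: sf].
Qed.

Lemma simple_limit_pair (T U : topologicalType) (f : S -> T) (g : S -> U) :
  simple_limit f -> simple_limit g -> simple_limit (fun w => (f w, g w)).
Proof.
move=> [s [ss sf]] [t [st tg]]; exists (fun k w => (s k w, t k w)).
split=> [k|w]; first exact: simple_map_pair.
by apply: cvg_pair; [exact: sf|exact: tg].
Qed.

Import HBSimple.

Lemma simple_limit_real (R : realType) (X : S -> R) :
  measurable_fun setT X -> simple_limit X.
Proof.
move=> mX.
have /measurable_EFinP mE := mX.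
have [g gX] := approximation_sfun measurableT mE.
exists (fun k => g k : S -> R); split=> [k|w].
  by split=> [|v]; [exact: fimfunP|exact: measurable_sfunP].
by have /fine_cvgP[] := gX w I.
Qed.

Lemma simple_limit_measurable (R : realType) (X : S -> R) :
  simple_limit X -> measurable_fun setT X.
Proof.
move=> [s [ss sX]]; apply: (measurable_fun_cvg (h := s)) => [m|w _]; last exact: sX.
by move=> _ Y mY; rewrite setTI; exact: simple_map_preimage.
Qed.

Lemma simple_limit_add (R : realType) (E : normedModType R) (f g : S -> E) :
  simple_limit f -> simple_limit g -> simple_limit (fun w => f w + g w).
Proof.
move=> sf sg.
exact: (simple_limit_comp (@add_continuous E) (simple_limit_pair sf sg)).
Qed.

Lemma simple_limit_scale (R : realType) (E : normedModType R) (t : S -> R) (x : E) :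
  measurable_fun setT t -> simple_limit (fun w => t w *: x).
Proof.
move=> /simple_limit_real st.
by apply: (simple_limit_comp (g := fun r : R => r *: x) _ st) => r; exact: scalel_continuous.
Qed.

Lemma simple_limit_row (R : realType) n (X : 'I_n -> S -> R) :
  (forall i, measurable_fun setT (X i)) ->
  simple_limit (fun w => \row_i X i w : 'rV_n).
Proof.
move=> mX; have /choice[s sX] := fun i => simple_limit_real (mX i).
exists (fun k w => \row_i s i k w); split=> [k|w].
  by apply: simple_map_row => i; case: (sX i).
apply/cvg_ballP => e e0.
have : \forall k \near \oo, forall i, ball (X i w) e (s i k w).
  apply: filter_forall => i; have [_ /(_ w)/cvg_ballP] := sX i; exact.
apply: filterS => k H; split => // i j.
by rewrite !mxE; exact: H.
Qed.

End SimpleMaps.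

Lemma simple_limit_measurable_comp (d d' : measure_display)
    (S : measurableType d) (S' : measurableType d') (T : topologicalType)
    (f : S -> T) (g : S' -> S) :
  measurable_fun setT g -> simple_limit f -> simple_limit (f \o g).
Proof.
move=> mg [s [ss sf]]; exists (fun k => s k \o g); split=> [k|w]; last exact: sf.
split=> [|v].
  by apply: sub_finite_set (ss k).1 => _ [w _ <-]; exists (g w).
rewrite comp_preimage -[X in measurable X]setTI.
by apply: mg => //; exact: (ss k).2.
Qed.
(** * Rotation invariance of the Gaussian integral *)

Section GaussianRotation.
Context (R : realType).
Local Open Scope ereal_scope.
Local Notation mu := (@lebesgue_measure R).
Local Notation gamma := (@normal_prob R 0 1).

(** Change of variables holds for the Radon-Nikodym derivative, which agrees almost everywhere with
    [normal_pdf] because both have the same integral over every measurable set. *)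
Lemma ge0_integral_normal_prob (f : R -> \bar R) :
  measurable_fun setT f -> (forall x, 0 <= f x) ->
  \int[gamma]_x f x = \int[mu]_x (f x * (normal_pdf 0 1 x)%:E).
Proof.
move=> mf f0.
have dom : gamma `<< mu := normal_prob_dominates 0 1.
rewrite -(Radon_Nikodym_SigmaFinite.change_of_variables dom)//.
apply: ge0_ae_eq_integral => //.
- apply: emeasurable_funM => //.
  exact: measurable_int (Radon_Nikodym_SigmaFinite.f_integrable dom).
- apply: emeasurable_funM => //; apply/measurable_EFinP.
  exact: measurable_normal_pdf.
- by move=> x _; rewrite mule_ge0 ?Radon_Nikodym_SigmaFinite.f_ge0.
- by move=> x _; rewrite mule_ge0// lee_fin normal_pdf_ge0.
apply: ae_eqe_mul2l; apply: integral_ae_eq => //.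
- exact: Radon_Nikodym_SigmaFinite.f_integrable.
- by apply/measurable_EFinP; exact: measurable_normal_pdf.
by move=> A _ mA; rewrite -Radon_Nikodym_SigmaFinite.f_integral.
Qed.

(** By uniqueness of Lebesgue measure it is enough to compare lengths of half-open intervals. *)
Lemma lebesgue_measure_translate (a : R) (A : set R) : measurable A ->
  pushforward mu (+%R^~ a : R -> measurableTypeR R) A = mu A.
Proof.
move=> mA; apply/esym/lebesgue_measure_unique => //=; first exact: measurable_funD.
move=> _ _ [[u v]] _ <-; rewrite /pushforward.
rewrite (_ : _ @^-1` _ = `](u - a)%R, (v - a)%R]%classic); last first.
  by apply/seteqP; split=> x /=; rewrite !in_itv/= ltrBlDr lerBrDr.
rewrite !lebesgue_measure_itv/= !lte_fin ltrD2r; case: ifP => // _.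
by rewrite opprB -!EFinD addrA subrK.
Qed.

Lemma ge0_integral_translate (f : R -> \bar R) (a : R) :
  measurable_fun setT f -> (forall x, 0 <= f x) ->
  \int[mu]_x f (x + a)%R = \int[mu]_x f x.
Proof.
move=> mf f0.
have mT : measurable_fun setT (+%R^~ a : R -> measurableTypeR R).
  exact: measurable_funD.
transitivity (\int[pushforward mu (+%R^~ a : R -> measurableTypeR R)]_x f x).
  by rewrite ge0_integral_pushforward.
by apply: eq_measure_integral => A mA _; exact: lebesgue_measure_translate.
Qed.

Section Shear.
Variable k : R * R -> \bar R.
Hypothesis (mk : measurable_fun setT k) (k0 : forall z, 0 <= k z).

Lemma ge0_integral_shear_snd (l : R) :
  \int[mu]_a \int[mu]_b k (a, b + l * a)%R = \int[mu]_a \int[mu]_b k (a, b).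
Proof.
apply: eq_integral => a _.
rewrite (ge0_integral_translate (f := fun b => k (a, b)))//.
by apply: measurableT_comp mk _; exact: pair1_measurable.
Qed.

Lemma ge0_integral_shear_fst (l : R) :
  \int[mu]_a \int[mu]_b k (a + l * b, b)%R = \int[mu]_a \int[mu]_b k (a, b).
Proof.
pose k' (z : R * R) := k (z.1 + l * z.2, z.2)%R.
have mk' : measurable_fun setT k'.
  apply: measurableT_comp mk _; apply: measurable_fun_pair => //.
  by apply: measurable_funD => //; apply: measurable_funM.
(* Tonelli makes the sheared variable the inner one, where the shear is a translation. *)
transitivity (\int[mu]_b \int[mu]_a k' (a, b)).
  have H := @fubini_tonelli _ _ _ _ R mu mu k' mk' (fun=> k0 _).
  by refine H.
transitivity (\int[mu]_b \int[mu]_a k (a, b)); last first.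
  have H := @fubini_tonelli _ _ _ _ R mu mu k mk k0.
  by refine (esym H).
apply: eq_integral => b _.
refine (ge0_integral_translate (f := fun a : R => k (a, b)) (l * b)%R _ _) => //.
by apply: measurableT_comp mk _; exact: pair2_measurable.
Qed.

End Shear.

(* A rotation is a product of three shears. *)
Lemma ge0_integral_rotate (k : R * R -> \bar R) (c s : R) :
  measurable_fun setT k -> (forall z, 0 <= k z) ->
  (c ^+ 2 + s ^+ 2 = 1)%R -> s != 0%R ->
  \int[mu]_a \int[mu]_b k (c * a - s * b, s * a + c * b)%R =
  \int[mu]_a \int[mu]_b k (a, b).
Proof.
(* For the angle [x] with cosine [c] and sine [s] this is [- tan (x / 2)]. The identities
   [t * s = c - 1] and [t * (c + 1) = - s] make the shears with slopes [t], [s], [t] compose to the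
   rotation. *)
move=> mk k0 cs1 s0; pose t := ((c - 1) / s)%R.
pose k1 (z : R * R) := k (z.1 + t * z.2, z.2)%R.
pose k2 (z : R * R) := k1 (z.1, z.2 + s * z.1)%R.
have mk1 : measurable_fun setT k1.
  apply: measurableT_comp mk _; apply: measurable_fun_pair => //.
  by apply: measurable_funD => //; apply: measurable_funM.
have mk2 : measurable_fun setT k2.
  apply: measurableT_comp mk1 _; apply: measurable_fun_pair => //.
  by apply: measurable_funD => //; apply: measurable_funM.
rewrite -(ge0_integral_shear_fst mk k0 t).
rewrite -(ge0_integral_shear_snd mk1 (fun=> k0 _) s).
rewrite -(ge0_integral_shear_fst mk2 (fun=> k0 _) t).
apply: eq_integral => a _; apply: eq_integral => b _; rewrite /k2 /k1/=.
have ts : (t * s = c - 1)%R by rewrite /t divfK.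
have tc : (t * (c + 1) = - s)%R.
  apply: (mulIf s0).
  have -> : (t * (c + 1) * s = t * s * (c + 1))%R by ring.
  rewrite ts (_ : ((c - 1) * (c + 1) = c ^+ 2 - 1)%R); last by ring.
  by rewrite -cs1; ring.
congr (k (_, _)); last first.
  have -> : (b + s * (a + t * b) = s * a + (t * s) * b + b)%R by ring.
  by rewrite ts; ring.
have -> : (a + t * b + t * (b + s * (a + t * b)) =
  a + (t * s) * a + (t * (t * s + 2)) * b)%R by ring.
by rewrite ts (_ : (c - 1 + 2 = c + 1)%R) ?tc; ring.
Qed.

(** The product of the two densities depends on [a ^+ 2 + b ^+ 2] only, so it can be absorbed into
    the integrand before Lebesgue measure is rotated. *)
Lemma ge0_integral_gauss_rotate (k : R * R -> \bar R) (c s : R) :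
  measurable_fun setT k -> (forall z, 0 <= k z) ->
  (c ^+ 2 + s ^+ 2 = 1)%R -> s != 0%R ->
  \int[gamma]_a \int[gamma]_b k (c * a - s * b, s * a + c * b)%R =
  \int[gamma]_a \int[gamma]_b k (a, b).
Proof.
move=> mk k0 cs1 s0.
pose q (z : R * R) := (normal_pdf 0 1 z.1 * normal_pdf 0 1 z.2 : R)%R.
have mq : measurable_fun setT q.
  by apply: measurable_funM; (apply: measurableT_comp; [exact: measurable_normal_pdf|]).
have q0 z : (0 <= q z)%R by rewrite mulr_ge0// normal_pdf_ge0.
have qrot a b : q (c * a - s * b, s * a + c * b)%R = q (a, b).
  rewrite /q/= !normal_pdfE ?oner_neq0// /normal_fun.
  rewrite mulrACA [RHS]mulrACA -!expRD; congr (_ * expR _)%R.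
  rewrite !subr0 -!mulrDl -!opprD; congr (- _ / _)%R.
  by rewrite -[RHS]mul1r -cs1; ring.
have E (k' : R * R -> \bar R) : measurable_fun setT k' -> (forall z, 0 <= k' z) ->
    \int[gamma]_a \int[gamma]_b k' (a, b) =
    \int[mu]_a \int[mu]_b (k' (a, b) * (q (a, b))%:E).
  move=> mk' k'0.
  rewrite ge0_integral_normal_prob//; last 2 first.
  - have H := @measurable_fun_fubini_tonelli_F _ _ _ _ R gamma k' mk' k'0.
    by refine H.
  - by move=> x; apply: integral_ge0.
  apply: eq_integral => a _.
  have mk'a : measurable_fun setT (fun b => k' (a, b)).
    by apply: measurableT_comp mk' _; exact: pair1_measurable.
  rewrite ge0_integral_normal_prob//= -ge0_integralZr//=; last 3 first.
  - apply: emeasurable_funM => //; apply/measurable_EFinP.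
    exact: measurable_normal_pdf.
  - by move=> b _; rewrite mule_ge0// lee_fin normal_pdf_ge0.
  - by rewrite lee_fin normal_pdf_ge0.
  by apply: eq_integral => b _; rewrite -muleA -EFinM mulrC.
have mr : measurable_fun setT
    (fun z : R * R => (c * z.1 - s * z.2, s * z.1 + c * z.2) : R * R)%R.
  by apply: measurable_fun_pair; [apply: measurable_funB|apply: measurable_funD];
    apply: measurable_funM.
rewrite (E (fun z : R * R => k (c * z.1 - s * z.2, s * z.1 + c * z.2)%R))//=; last first.
  exact: measurableT_comp mk mr.
rewrite (E k mk k0).
pose k' (z : R * R) := k z * (q z)%:E.
have mk' : measurable_fun setT k'.
  by apply: emeasurable_funM => //; exact/measurable_EFinP.
have k'0 z : 0 <= k' z by rewrite mule_ge0// lee_fin.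
have H := ge0_integral_rotate mk' k'0 cs1 s0.
refine (etrans _ H).
apply: eq_integral => a _; apply: eq_integral => b _; rewrite /k'.
by rewrite qrot.
Qed.

End GaussianRotation.
(** Rotating a pair of vectors amounts to rotating their coefficients. The coefficients are Gaussian
    variables in [same_gauss_rotate] and inner products in [tensor_rotate]. *)
Lemma scale_rotate (R : realType) (E : normedModType R) (x y : E) (c s t u : R) :
  t *: (c *: x + s *: y) + u *: (c *: y - s *: x) =
  (c * t - s * u) *: x + (s * t + c * u) *: y.
Proof.
rewrite !scalerDr scalerN !scalerA scalerBl scalerDl.
rewrite (mulrC t c) (mulrC t s) (mulrC u c) (mulrC u s) -!addrA.
by congr (_ + _); rewrite [RHS]addrC -addrA.
Qed.

(** * Laws of Gaussian sums of vectors *)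

Section GaussianSums.
Context (R : realType).
Local Open Scope ereal_scope.
Local Notation gamma := (@normal_prob R 0 1).

(** The expectation of [psi] at a Gaussian sum with coefficient vectors [l]. Shifting the partial
    sum into [psi] leaves the vectors in a list, whose head can be rotated or dropped. *)
Fixpoint gauss_mean (E : normedModType R) (l : seq E) (psi : E -> R) : \bar R :=
  if l is x :: l' then
    \int[gamma]_t gauss_mean l' (fun z => psi (t *: x + z)%R)
  else (psi 0%R)%:E.

Section Fixed.
Context (E : normedModType R).
Implicit Types (l : seq E) (psi : E -> R).

(** Continuity gives measurability of the iterated integrals, and nonnegativity gives Tonelli.
    Unlike the square of the norm alone, this class is stable under the translations made by
    [gauss_mean]. *)
Definition admissible psi := continuous psi /\ forall z, (0 <= psi z)%R.

Lemma admissible_shift psi y : admissible psi -> admissible (fun z => psi (y + z)%R).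
Proof.
move=> [cp p0]; split=> [z|z]; last exact: p0.
apply: continuous_comp; last exact: cp.
by apply: continuousD; [exact: cst_continuous|exact: cvg_id].
Qed.

Lemma gauss_mean_ge0 l psi : (forall z, (0 <= psi z)%R) -> 0 <= gauss_mean l psi.
Proof.
elim: l psi => [|x l IH] psi p0 /=; first by rewrite lee_fin.
by apply: integral_ge0 => t _; apply: IH.
Qed.

(** The parameter space is quantified inside the induction, since each step adjoins the variable of
    the outer integral to the parameter and then applies Tonelli. *)
Lemma gauss_mean_measurable l (d : measure_display) (S : measurableType d)
    (q : S -> E) psi :
  simple_limit q -> admissible psi ->
  measurable_fun setT (fun s => gauss_mean l (fun z => psi (q s + z)%R)).
Proof.
elim: l d S q psi => [|x l IH] d S q psi sq ap /=.
  apply/measurable_EFinP/simple_limit_measurable.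
  under eq_fun do rewrite addr0.
  by apply: simple_limit_comp sq; case: ap.
pose q' (st : S * R) := (q st.1 + st.2 *: x)%R.
have sq' : simple_limit q'.
  apply: simple_limit_add; last exact: simple_limit_scale.
  exact: (simple_limit_measurable_comp _ sq).
have m := IH _ _ q' psi sq' ap.
apply: (eq_measurable_fun (fubini_F gamma
  (fun st => gauss_mean l (fun z => psi (q' st + z)%R)))) => [s _|].
  apply: eq_integral => t _; congr gauss_mean; apply/funext => z.
  by rewrite /q'/= addrA.
apply: measurable_fun_fubini_tonelli_F => //.
by move=> st; apply: gauss_mean_ge0 => z; case: ap.
Qed.

Lemma gauss_mean_measurable1 l x psi : admissible psi ->
  measurable_fun setT (fun t : R => gauss_mean l (fun z => psi (t *: x + z)%R)).
Proof. by move=> ap; apply: gauss_mean_measurable => //; exact: simple_limit_scale. Qed.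

Lemma le_gauss_mean l psi psi' : admissible psi -> admissible psi' ->
  (forall z, (psi z <= psi' z)%R) -> gauss_mean l psi <= gauss_mean l psi'.
Proof.
elim: l psi psi' => [|x l IH] psi psi' a a' pp' /=; first by rewrite lee_fin.
apply: ge0_le_integral => //.
- by move=> t _; apply: gauss_mean_ge0 => z; case: a.
- exact: gauss_mean_measurable1.
- exact: gauss_mean_measurable1.
- by move=> t _; apply: IH; [exact: admissible_shift|exact: admissible_shift|].
Qed.

Lemma gauss_meanD l psi psi' : admissible psi -> admissible psi' ->
  gauss_mean l (fun z => psi z + psi' z)%R = gauss_mean l psi + gauss_mean l psi'.
Proof.
elim: l psi psi' => [|x l IH] psi psi' a a' /=; first by rewrite EFinD.
rewrite -ge0_integralD//; last 4 first.
- by move=> t _; apply: gauss_mean_ge0 => z; case: a.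
- exact: gauss_mean_measurable1.
- by move=> t _; apply: gauss_mean_ge0 => z; case: a'.
- exact: gauss_mean_measurable1.
by apply: eq_integral => t _; rewrite IH//; exact: admissible_shift.
Qed.

Lemma gauss_meanZ l psi (k : R) : (0 <= k)%R -> admissible psi ->
  gauss_mean l (fun z => k * psi z)%R = k%:E * gauss_mean l psi.
Proof.
move=> k0; elim: l psi => [|x l IH] psi a /=; first by rewrite EFinM.
rewrite -ge0_integralZl//; last 2 first.
- exact: gauss_mean_measurable1.
- by move=> t _; apply: gauss_mean_ge0 => z; case: a.
by apply: eq_integral => t _; rewrite IH//; exact: admissible_shift.
Qed.

(** Testing on every admissible function, and not only on the square of the norm, makes the relation
    stable under adding a vector in front. *)
Definition same_gauss l l' := forall psi, admissible psi ->
  gauss_mean l psi = gauss_mean l' psi.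

Lemma same_gauss_cons x l l' : same_gauss l l' -> same_gauss (x :: l) (x :: l').
Proof.
by move=> ll' psi a; apply: eq_integral => t _; apply: ll'; exact: admissible_shift.
Qed.

Lemma same_gauss_trans l1 l2 l3 :
  same_gauss l1 l2 -> same_gauss l2 l3 -> same_gauss l1 l3.
Proof. by move=> h h' psi a; rewrite h// h'. Qed.

Lemma same_gauss_cons0 l : same_gauss (0%R :: l) l.
Proof.
move=> psi a /=; under eq_integral do under eq_fun do rewrite scaler0 add0r.
rewrite integral_cst// [X in _ * X](_ : _ = 1) ?mule1//.
exact: probability_setT.
Qed.

(** With the inner integrals collected in a function [k] of the first two variables, this is the
    invariance of the Gaussian measure of the plane. *)
Lemma same_gauss_rotate l x y (c s : R) : (c ^+ 2 + s ^+ 2 = 1)%R -> s != 0%R ->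
  same_gauss (x :: y :: l) ((c *: x + s *: y) :: (c *: y - s *: x) :: l)%R.
Proof.
move=> cs1 s0 psi a.
pose k (z : R * R) := gauss_mean l (fun w => psi (z.1 *: x + z.2 *: y + w)%R).
have mk : measurable_fun setT k.
  apply: (@gauss_mean_measurable l _ _ (fun z : R * R => z.1 *: x + z.2 *: y)%R) => //.
  by apply: simple_limit_add; exact: simple_limit_scale.
have k0 z : 0 <= k z by apply: gauss_mean_ge0 => w; case: a.
have := ge0_integral_gauss_rotate mk k0 cs1 s0.
rewrite /k/= => /esym; congr (_ = _); apply: eq_integral => t _;
  apply: eq_integral => u _; congr gauss_mean; apply/funext => w.
  by rewrite addrA.
by rewrite addrA scale_rotate.
Qed.

End Fixed.

Lemma gauss_mean_map (E E' : normedModType R) (A : E -> E') (l : seq E) psi :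
  A 0%R = 0%R -> (forall t x y, A (t *: x + y)%R = (t *: A x + A y)%R) ->
  gauss_mean (map A l) psi = gauss_mean l (psi \o A).
Proof.
move=> A0 AD; elim: l psi => [|x l IH] psi /=; first by rewrite A0.
apply: eq_integral => t _; rewrite IH; congr gauss_mean.
by apply/funext => z /=; rewrite AD.
Qed.

Lemma gauss_expectationE (E : normedModType R) n (x : 'I_n -> E) (psi : E -> R) :
  gauss_expectation (fun u : n.-tuple R => (psi (\sum_(j < n) tnth u j *: x j)%R)%:E)
  = gauss_mean [seq x i | i <- enum 'I_n] psi.
Proof.
elim: n x psi => [|n IH] x psi /=.
  by rewrite big_ord0 (size0nil (s := enum _)) ?size_enum_ord.
rewrite enum_ordSl/=; apply: eq_integral => t _.
rewrite -map_comp -(IH (x \o lift ord0) (fun z => psi (t *: x ord0 + z)%R)).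
congr gauss_expectation; apply/funext => u; rewrite big_ord_recl.
congr (psi (_ + _)%R)%:E.
by apply: eq_bigr => i _; rewrite tnthS.
Qed.

End GaussianSums.
(** * Orthonormal systems *)

Section OrthonormalSystems.
Context (R : realType) (H : completeNormedModType R).
Context (ip : {dot H for (@idfun R)}).

Lemma ipDl a b c : ip (a + b) c = ip a c + ip b c. Proof. exact: linearDl. Qed.

Lemma ipDr a b c : ip a (b + c) = ip a b + ip a c. Proof. exact: linearDr. Qed.

Lemma ipZl k b c : ip (k *: b) c = k * ip b c. Proof. by rewrite linearZl_LR. Qed.

Lemma ipZr k b c : ip b (k *: c) = k * ip b c. Proof. by rewrite linearZr. Qed.

Lemma ipNl b c : ip (- b) c = - ip b c. Proof. exact: linearNl. Qed.

Lemma ipNr b c : ip b (- c) = - ip b c. Proof. exact: linearNr. Qed.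

Lemma ipC a b : ip a b = ip b a. Proof. by rewrite hermC expr0 mul1r. Qed.

Fixpoint orthonormal_seq (l : seq H) : Prop :=
  if l is h :: l' then
    [/\ ip h h = 1, forall g, g \in l' -> ip h g = 0 & orthonormal_seq l']
  else True.

Definition orthogonal_to (v : H) (l : seq H) := forall g, g \in l -> ip v g = 0.

Lemma orthogonal_to_cons v h l :
  orthogonal_to v (h :: l) <-> ip v h = 0 /\ orthogonal_to v l.
Proof.
split=> [vl|[vh vl] g]; last by rewrite inE => /predU1P[->|/vl].
by split=> [|g gl]; apply: vl; rewrite inE ?eqxx ?gl ?orbT.
Qed.

Lemma orthogonal_to_sum v (l : seq H) (c : H -> R) :
  orthogonal_to v l -> ip v (\sum_(g <- l) c g *: g) = 0.
Proof.
elim: l => [|g l IH] vl; first by rewrite big_nil linear0r.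
have /orthogonal_to_cons[vg {}vl] := vl.
by rewrite big_cons ipDr ipZr vg mulr0 add0r IH.
Qed.

Lemma ip_projection (l : seq H) (e h : H) : orthonormal_seq l -> h \in l ->
  ip h (\sum_(g <- l) ip g e *: g) = ip h e.
Proof.
elim: l => // g l IH [g1 gl ol]; rewrite big_cons ipDr ipZr inE => /predU1P[->|hl].
  by rewrite g1 mulr1 orthogonal_to_sum ?addr0.
by rewrite (ipC h g) (gl h)// mulr0 add0r IH.
Qed.

Section Operators.
Context (E : normedModType R).
Implicit Types (l r : seq (H * E)).

Definition tensor_sum l : H -> E := \sum_(p <- l) tensor ip p.1 p.2.

Lemma tensor_sum_cons p l : tensor_sum (p :: l) = tensor ip p.1 p.2 + tensor_sum l.
Proof. by rewrite /tensor_sum big_cons. Qed.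

Lemma tensor_rotate h g (x y : E) (c s : R) : c ^+ 2 + s ^+ 2 = 1 ->
  tensor ip (c *: h + s *: g) (c *: x + s *: y) +
  tensor ip (c *: g - s *: h) (c *: y - s *: x) =
  tensor ip h x + tensor ip g y.
Proof.
move=> cs1; apply/funext => k; rewrite /tensor !fctE.
rewrite !ipDl ipNl !ipZl scale_rotate; congr (_ *: _ + _ *: _).
  by rewrite -[RHS]mul1r -cs1; ring.
by rewrite -[RHS]mul1r -cs1; ring.
Qed.

(* Givens rotations of one pair of vectors at a time. *)
Lemma pivot e l : l != [::] -> orthonormal_seq (map fst l) ->
  exists g x r rho, [/\ orthonormal_seq (g :: map fst r),
    tensor_sum ((g, x) :: r) = tensor_sum l,
    same_gauss (x :: map snd r) (map snd l),
    \sum_(h <- map fst l) ip h e *: h = rho *: g &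
    forall v, orthogonal_to v (map fst l) -> orthogonal_to v (g :: map fst r)].
Proof.
elim: l => // -[h x] [|p l] IH _ /=.
  by move=> ol; exists h, x, [::], (ip h e); split=> //; rewrite big_seq1.
move=> [h1 hl ol].
have [g0 [x0 [r0 [rho0 [og op sg pg perp]]]]] := IH isT ol.
have hg0 := perp h hl; have /orthogonal_to_cons[hg0h hr0] := hg0.
(* If [rho0 = 0] the projection of [e] already lies along [h]; otherwise the sine of the rotation
   below is nonzero. *)
have [rho00|rho0n0] := eqVneq rho0 0.
  exists h, x, ((g0, x0) :: r0), (ip h e); split=> //.
  - by rewrite tensor_sum_cons op -tensor_sum_cons.
  - exact: same_gauss_cons.
  - by rewrite big_cons pg rho00 scale0r addr0.
  - by move=> v /orthogonal_to_cons[vh vl]; apply/orthogonal_to_cons; split=> //; exact: perp.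
(* The projection of [e] is [a *: h + rho0 *: g0], of length [rho]; the rotation sends [h] to its
   direction and leaves the orthogonal vector in the remainder. *)
pose a := ip h e; pose rho : R := Num.sqrt (a ^+ 2 + rho0 ^+ 2).
have rho2 : rho ^+ 2 = a ^+ 2 + rho0 ^+ 2 by rewrite sqr_sqrtr// addr_ge0 ?sqr_ge0.
have rhon0 : rho != 0.
  rewrite -sqrf_eq0 rho2 gt_eqF// ltr_wpDl ?sqr_ge0//.
  by rewrite lt0r sqr_ge0 sqrf_eq0 rho0n0.
pose c := a / rho; pose s := rho0 / rho.
have cs1 : c ^+ 2 + s ^+ 2 = 1.
  by rewrite !expr_div_n -mulrDl -rho2 divff// sqrf_eq0.
have sn0 : s != 0 by rewrite mulf_neq0// invr_eq0.
case: og => g01 g0r or0.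
exists (c *: h + s *: g0), (c *: x + s *: x0),
  ((c *: g0 - s *: h, c *: x0 - s *: x) :: r0), rho; split=> //=.
- split.
  + rewrite !ipDl !ipDr !ipZl !ipZr h1 g01 (ipC g0 h) hg0h.
    by rewrite -[RHS]cs1; ring.
  + move=> k; rewrite inE => /predU1P[->|kr].
      by rewrite !ipDl !ipDr !ipZl !ipNr !ipZr h1 g01 (ipC g0 h) hg0h; ring.
    by rewrite !ipDl !ipZl hr0// g0r// !mulr0 addr0.
  + split=> //.
      rewrite !ipDl !ipDr !ipNl !ipNr !ipZl !ipZr h1 g01 (ipC g0 h) hg0h.
      by rewrite -[RHS]cs1; ring.
    by move=> k kr; rewrite !ipDl ipNl !ipZl hr0// g0r// !mulr0 subr0.
- by rewrite [RHS]tensor_sum_cons -op !tensor_sum_cons/= !addrA tensor_rotate.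
- apply: (same_gauss_trans _ (same_gauss_cons x sg)).
  by move=> psi ap; apply/esym; exact: same_gauss_rotate.
- rewrite big_cons pg scalerDr !scalerA /c /s.
  by rewrite ![rho * _]mulrC !divfK.
- move=> v /orthogonal_to_cons[vh /perp/orthogonal_to_cons[vg vr]].
  apply/orthogonal_to_cons; split.
    by rewrite ipDr !ipZr vh vg !mulr0 addr0.
  apply/orthogonal_to_cons; split=> //.
  by rewrite ipDr ipNr !ipZr vh vg !mulr0 subr0.
Qed.

Lemma same_gaussN (x : E) (l : seq E) : same_gauss (- x :: l) (x :: l).
Proof.
have h : same_gauss (x :: 0 :: l) (0 :: - x :: l).
  have := @same_gauss_rotate R E l x 0 0 1.
  rewrite !scale0r !scale1r add0r sub0r.
  by apply; [rewrite expr0n/= add0r expr1n|exact: oner_neq0].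
move=> psi ap; rewrite -same_gauss_cons0// -h//.
by apply: same_gauss_cons => //; exact: same_gauss_cons0.
Qed.

(** A unit vector [e] can be made the first vector of a representation: once [e] is in the span of
    the system, [pivot] produces [e] up to sign. *)
Lemma orthonormal_adjoin e l : ip e e = 1 -> orthonormal_seq (map fst l) ->
  exists x r, [/\ orthonormal_seq (e :: map fst r),
    tensor_sum ((e, x) :: r) = tensor_sum l,
    same_gauss (x :: map snd r) (map snd l) &
    forall v, ip v e = 0 -> orthogonal_to v (map fst l) ->
      orthogonal_to v (map fst r)].
Proof.
move=> e1 ol.
pose pr := \sum_(h <- map fst l) ip h e *: h; pose u := e - pr.
have ue h : h \in map fst l -> ip u h = 0.
  by move=> hl; rewrite ipC ipDr ipNr ip_projection// subrr.
(* If [e] is not in the span, its normalised orthogonal component is added with coefficient 0, which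
   changes neither the operator nor the Gaussian sum. *)
have [l' [ln0 ol' op' sg' [pe' perp']]] : exists l', [/\ l' != [::],
    orthonormal_seq (map fst l'), tensor_sum l' = tensor_sum l,
    same_gauss (map snd l') (map snd l) &
    \sum_(h <- map fst l') ip h e *: h = e /\
    forall v, ip v e = 0 -> orthogonal_to v (map fst l) ->
      orthogonal_to v (map fst l')].
  have [u0|un0] := eqVneq u 0.
    have epr : pr = e by apply/esym/eqP; rewrite -subr_eq0 -/u u0.
    exists l; split=> //; apply/eqP => l0; move: epr e1; rewrite /pr l0 big_nil => <-.
    by rewrite linear0r => /esym/eqP; rewrite oner_eq0.
  have uu : 0 < ip u u by exact: neq0_dnorm_gt0.
  pose n : R := Num.sqrt (ip u u).
  have nn : n ^+ 2 = ip u u by rewrite sqr_sqrtr// ltW.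
  have nn0 : n != 0 by rewrite gt_eqF// sqrtr_gt0.
  have uel : ip u e = ip u u.
    by rewrite {3}/u ipDr ipNr orthogonal_to_sum ?subr0.
  exists ((n^-1 *: u, 0) :: l); split=> //=.
  - split=> //.
      by rewrite ipZl ipZr -nn mulrA -expr2 -exprMn mulVf// expr1n.
    by move=> g gl; rewrite ipZl ue// mulr0.
  - rewrite tensor_sum_cons/= (_ : tensor _ _ _ = 0) ?add0r//.
    by apply/funext => k; rewrite /tensor scaler0.
  - exact: same_gauss_cons0.
  split.
    rewrite big_cons -/pr ipZl uel scalerA -nn mulrAC -expr2 -exprMn mulVf// expr1n.
    by rewrite scale1r /u subrK.
  move=> v ve vl; apply/orthogonal_to_cons; split=> //.
  by rewrite ipZr ipDr ipNr ve orthogonal_to_sum// subrr mulr0.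
have [g [x [r [rho [og op sg pg perp]]]]] := pivot e ln0 ol'.
rewrite pe' in pg.
have g1 : ip g g = 1 by case: og.
have : rho ^+ 2 = 1 by rewrite -e1 pg ipZl ipZr g1 mulr1.
have vr v : ip v e = 0 -> orthogonal_to v (map fst l) -> orthogonal_to v (map fst r).
  by move=> ve vl; have /orthogonal_to_cons[] := perp v (perp' v ve vl).
(* Both [g] and [e = rho *: g] are unit vectors. When [rho = -1], the vector and its coefficient are
   negated together, so the tensor is unchanged. *)
move=> /eqP; rewrite sqrf_eq1 => /orP[]/eqP rhoE; rewrite rhoE in pg.
  rewrite scale1r in pg; rewrite pg; exists x, r; split=> //.
  - by rewrite op.
  - exact: same_gauss_trans sg sg'.
  - by rewrite -pg.
rewrite scaleN1r in pg; rewrite pg; exists (- x), r; split=> //.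
- case: og => _ gr orr; split=> //.
    by rewrite ipNl ipNr opprK.
  by move=> k kr; rewrite ipNl gr// oppr0.
- rewrite -op' -op !tensor_sum_cons/=; congr (_ + _); apply/funext => k.
  by rewrite /tensor ipNl scaleNr scalerN opprK.
- exact: same_gauss_trans (same_gaussN _ _) (same_gauss_trans sg sg').
- by rewrite -pg.
Qed.

(** An operator can be rewritten on any prescribed orthonormal list, enlarged by a remainder,
    without changing its Gaussian law. The last clause serves the induction: it keeps the vectors
    already adjoined orthogonal to later remainders. *)
Lemma orthonormal_extend (es : seq H) l :
  orthonormal_seq es -> orthonormal_seq (map fst l) ->
  exists xs r, [/\ size xs = size es,
    orthonormal_seq (es ++ map fst r),
    tensor_sum (zip es xs ++ r) = tensor_sum l,
    same_gauss (xs ++ map snd r) (map snd l) &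
    forall v, orthogonal_to v es -> orthogonal_to v (map fst l) ->
      orthogonal_to v (map fst r)].
Proof.
elim: es l => [|e es IH] l /=.
  by move=> _ ol; exists [::], l; split.
move=> [e1 ees oes] ol.
have [x [r [[_ er or] op sg perp]]] := orthonormal_adjoin e1 ol.
have [xs [r' [sz or' op' sg' perp']]] := IH r oes or.
exists (x :: xs), r'; split=> /=.
- by rewrite sz.
- split=> // g; rewrite mem_cat => /orP[/ees//|].
  exact: perp'.
- by rewrite tensor_sum_cons op' -tensor_sum_cons.
- exact: same_gauss_trans (same_gauss_cons _ sg') sg.
- move=> v /orthogonal_to_cons[ve ves] vl; apply: perp' => //; exact: perp.
Qed.

End Operators.
End OrthonormalSystems.
(** * The norm of gamma(H, E) *)

(** Reduces a triangle inequality between infima to near-minimisers, the infinite cases included. *)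
Lemma le_add_of_lt (R : realType) (x y z : \bar R) : (0 <= x)%E -> (0 <= y)%E ->
  (forall a b : R, (x < a%:E)%E -> (y < b%:E)%E -> (z <= (a + b)%:E)%E) ->
  (z <= x + y)%E.
Proof.
case: x => [x| |]//; last by case: y => [y| |]// _ _ _; exact: leey.
case: y => [y| |]// _ _; last by move=> _; exact: leey.
move=> h; apply/lee_addgt0Pr => e e0.
have e20 : 0 < e / 2 by rewrite divr_gt0.
have := h (x + e / 2) (y + e / 2).
rewrite !lte_fin !ltrDl => /(_ e20 e20) /le_trans; apply.
by rewrite -!EFinD lee_fin; lra.
Qed.

Lemma le_scale_of_lt (R : realType) (x z : \bar R) (C : R) : 0 < C -> (0 <= x)%E ->
  (forall a : R, (x < a%:E)%E -> (z <= (C * a)%:E)%E) -> (z <= C%:E * x)%E.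
Proof.
move=> C0; case: x => [x| |]// _; last by move=> _; rewrite gt0_muley ?lte_fin// leey.
move=> h; apply/lee_addgt0Pr => e e0.
have eC : 0 < e / C by rewrite divr_gt0.
have := h (x + e / C); rewrite lte_fin ltrDl => /(_ eC) /le_trans; apply.
by rewrite -EFinM -EFinD lee_fin mulrDr mulrCA divff ?mulr1// gt_eqF.
Qed.

Section FiniteRankNorm.
Context (R : realType) (H : completeNormedModType R).
Context (ip : {dot H for (@idfun R)}).

Definition sqnorm (E : normedModType R) (z : E) : R := `|z| ^+ 2.

Lemma admissible_sqnorm (E : normedModType R) : admissible (@sqnorm E).
Proof.
split=> [z|z]; last by rewrite sqr_ge0.
have -> : @sqnorm E = (fun z => `|z| * `|z|) by apply/funext => y; rewrite /sqnorm expr2.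
by apply: cvgM; exact: norm_continuous.
Qed.

Lemma admissible_comp (E E' : normedModType R) (f : E -> E') (psi : E' -> R) :
  continuous f -> admissible psi -> admissible (psi \o f).
Proof.
move=> cf [cp p0]; split=> [z|z]; last exact: p0.
by apply: continuous_comp; [exact: cf|exact: cp].
Qed.

Lemma admissibleZ (E : normedModType R) (psi : E -> R) (k : R) : 0 <= k ->
  admissible psi -> admissible (fun z => k * psi z).
Proof.
move=> k0 [cp p0]; split=> [z|z]; last by rewrite mulr_ge0.
by apply: cvgM; [exact: cvg_cst|exact: cp].
Qed.

Lemma admissibleD (E : normedModType R) (psi psi' : E -> R) :
  admissible psi -> admissible psi' -> admissible (fun z => psi z + psi' z).
Proof.
move=> [cp p0] [cp' p0']; split=> [z|z]; last by rewrite addr_ge0.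
by apply: cvgD; [exact: cp|exact: cp'].
Qed.

(* From [(u + v)^2 <= (1 + b/a) u^2 + (1 + a/b) v^2]. *)
Lemma gauss_mean_minkowski (E : normedModType R) (l : seq (E * E)) (a b : R) :
  0 < a -> 0 < b ->
  (gauss_mean (map fst l) (@sqnorm E) <= (a ^+ 2)%:E)%E ->
  (gauss_mean (map snd l) (@sqnorm E) <= (b ^+ 2)%:E)%E ->
  (gauss_mean (map (fun z => z.1 + z.2)%R l) (@sqnorm E) <= ((a + b) ^+ 2)%:E)%E.
Proof.
move=> a0 b0.
have cf : continuous (@fst E E) by move=> z; exact: cvg_fst.
have cs : continuous (@snd E E) by move=> z; exact: cvg_snd.
have cD : continuous (fun z : E * E => z.1 + z.2) by exact: add_continuous.
(* The three sums become linear images of a single Gaussian sum in [E * E]. *)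
rewrite !gauss_mean_map//; last 2 first.
- by rewrite /= addr0.
- by move=> t x y /=; rewrite scalerDr addrACA.
have a1 := admissible_comp cf (admissible_sqnorm E).
have a2 := admissible_comp cs (admissible_sqnorm E).
have a3 := admissible_comp cD (admissible_sqnorm E).
(* The weights satisfy [k1 * a ^+ 2 + k2 * b ^+ 2 = (a + b) ^+ 2], so the pointwise estimate
   integrates to the sharp bound. *)
set k1 := 1 + b / a; set k2 := 1 + a / b => la lb.
have k10 : 0 <= k1 by rewrite addr_ge0// divr_ge0// ltW.
have k20 : 0 <= k2 by rewrite addr_ge0// divr_ge0// ltW.
apply: (@le_trans _ _ (gauss_mean l
    (fun z => k1 * (@sqnorm E \o fst) z + k2 * (@sqnorm E \o snd) z))).
  apply: le_gauss_mean => //.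
    by apply: admissibleD; exact: admissibleZ.
  move=> z; rewrite /sqnorm/=.
  apply: (@le_trans _ _ ((`|z.1| + `|z.2|) ^+ 2)).
    by rewrite ler_sqr ?nnegrE ?addr_ge0// ler_normD.
  rewrite -subr_ge0.
  have -> : k1 * `|z.1| ^+ 2 + k2 * `|z.2| ^+ 2 - (`|z.1| + `|z.2|) ^+ 2 =
     (b * `|z.1| - a * `|z.2|) ^+ 2 / (a * b).
    by rewrite /k1 /k2; field; rewrite !gt_eqF.
  by rewrite divr_ge0 ?sqr_ge0// mulr_ge0// ltW.
rewrite gauss_meanD; [|exact: admissibleZ|exact: admissibleZ].
rewrite !gauss_meanZ//.
apply: (@le_trans _ _ (k1%:E * (a ^+ 2)%:E + k2%:E * (b ^+ 2)%:E)%E).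
  by apply: leeD; apply: lee_wpmul2l.
rewrite -!EFinM -EFinD lee_fin le_eqVlt; apply/orP; left; apply/eqP.
by rewrite /k1 /k2; field; rewrite !gt_eqF.
Qed.

Lemma poweR_half_le (x : \bar R) (a : R) : (0 <= x)%E -> 0 <= a ->
  (x `^ 2^-1 <= a%:E)%E = (x <= (a ^+ 2)%:E)%E.
Proof.
case: x => [x| |]// x0 a0.
  rewrite poweR_EFin powR12_sqrt// !lee_fin.
  by rewrite -[RHS]ler_sqrt ?sqr_ge0// sqrtr_sqr ger0_norm.
by rewrite poweRyr ?gt_eqF ?invr_gt0// !leye_eq.
Qed.

Section Norm.
Context (E : normedModType R).
Implicit Types (T : H -> E) (l : seq (H * E)).
Local Notation frn := (finite_rank_gamma_norm ip).

Definition gauss_norm l : \bar R := (gauss_mean (map snd l) (@sqnorm E) `^ 2^-1)%E.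

Lemma gauss_norm_ge0 l : (0 <= gauss_norm l)%E.
Proof. by rewrite poweR_ge0. Qed.

Lemma orthonormal_seq_system n (h : 'I_n -> H) :
  orthonormal_system ip h -> orthonormal_seq ip [seq h i | i <- enum 'I_n].
Proof.
move=> oh; have := enum_uniq 'I_n; elim: (enum 'I_n) => // i s IH /= /andP[si us].
split=> [||]; [by rewrite oh eqxx| |exact: IH].
move=> g /mapP[j js ->]; rewrite oh; case: eqP => // ij.
by rewrite ij js in si.
Qed.

Lemma orthonormal_seq_nth (l : seq H) : orthonormal_seq ip l ->
  forall i j, (i < size l)%N -> (j < size l)%N ->
  ip (nth 0 l i) (nth 0 l j) = (i == j)%:R.
Proof.
elim: l => // h l IH [h1 hl ol] [|i] [|j]//= i1 j1.
- by rewrite hl// mem_nth.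
- by rewrite ipC hl// mem_nth.
- exact: IH.
Qed.

Lemma finite_rank_gamma_normP T : frn T = ereal_inf [set r | exists l,
  [/\ orthonormal_seq ip (map fst l), T = tensor_sum ip l & r = gauss_norm l]].
Proof.
rewrite /finite_rank_gamma_norm; congr ereal_inf; apply/seteqP; split=> r.
  move=> [n [h [x [oh -> ->]]]]; exists [seq (h i, x i) | i <- enum 'I_n]; split.
  - by rewrite -map_comp; exact: orthonormal_seq_system.
  - by rewrite /tensor_sum big_map big_enum.
  - rewrite /gauss_norm -map_comp.
    by rewrite -(@gauss_expectationE R E n x (@sqnorm E)).
move=> [l [ol -> ->]].
pose z := nth (0 : H, 0 : E) l.
exists (size l), (fun i => (z i).1), (fun i => (z i).2); split.
- move=> i j; have := orthonormal_seq_nth ol (i := i) (j := j).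
  rewrite size_map => /(_ (ltn_ord i) (ltn_ord j)).
  by rewrite !(nth_map (0 : H, 0 : E)).
- rewrite /tensor_sum (big_nth (0 : H, 0 : E)) big_mkord; apply: eq_bigr => i _.
  by [].
- rewrite /gauss_norm; congr (_ `^ _)%E.
  rewrite (@gauss_expectationE R E _ (fun i : 'I_(size l) => (z i).2) (@sqnorm E)).
  congr gauss_mean.
  by rewrite -[in LHS](mkseq_nth (0 : H, 0 : E) l) -map_comp/= -val_enum_ord -map_comp.
Qed.

Lemma finite_rank_gamma_norm_ge0 T : (0 <= frn T)%E.
Proof.
rewrite finite_rank_gamma_normP; apply: le_ereal_inf_tmp => _ [l [_ _ ->]].
exact: gauss_norm_ge0.
Qed.

Lemma finite_rank_gamma_norm_le l : orthonormal_seq ip (map fst l) ->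
  (frn (tensor_sum ip l) <= gauss_norm l)%E.
Proof. by move=> ol; rewrite finite_rank_gamma_normP; apply: ereal_inf_lbound; exists l. Qed.

Lemma finite_rank_gamma_norm_lt T (a : R) : (frn T < a%:E)%E ->
  exists l, [/\ orthonormal_seq ip (map fst l), T = tensor_sum ip l,
    0 < a & (gauss_mean (map snd l) (@sqnorm E) <= (a ^+ 2)%:E)%E].
Proof.
move=> Ta; have a0 : 0 < a.
  by rewrite -lte_fin (le_lt_trans _ Ta)// finite_rank_gamma_norm_ge0.
move: Ta; rewrite finite_rank_gamma_normP => /ereal_inf_lt[_ [l [ol Tl ->]] /ltW la].
exists l; split=> //; rewrite -poweR_half_le ?(ltW a0)//.
by apply: gauss_mean_ge0 => z; case: (admissible_sqnorm E).
Qed.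

(** Coefficients are added on the common system [map fst l ++ map fst r], along whose second part
    [l] has coefficient 0. *)
Lemma tensor_sum_zipD l r (xs : seq E) : size xs = size l ->
  tensor_sum ip (zip (map fst l ++ map fst r)
    (map (fun z => z.1 + z.2)
      (zip (xs ++ map snd r) (map snd l ++ nseq (size r) 0)))) =
  tensor_sum ip (zip (map fst l) xs ++ r) + tensor_sum ip l.
Proof.
elim: l xs => [|p l IH] [|x xs]//=.
  move=> _; rewrite [X in _ = _ + X]big_nil addr0.
  elim: r => [|p r IH] //=; rewrite !tensor_sum_cons/= IH; congr (_ + _).
  by rewrite addr0.
move=> [sz]; rewrite !tensor_sum_cons/= IH// addrACA; congr (_ + _).
by apply/funext => k; rewrite /tensor/= !fctE scalerDr.
Qed.

(** Near-optimal representations of [T] and [T'] use unrelated systems. Rewriting [T] on the system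
    of [T'], enlarged by [r], leaves its Gaussian law unchanged, and Minkowski's inequality then
    applies to the coefficients. *)
Lemma finite_rank_gamma_normD T T' : (frn (T + T')%R <= frn T + frn T')%E.
Proof.
apply: le_add_of_lt; rewrite ?finite_rank_gamma_norm_ge0// => a b.
move=> /finite_rank_gamma_norm_lt[l [ol -> a0 la]].
move=> /finite_rank_gamma_norm_lt[l' [ol' -> b0 lb]].
have [xs [r [sz orr op sg _]]] := orthonormal_extend ol' ol.
have szm : size xs = size l' by rewrite sz size_map.
pose es := map fst l' ++ map fst r.
pose zs := zip (xs ++ map snd r) (map snd l' ++ nseq (size r) 0).
pose L := zip es (map (fun z => z.1 + z.2) zs).
have szz : size (xs ++ map snd r) = size (map snd l' ++ nseq (size r) (0 : E)).
  by rewrite !size_cat size_nseq !size_map szm.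
have szL : size es = size (map (fun z : E * E => z.1 + z.2) zs).
  by rewrite size_map size_zip -szz minnn !size_cat !size_map szm.
have L1 : map fst L = es by rewrite -/(unzip1 _) unzip1_zip// szL.
have L2 : map snd L = map (fun z => z.1 + z.2) zs by rewrite -/(unzip2 _) unzip2_zip// szL.
have <- : tensor_sum ip L = tensor_sum ip l + tensor_sum ip l'.
  by rewrite -op -tensor_sum_zipD.
apply: le_trans (finite_rank_gamma_norm_le _) _; first by rewrite L1.
rewrite /gauss_norm L2 poweR_half_le ?addr_ge0 ?(ltW a0) ?(ltW b0)//; last first.
  by apply: gauss_mean_ge0 => z; case: (admissible_sqnorm E).
apply: gauss_mean_minkowski => //.
  by rewrite -/(unzip1 _) unzip1_zip ?szz// sg//; exact: admissible_sqnorm.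
rewrite -/(unzip2 _) unzip2_zip ?szz//.
suff -> : gauss_mean (map snd l' ++ nseq (size r) 0) (@sqnorm E) =
          gauss_mean (map snd l') (@sqnorm E) by [].
have : same_gauss (map snd l' ++ nseq (size r) 0) (map snd l'); last first.
  by apply; exact: admissible_sqnorm.
elim: (l') => [|p s IH] /=; last exact: same_gauss_cons.
elim: (size r) => [//|n IH]; exact: same_gauss_trans (same_gauss_cons0 _) IH.
Qed.

Lemma finite_rank_gamma_norm0 : frn (0 : H -> E) = 0%E.
Proof.
apply/eqP; rewrite eq_le finite_rank_gamma_norm_ge0 andbT.
have := @finite_rank_gamma_norm_le [::] I.
rewrite /gauss_norm/= /tensor_sum big_nil => /le_trans; apply.
by rewrite /sqnorm normr0 expr0n/= powR0// invr_eq0 pnatr_eq0.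
Qed.

End Norm.

(** [A] acts on the coefficients only, so the orthonormal system is kept. It is a bare function with
    linearity as a hypothesis, so that differences of derivatives qualify later. *)
Lemma finite_rank_gamma_norm_comp (E E' : normedModType R) (A : E -> E') (C : R)
    (T : H -> E) :
  (forall t x y, A (t *: x + y) = t *: A x + A y) -> 0 < C ->
  (forall x, `|A x| <= C * `|x|) ->
  (finite_rank_gamma_norm ip (A \o T) <= C%:E * finite_rank_gamma_norm ip T)%E.
Proof.
move=> Alin C0 AC.
have A0 : A 0 = 0.
  by have := AC 0; rewrite normr0 mulr0 normr_le0 => /eqP.
apply: le_scale_of_lt; rewrite ?finite_rank_gamma_norm_ge0//.
move=> a /finite_rank_gamma_norm_lt[l [ol -> a0 la]].
pose L := [seq (p.1, A p.2) | p <- l].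
have <- : tensor_sum ip L = A \o tensor_sum ip l.
  rewrite /L {ol la L}; elim: l => [|p l IH] /=.
    by rewrite /tensor_sum !big_nil; apply/funext => k; rewrite /= A0.
  rewrite !tensor_sum_cons IH; apply/funext => k.
  by rewrite /tensor/= !fctE/= Alin.
apply: le_trans (finite_rank_gamma_norm_le _) _; first by rewrite /L -map_comp.
have cA : continuous A.
  move=> x; apply/cvgrPdist_le => e e0; near=> y.
  rewrite (_ : A x - A y = A (x - y)); last first.
    by rewrite (_ : x - y = -1 *: y + x) ?Alin scaleN1r addrC.
  apply: le_trans (AC _) _; rewrite -ler_pdivlMl// mulrC.
  near: y; have /cvgrPdist_le := @cvg_id _ (nbhs x).
  by apply; rewrite divr_gt0.
have apA := admissible_comp cA (admissible_sqnorm E').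
rewrite /gauss_norm poweR_half_le ?mulr_ge0 ?(ltW C0) ?(ltW a0)//; last first.
  by apply: gauss_mean_ge0 => z; case: (admissible_sqnorm E').
rewrite /L -map_comp (map_comp A snd l) gauss_mean_map//.
apply: (@le_trans _ _ (gauss_mean (map snd l) (fun z => C ^+ 2 * sqnorm z))).
  apply: le_gauss_mean => //.
    by apply: admissibleZ; [rewrite sqr_ge0|exact: admissible_sqnorm].
  move=> z; rewrite /sqnorm/= -exprMn ler_sqr ?nnegrE//.
  by rewrite mulr_ge0// ltW.
rewrite gauss_meanZ ?sqr_ge0//; last exact: admissible_sqnorm.
by rewrite exprMn (EFinM (C ^+ 2)); apply: lee_wpmul2l => //; rewrite lee_fin sqr_ge0.
Unshelve. all: by end_near. Qed.

(** With [u = t ^+ 2 / 4] and [u * expR (- u) <= 1], the integrand is at most a multiple of the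
    normal density of variance 2, whose integral is 1. *)
Lemma normal_second_moment : exists K : R, 0 < K /\
  (\int[@normal_prob R 0 1]_t (t ^+ 2)%:E <= (K ^+ 2)%:E)%E.
Proof.
pose s : R := Num.sqrt 2.
have s2 : s ^+ 2 = 2 by rewrite sqr_sqrtr.
have sn0 : s != 0 by rewrite gt_eqF// sqrtr_gt0.
have p1 : 0 < normal_peak (1 : R) by rewrite normal_peak_gt0 ?oner_neq0.
have ps : 0 < normal_peak s by rewrite normal_peak_gt0.
pose k : R := 4 * normal_peak 1 / normal_peak s.
have k0 : 0 < k by rewrite divr_gt0// mulr_gt0.
exists (Num.sqrt k); split; first by rewrite sqrtr_gt0.
rewrite sqr_sqrtr ?(ltW k0)//.
have msq : measurable_fun setT (fun t : R => (t ^+ 2)%:E).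
  by apply/measurable_EFinP; apply: measurable_funX.
rewrite ge0_integral_normal_prob//; last by move=> t; rewrite lee_fin sqr_ge0.
apply: (@le_trans _ _ (\int[lebesgue_measure]_t (k%:E * (normal_pdf 0 s t)%:E))%E).
  apply: ge0_le_integral => //.
  - by move=> t _; rewrite mule_ge0// lee_fin ?sqr_ge0// normal_pdf_ge0.
  - apply: emeasurable_funM => //; apply/measurable_EFinP.
    exact: measurable_normal_pdf.
  - apply: emeasurable_funM => //; apply/measurable_EFinP.
    exact: measurable_normal_pdf.
  move=> t _; rewrite -!EFinM lee_fin !normal_pdfE ?oner_neq0// /normal_fun.
  rewrite !subr0 s2 expr1n; pose u := t ^+ 2 / 4.
  have -> : - t ^+ 2 / (1 *+ 2) = - u + - u by rewrite /u; field.
  have -> : - t ^+ 2 / (2 *+ 2) = - u by rewrite /u; field.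
  have -> : k * (normal_peak s * expR (- u)) = normal_peak 1 * expR (- u) * 4.
    by rewrite /k; field; rewrite gt_eqF.
  have ue : u * expR (- u) <= 1.
    rewrite expRN ler_pdivrMr ?expR_gt0// mul1r.
    by apply: le_trans (expR_ge1Dx u); rewrite lerDr.
  have -> : t ^+ 2 = 4 * u by rewrite /u; field.
  rewrite expRD (_ : 4 * u * _ = normal_peak 1 * expR (- u) * 4 * (u * expR (- u))).
    by rewrite ler_piMr// mulr_ge0// mulr_ge0 ?expR_ge0// ltW.
  by ring.
rewrite ge0_integralZl//=; last 3 first.
- by apply/measurable_EFinP; exact: measurable_normal_pdf.
- by move=> t _; rewrite lee_fin normal_pdf_ge0.
- by rewrite lee_fin ltW.
by rewrite integral_normal_pdf mule1.
Qed.

Lemma finite_rank_gamma_norm_tensor : exists K : R, 0 < K /\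
  forall (E : normedModType R) (h : H) (x : E),
    (finite_rank_gamma_norm ip (tensor ip h x) <=
      (K * (Num.sqrt (ip h h) * `|x|))%:E)%E.
Proof.
have [K [K0 HK]] := normal_second_moment; exists K; split=> // E h x.
have [->|hn0] := eqVneq h 0.
  rewrite (_ : tensor _ _ _ = 0) ?finite_rank_gamma_norm0 ?lee_fin.
    by rewrite mulr_ge0 ?(ltW K0)// mulr_ge0 ?sqrtr_ge0.
  by apply/funext => k; rewrite /tensor linear0l scale0r.
have hh : 0 < ip h h by exact: neq0_dnorm_gt0.
pose n : R := Num.sqrt (ip h h).
have nn : n ^+ 2 = ip h h by rewrite sqr_sqrtr// ltW.
have n0 : 0 < n by rewrite sqrtr_gt0.
have nn0 : n != 0 by rewrite gt_eqF.
(* [h] is normalised, and its length is moved to [x]. *)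
pose l := [:: (n^-1 *: h, n *: x)].
have -> : tensor ip h x = tensor_sum ip l.
  rewrite /tensor_sum big_seq1/=; apply/funext => k.
  by rewrite /tensor ipZl scalerA mulrAC mulVf// mul1r.
apply: le_trans (finite_rank_gamma_norm_le _) _.
  split=> //; by rewrite ipZl ipZr -nn mulrA -expr2 -exprMn mulVf// expr1n.
have p0 : 0 <= n * `|x| by rewrite mulr_ge0// ltW.
rewrite /gauss_norm poweR_half_le ?mulr_ge0 ?(ltW K0) ?(ltW n0)//=; last first.
  by apply: integral_ge0 => t _; rewrite lee_fin sqr_ge0.
under eq_integral => t _.
  rewrite /sqnorm addr0 !normrZ (ger0_norm (ltW n0)) exprMn real_normK ?num_real//.
  rewrite mulrC EFinM.
  over.
rewrite ge0_integralZl//; last 3 first.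
- by apply/measurable_EFinP; apply: measurable_funX.
- by move=> t _; rewrite lee_fin sqr_ge0.
- by rewrite lee_fin sqr_ge0.
rewrite (exprMn _ K) (mulrC (K ^+ 2)) (EFinM ((n * `|x|) ^+ 2)); apply: lee_wpmul2l => //.
by rewrite lee_fin sqr_ge0.
Qed.

(** Without a representation the infimum is over the empty set, hence infinite. Closure of the
    finite rank operators under sums and composition then follows from the norm inequalities. *)
Lemma finite_rankP (E : normedModType R) (T : H -> E) :
  finite_rank ip T <-> (finite_rank_gamma_norm ip T < +oo)%E.
Proof.
split=> [[n [h [x [_ ->]]]]|Tfin].
  have [K [K0 HK]] := finite_rank_gamma_norm_tensor.
  elim/big_ind: _ => [|T1 T2 T1y T2y|i _].
  - by rewrite finite_rank_gamma_norm0.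
  - by apply: le_lt_trans (finite_rank_gamma_normD _ _) _; rewrite lte_add_pinfty.
  - by apply: le_lt_trans (HK _ _ _) _; rewrite ltry.
have Tf : finite_rank_gamma_norm ip T \is a fin_num.
  by rewrite ge0_fin_numE// finite_rank_gamma_norm_ge0.
have : (finite_rank_gamma_norm ip T < (fine (finite_rank_gamma_norm ip T) + 1)%:E)%E.
  by rewrite EFinD fineK// lteDl// lte01.
move=> /finite_rank_gamma_norm_lt[l [ol -> _ _]].
pose z := nth (0 : H, 0 : E) l.
exists (size l), (fun i => (z i).1), (fun i => (z i).2); split.
- move=> i j; have := orthonormal_seq_nth ol (i := i) (j := j).
  rewrite size_map => /(_ (ltn_ord i) (ltn_ord j)).
  by rewrite !(nth_map (0 : H, 0 : E)).
- by rewrite /tensor_sum (big_nth (0 : H, 0 : E)) big_mkord; apply: eq_bigr.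
Qed.

End FiniteRankNorm.

(** * Passage from finite rank operators to their completion *)

Section GammaNorm.
Context (R : realType) (H : completeNormedModType R).
Context (ip : {dot H for (@idfun R)}).
Local Notation frn := (finite_rank_gamma_norm ip).

Lemma finite_rank_gamma_normN (E : normedModType R) (T : H -> E) : frn (- T) = frn T.
Proof.
have h (S : H -> E) : (frn (- S)%R <= frn S)%E.
  have := @finite_rank_gamma_norm_comp R H ip E E -%R 1 S.
  rewrite mul1e; apply=> //; last by move=> x; rewrite normrN mul1r.
  by move=> t x y; rewrite opprD scalerN.
by apply/eqP; rewrite eq_le h/= -{1}(opprK T) h.
Qed.

Section Fixed.
Context (E : normedModType R).
Implicit Types (T : H -> E) (r : \bar R).

Definition gamma_cauchy (Tn : nat -> H -> E) := forall e : R, 0 < e ->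
  exists k0, forall k l, (k0 <= k)%N -> (k0 <= l)%N -> (frn (Tn k - Tn l)%R <= e%:E)%E.

Lemma finite_rank_fin_num T : finite_rank ip T -> frn T \is a fin_num.
Proof. by move=> /finite_rankP Tf; rewrite ge0_fin_numE// finite_rank_gamma_norm_ge0. Qed.

Lemma gamma_cauchy_limit (Tn : nat -> H -> E) T :
  (forall k, finite_rank ip (Tn k)) -> gamma_cauchy Tn ->
  (forall h, (fun k => Tn k h) @ \oo --> T h) ->
  exists r : R, gamma_limit ip T r%:E /\ (fun k => frn (Tn k)) @ \oo --> r%:E.
Proof.
move=> fT cT Tlim.
pose a k := fine (frn (Tn k)).
have aE k : frn (Tn k) = (a k)%:E by rewrite fineK// finite_rank_fin_num.
have dist k l : (frn (Tn k) <= frn (Tn k - Tn l)%R + frn (Tn l))%E.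
  by rewrite -{1}(subrK (Tn l) (Tn k)); exact: finite_rank_gamma_normD.
have adist k l : (frn (Tn k - Tn l)%R = frn (Tn l - Tn k)%R)%E.
  by rewrite -finite_rank_gamma_normN opprB.
have : cvgn a.
  apply/cauchy_cvgP/cauchy_exP => e e0.
  have [|k0 Hk] := cT (e / 2); first by rewrite divr_gt0.
  exists (a k0); exists k0 => // k /= k0k.
  rewrite /ball/= distrC.
  have : `|a k - a k0| <= e / 2.
    have h1 := dist k k0; have h2 := dist k0 k; rewrite adist in h2.
    have h3 := Hk k k0 k0k (leqnn _).
    have h4 : (frn (Tn k) <= (e / 2 + a k0)%:E)%E.
      by apply: le_trans h1 _; rewrite EFinD aE leeD2r.
    have h5 : (frn (Tn k0) <= (e / 2 + a k)%:E)%E.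
      by apply: le_trans h2 _; rewrite EFinD aE leeD2r.
    rewrite aE lee_fin in h4; rewrite aE lee_fin in h5.
    by rewrite ler_norml; apply/andP; split; lra.
  by move=> h; apply: le_lt_trans h _; rewrite ltr_pdivrMr// ltr_pMr// ltr1n.
move=> /cvg_ex[r ar]; exists r.
have rr : (fun k => frn (Tn k)) @ \oo --> r%:E.
  rewrite (_ : (fun k => _) = (fun k => (a k)%:E)); last exact/funext.
  by apply/fine_cvgP; split; [exact: nearW|exact: ar].
by split=> //; exists Tn; split.
Qed.

Lemma gamma_limit_ge0 T r : gamma_limit ip T r -> (0 <= r)%E.
Proof.
move=> [Tn [_ _ _ Tr]]; rewrite -(cvg_lim _ Tr)//; apply: lime_ge.
  by apply/cvg_ex; exists r.
by apply: nearW => k; exact: finite_rank_gamma_norm_ge0.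
Qed.

Lemma gamma_norm_ge0 T : (0 <= gamma_norm ip T)%E.
Proof. by apply: le_ereal_inf_tmp => r; exact: gamma_limit_ge0. Qed.

Lemma gamma_norm_lt T (a : R) : (gamma_norm ip T < a%:E)%E ->
  exists Tn : nat -> H -> E, [/\ forall k, finite_rank ip (Tn k), gamma_cauchy Tn,
    forall h, (fun k => Tn k h) @ \oo --> T h &
    \forall k \near \oo, (frn (Tn k) <= a%:E)%E].
Proof.
move=> /ereal_inf_lt[r [Tn [fT cT Tlim Tr]] ra]; exists Tn; split=> //.
have : \forall k \near \oo, (frn (Tn k) < a%:E)%E.
  exact: (Tr _ (open_ereal_lt' ra)).
by apply: filterS => k /ltW.
Qed.

(** One approximating sequence suffices for an upper bound, the norm being an infimum. Together with
    [gamma_norm_lt] this transfers inequalities from finite rank operators to their limits. *)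
Lemma gamma_norm_le (Tn : nat -> H -> E) T (a : R) :
  (forall k, finite_rank ip (Tn k)) -> gamma_cauchy Tn ->
  (forall h, (fun k => Tn k h) @ \oo --> T h) ->
  (\forall k \near \oo, (frn (Tn k) <= a%:E)%E) ->
  (gamma_norm ip T <= a%:E)%E.
Proof.
move=> fT cT Tlim Ta; have [r [Tr rr]] := gamma_cauchy_limit fT cT Tlim.
apply: (@le_trans _ _ r%:E); first exact: ereal_inf_lbound.
rewrite -(cvg_lim _ rr)//; apply: lime_le => //.
by apply/cvg_ex; exists r%:E.
Qed.

Lemma gamma_norm_le_finite_rank T : (gamma_norm ip T <= frn T)%E.
Proof.
have [fT|] := boolP (frn T \is a fin_num); last first.
  by rewrite ge0_fin_numE ?finite_rank_gamma_norm_ge0// -leNgt leye_eq => /eqP ->; rewrite leey.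
rewrite -(fineK fT); apply: (@gamma_norm_le (fun=> T)).
- by move=> k; apply/finite_rankP; rewrite -ge0_fin_numE ?finite_rank_gamma_norm_ge0.
- move=> e e0; exists 0%N => k l _ _; rewrite subrr finite_rank_gamma_norm0.
  by rewrite lee_fin ltW.
- by move=> h; exact: cvg_cst.
- by apply: nearW => k; rewrite fineK.
Qed.

Lemma gamma_norm0 : gamma_norm ip (0 : H -> E) = 0%E.
Proof.
apply/eqP; rewrite eq_le gamma_norm_ge0 andbT.
by apply: le_trans (gamma_norm_le_finite_rank _) _; rewrite finite_rank_gamma_norm0.
Qed.

Lemma gamma_normD T T' : (gamma_norm ip (T + T')%R <= gamma_norm ip T + gamma_norm ip T')%E.
Proof.
apply: le_add_of_lt; rewrite ?gamma_norm_ge0// => a b.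
move=> /gamma_norm_lt[Tn [fT cT Tlim Ta]] /gamma_norm_lt[Sn [fS cS Slim Sb]].
apply: (@gamma_norm_le (fun k => Tn k + Sn k)).
- move=> k; apply/finite_rankP; apply: le_lt_trans (finite_rank_gamma_normD _ _ _) _.
  by rewrite lte_add_pinfty//; apply/finite_rankP.
- move=> e e0; have e2 : 0 < e / 2 by rewrite divr_gt0.
  have [k1 h1] := cT _ e2; have [k2 h2] := cS _ e2.
  exists (maxn k1 k2) => k l; rewrite !geq_max => /andP[k1k k2k] /andP[k1l k2l].
  rewrite opprD addrACA; apply: le_trans (finite_rank_gamma_normD _ _ _) _.
  by rewrite (splitr e) EFinD; apply: leeD; [exact: h1|exact: h2].
- by move=> h; apply: cvgD; [exact: Tlim|exact: Slim].
- apply: filterS2 Ta Sb => k ta sb; apply: le_trans (finite_rank_gamma_normD _ _ _) _.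
  by rewrite EFinD leeD.
Qed.

End Fixed.

Lemma gamma_norm_comp (E E' : normedModType R) (A : E -> E') (C : R) (T : H -> E) :
  (forall t x y, A (t *: x + y) = t *: A x + A y) -> 0 < C ->
  (forall x, `|A x| <= C * `|x|) ->
  (gamma_norm ip (A \o T) <= C%:E * gamma_norm ip T)%E.
Proof.
move=> Alin C0 AC.
have ideal S := @finite_rank_gamma_norm_comp R H ip E E' A C S Alin C0 AC.
have AB x y : A (x - y) = A x - A y.
  by rewrite (_ : x - y = -1 *: y + x) ?Alin scaleN1r addrC.
apply: le_scale_of_lt; rewrite ?gamma_norm_ge0// => a /gamma_norm_lt[Tn [fT cT Tlim Ta]].
apply: (@gamma_norm_le _ (fun k => A \o Tn k)).
- move=> k; apply/finite_rankP; apply: le_lt_trans (ideal _) _.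
  by rewrite lte_mul_pinfty ?lee_fin ?(ltW C0)//; apply/finite_rankP.
- move=> e e0; have [|k0 hk] := cT (e / C); first by rewrite divr_gt0.
  exists k0 => k l k0k k0l.
  rewrite (_ : _ - _ = A \o (Tn k - Tn l)); last by apply/funext => h /=; rewrite AB.
  apply: le_trans (ideal _) _.
  apply: (@le_trans _ _ (C%:E * (e / C)%:E)%E).
    by apply: lee_wpmul2l; [rewrite lee_fin ltW|exact: hk].
  by rewrite -EFinM lee_fin mulrCA divff ?mulr1// gt_eqF.
- move=> h; have /cvgrPdist_le Th := Tlim h.
  apply/cvgrPdist_le => e e0; have := Th (e / C); rewrite divr_gt0// => /(_ isT).
  apply: filterS => k hk /=; rewrite -AB; apply: le_trans (AC _) _.
  by rewrite -ler_pdivlMl// mulrC.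
- apply: filterS Ta => k ta; apply: le_trans (ideal _) _.
  by rewrite EFinM; apply: lee_wpmul2l => //; rewrite lee_fin ltW.
Qed.

Lemma gamma_normN (E : normedModType R) (T : H -> E) : gamma_norm ip (- T) = gamma_norm ip T.
Proof.
have h (S : H -> E) : (gamma_norm ip (- S)%R <= gamma_norm ip S)%E.
  have := @gamma_norm_comp E E -%R 1 S.
  rewrite mul1e; apply=> //; last by move=> x; rewrite normrN mul1r.
  by move=> t x y; rewrite opprD scalerN.
by apply/eqP; rewrite eq_le h/= -{1}(opprK T) h.
Qed.

Lemma gamma_norm_tensor : exists K : R, 0 < K /\
  forall (E : normedModType R) (h : H) (x : E),
    (gamma_norm ip (tensor ip h x) <= (K * (Num.sqrt (ip h h) * `|x|))%:E)%E.
Proof.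
have [K [K0 HK]] := finite_rank_gamma_norm_tensor ip; exists K; split=> // E h x.
exact: le_trans (gamma_norm_le_finite_rank _) (HK _ _ _).
Qed.

End GammaNorm.
(** * Smallness in L^p *)

Section AlmostEverywhereIntegral.
Context (d : measure_display) (S : measurableType d) (R : realType).
Context (mu : {measure set S -> \bar R}).
Local Open Scope ereal_scope.

Import HBNNSimple.

(* The integral of a nonnegative function is a supremum over simple functions,
   so that no measurability is needed here. *)
Lemma ge0_le_integral_nonmeasurable (f g : S -> \bar R) : (forall w, 0 <= f w) ->
  (forall w, f w <= g w) -> \int[mu]_w f w <= \int[mu]_w g w.
Proof.
move=> f0 fg; have g0 w : 0 <= g w by exact: le_trans (f0 w) (fg w).
rewrite !ge0_integralTE//; apply: ereal_sup_le => _ [h hf <-].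
by exists h => // w; apply: le_trans (hf w) (fg w).
Qed.

(** A simple function below [f], set to 0 on the null set, lies below [g] everywhere without losing
    any of its integral. *)
Lemma ae_ge0_le_integral_nonmeasurable (f g : S -> \bar R) :
  (forall w, 0 <= f w) -> (forall w, 0 <= g w) ->
  {ae mu, forall w, f w <= g w} -> \int[mu]_w f w <= \int[mu]_w g w.
Proof.
move=> f0 g0 [N [mN N0 fgN]].
rewrite [leLHS]ge0_integralTE//; apply: ge_ereal_sup => _ [h hf <-].
have mh : measurable_fun setT (EFin \o h).
  by apply/measurable_EFinP.
have h0 w : 0 <= (h w)%:E by rewrite lee_fin.
rewrite -integralT_nnsfun.
have mhN : measurable_fun setT ((EFin \o h) \_ (~` N)).
  by apply/(measurable_restrictT _ _).1; [exact: measurableC|exact: measurable_funTS].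
apply: (@le_trans _ _ (\int[mu]_w ((EFin \o h) \_ (~` N)) w)).
  apply: ae_ge0_le_integral => //.
  - by move=> w _; apply: erestrict_ge0 => ? _; exact: h0.
  - exists N; split=> // w /=; apply: contra_notP => Nw _.
    by rewrite patchE mem_set.
apply: ge0_le_integral_nonmeasurable => w.
  by apply: erestrict_ge0 => ? _; exact: h0.
rewrite patchE; case: ifPn => // /[!inE] Nw.
apply: le_trans (hf w) _; apply: contrapT => fgw; apply: Nw; exact: fgN.
Qed.

End AlmostEverywhereIntegral.

Section Small.
Context (d : measure_display) (Omega : measurableType d) (R : realType).
Context (P : probability Omega R) (p : R) (p_gt0 : 0 < p).
Implicit Types (f : Omega -> \bar R) (e c : R).

(* A substitute for the L^p norm that is subadditive without any measurability
   of [f], which is only dominated. *)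
Definition small f e : Prop := exists g : Omega -> R,
  [/\ measurable_fun setT g, forall w, 0 <= g w,
      {ae P, forall w, (f w <= (g w)%:E)%E} &
      (\int[P]_w (g w `^ p)%:E <= e%:E)%E].

Lemma measurable_powRp (g : Omega -> R) : measurable_fun setT g ->
  measurable_fun setT (fun w => (g w `^ p)%:E).
Proof.
by move=> mg; apply/measurable_EFinP; exact: (measurableT_comp (measurable_powR p) mg).
Qed.

Lemma small_ae_le f f' e e' : {ae P, forall w, (f w <= f' w)%E} -> e' <= e ->
  small f' e' -> small f e.
Proof.
move=> ff' ee' [g [mg g0 f'g ig]]; exists g; split=> //.
  by apply: filterS2 ff' f'g => w; exact: le_trans.
by apply: le_trans ig _; rewrite lee_fin.
Qed.

Lemma small_le f f' e e' : (forall w, (f w <= f' w)%E) -> e' <= e ->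
  small f' e' -> small f e.
Proof. by move=> ff'; apply: small_ae_le; exact: aeW. Qed.

(** From [a + b <= 2 * max a b]; this holds for every [p > 0] and is precise enough to preserve
    smallness and finiteness. *)
Lemma powRD_le (a b : R) : 0 <= a -> 0 <= b ->
  (a + b) `^ p <= 2 `^ p * (a `^ p + b `^ p).
Proof.
move=> a0 b0; wlog ab : a b a0 b0 / a <= b.
  by move=> h; have [/h|/ltW/h] := leP a b; [exact|rewrite addrC (addrC (b `^ _)); exact].
apply: (@le_trans _ _ ((2 * b) `^ p)).
  by apply: ge0_ler_powR; rewrite ?nnegrE ?addr_ge0 ?mulr_ge0 ?(ltW p_gt0)//; lra.
by rewrite powRM// ler_pM2l ?powR_gt0// lerDr powR_ge0.
Qed.

Lemma smallD f f' e e' : small f e -> small f' e' ->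
  small (fun w => f w + f' w)%E (2 `^ p * (e + e')).
Proof.
move=> [g [mg g0 fg ig]] [g' [mg' g0' fg' ig']].
exists (fun w => g w + g' w); split.
- exact: measurable_funD.
- by move=> w; rewrite addr_ge0.
- by apply: filterS2 fg fg' => w h h'; rewrite EFinD; exact: leeD.
apply: (@le_trans _ _ (\int[P]_w ((2 `^ p)%:E * ((g w `^ p)%:E + (g' w `^ p)%:E)))%E).
  apply: ge0_le_integral_nonmeasurable => w; first by rewrite lee_fin powR_ge0.
  by rewrite -EFinD -EFinM lee_fin powRD_le.
have m1 := measurable_powRp mg; have m2 := measurable_powRp mg'.
rewrite ge0_integralZl//; last 2 first.
- exact: emeasurable_funD m1 m2.
- by move=> w _; rewrite adde_ge0// lee_fin powR_ge0.
rewrite ge0_integralD//; [|by move=> w _; rewrite lee_fin powR_ge0..].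
by rewrite EFinM EFinD; apply: lee_wpmul2l; [rewrite lee_fin powR_ge0|exact: leeD].
Qed.

Lemma smallZ f e c : 0 <= c -> small f e -> small (fun w => c%:E * f w)%E (c `^ p * e).
Proof.
move=> c0 [g [mg g0 fg ig]]; exists (fun w => c * g w); split.
- exact: measurable_funM.
- by move=> w; rewrite mulr_ge0.
- by apply: filterS fg => w h; rewrite EFinM; apply: lee_wpmul2l.
under eq_integral do rewrite powRM// EFinM.
rewrite ge0_integralZl//; last 3 first.
- exact: measurable_powRp.
- by move=> w _; rewrite lee_fin powR_ge0.
- by rewrite lee_fin powR_ge0.
by rewrite EFinM; apply: lee_wpmul2l => //; rewrite lee_fin powR_ge0.
Qed.

Lemma small_cst c : 0 <= c -> small (fun=> c%:E) (c `^ p).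
Proof.
move=> c0; exists (fun=> c); split=> //; first exact: aeW.
rewrite integral_cst// [X in (_ * X)%E](_ : _ = 1%E) ?mule1//.
exact: probability_setT.
Qed.

Lemma small_Lnorm f e : (forall w, (0 <= f w)%E) -> 0 <= e -> small f e ->
  ('N[P]_p%:E[f] <= (e `^ p^-1)%:E)%E.
Proof.
move=> f0 e0 [g [mg g0 fg ig]]; rewrite unlock -poweR_EFin.
apply: gt0_ler_poweR.
- by rewrite invr_ge0 ltW.
- by rewrite in_itv/= leey andbT; apply: integral_ge0 => w _; exact: poweR_ge0.
- by rewrite in_itv/= leey andbT lee_fin.
apply: le_trans ig; apply: ae_ge0_le_integral_nonmeasurable.
- by move=> w; exact: poweR_ge0.
- by move=> w; rewrite lee_fin powR_ge0.
apply: filterS fg => w fgw; rewrite gee0_abs// -poweR_EFin.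
apply: gt0_ler_poweR => //; rewrite ?(ltW p_gt0)// in_itv/= leey andbT//.
by rewrite lee_fin.
Qed.

Lemma Lnorm_small f e (g : Omega -> R) : measurable_fun setT g ->
  (forall w, 0 <= g w) -> (forall w, (0 <= f w)%E) ->
  {ae P, forall w, f w = (g w)%:E} ->
  0 <= e -> ('N[P]_p%:E[f] <= e%:E)%E -> small f (e `^ p).
Proof.
move=> mg g0 f0 fg e0 Nf; exists g; split=> //.
  by apply: filterS fg => w ->.
apply: (@le_trans _ _ (\int[P]_w (`|f w| `^ p))%E).
  apply: ae_ge0_le_integral_nonmeasurable.
  - by move=> w; rewrite lee_fin powR_ge0.
  - by move=> w; exact: poweR_ge0.
  by apply: filterS fg => w ->; rewrite gee0_abs ?lee_fin// poweR_EFin.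
rewrite -powR_Lnorm ?gt_eqF// -poweR_EFin.
apply: gt0_ler_poweR; rewrite ?(ltW p_gt0)// in_itv/= leey andbT ?lee_fin//.
exact: Lnorm_ge0.
Qed.

End Small.
(** * Strong measurability and convergence *)

Definition seminorm (R : realType) (V : zmodType) (N : V -> \bar R) : Prop :=
  [/\ N 0 = 0%E, forall x, (0 <= N x)%E, forall x, N (- x) = N x &
      forall x y, (N (x + y)%R <= N x + N y)%E].

Lemma seminorm_enorm (R : realType) (E : normedModType R) : seminorm (@enorm R E).
Proof.
split=> [|x|x|x y]; rewrite /enorm ?lee_fin ?normr0 ?normrN//.
exact: ler_normD.
Qed.

Lemma seminorm_gamma_norm (R : realType) (H : completeNormedModType R)
    (ip : {dot H for (@idfun R)}) (E : normedModType R) :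
  seminorm (@gamma_norm R H ip E).
Proof.
split; [exact: gamma_norm0|exact: gamma_norm_ge0|exact: gamma_normN|exact: gamma_normD].
Qed.

Section Seminorms.
Context (R : realType).

Section Pointwise.
Context (V : zmodType) (N : V -> \bar R) (sN : seminorm N).

Lemma seminormB x y : (N (x - y)%R <= N x + N y)%E.
Proof. by case: sN => _ _ NN ND; rewrite -(NN y); exact: ND. Qed.

Lemma seminorm_dist x y : N (x - y) = N (y - x).
Proof. by case: sN => _ _ NN _; rewrite -NN opprB. Qed.

Lemma seminorm_split x y : (N x <= N (x - y)%R + N y)%E.
Proof. by case: sN => _ _ _ ND; rewrite -{1}(subrK y x); exact: ND. Qed.

Lemma seminorm_cvg_fin (x : nat -> V) y :
  (forall k, N (x k) < +oo)%E -> (fun k => N (x k - y)) @ \oo --> 0%E ->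
  N y \is a fin_num.
Proof.
case: (sN) => _ N0 _ _ xf xy; rewrite ge0_fin_numE//.
have : \forall k \near \oo, (N (x k - y)%R < 1)%E.
  by apply: (xy _ (open_ereal_lt' _)); rewrite lte01.
move=> [k _ /(_ k (leqnn _))/= hk].
rewrite seminorm_dist in hk.
apply: le_lt_trans (seminorm_split y (x k)) _.
by rewrite lte_add_pinfty// (lt_trans hk)// ltry.
Qed.

Lemma seminorm_cvg (x : nat -> V) y :
  (forall k, N (x k) < +oo)%E -> (fun k => N (x k - y)) @ \oo --> 0%E ->
  (fun k => fine (N (x k))) @ \oo --> fine (N y).
Proof.
move=> xf xy; have yf := seminorm_cvg_fin xf xy.
case: (sN) => _ N0 _ _.
apply/cvgrPdist_le => e e0.
have : \forall k \near \oo, (N (x k - y)%R < e%:E)%E.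
  by apply: (xy _ (open_ereal_lt' _)); rewrite lte_fin.
apply: filterS => k /ltW hk.
have fk : N (x k) \is a fin_num by rewrite ge0_fin_numE.
have h1 := le_trans (seminorm_split (x k) y) (leeD2r _ hk).
rewrite seminorm_dist in hk.
have h2 := le_trans (seminorm_split y (x k)) (leeD2r _ hk).
move: h1 h2; rewrite -(fineK fk) -(fineK yf) -!EFinD !lee_fin => h1 h2.
by rewrite ler_norml; apply/andP; split; lra.
Qed.

End Pointwise.

Lemma cvge0_le (a b : nat -> \bar R) : (forall k, (0 <= a k)%E) ->
  (\forall k \near \oo, (a k <= b k)%E) -> b @ \oo --> 0%E -> a @ \oo --> 0%E.
Proof.
move=> a0 ab b0; apply: squeeze_cvge b0; last exact: cvg_cst.
by apply: filterS ab => k ->; rewrite a0.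
Qed.

Section StronglyMeasurable.
Context (d : measure_display) (Omega : measurableType d) (P : probability Omega R).

(** The norms of the simple maps converge only off a null set, and [P] need not be complete; a
    measurable version is obtained by putting 0 on a measurable null set containing the
    exceptions. *)
Lemma strongly_measurable_norm (V : zmodType) (N : V -> \bar R) (f : Omega -> V) :
  seminorm N -> strongly_measurable P N measurable f ->
  exists g : Omega -> R, [/\ measurable_fun setT g, forall w, 0 <= g w &
    {ae P, forall w, N (f w) = (g w)%:E}].
Proof.
move=> sN [s [ss [A [mA A0 sA]]]].
have [_ N0 _ _] := sN.
have sf w : ~ A w -> (fun k => N (s k w - f w)) @ \oo --> 0%E.
  by move=> Aw; apply: contrapT => h; apply: Aw; exact: sA.
have sfin k w : (N (s k w) < +oo)%E by case: (ss k).
pose a k : Omega -> R := (fun w => fine (N (s k w))) \_ (~` A).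
have ma k : measurable_fun setT (a k).
  apply/(measurable_restrictT _ _).1; [exact: measurableC|apply: measurable_funTS].
  move=> _ Y mY; rewrite setTI.
  have sk : simple_map (s k) by case: (ss k).
  exact: (simple_map_preimage Y (simple_map_comp (fun v => fine (N v)) sk)).
pose g w : R := if w \in A then 0 else fine (N (f w)).
exists g; split.
- apply: (measurable_fun_cvg (h := a)) => // w _; rewrite /a /g.
  have [wA|wA] := boolP (w \in A).
    rewrite (_ : (fun _ => _) = (fun=> 0)); first exact: cvg_cst.
    by apply/funext => k; rewrite patchE in_setC wA.
  rewrite (_ : (fun _ => _) = (fun k => fine (N (s k w)))); last first.
    by apply/funext => k; rewrite patchE in_setC wA.
  apply: seminorm_cvg => //; apply: sf => Aw.
  by rewrite mem_set in wA.
- by move=> w; rewrite /g; case: ifP => // _; rewrite fine_ge0.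
exists A; split=> // w /=; apply: contra_notP => Aw.
rewrite /g memNset// fineK//.
by apply: (seminorm_cvg_fin sN (fun k => sfin k w)); exact: sf.
Qed.

(** Joint sequential continuity along sequences of finite norm is enough, as simple functions have
    finite norm at every point. It is applied to sums, to [phi], and to the pairing of a point [x]
    and an operator [T] into ['d phi x \o T]. *)
Lemma strongly_measurable_op (V1 V2 V3 : zmodType) (N1 : V1 -> \bar R)
    (N2 : V2 -> \bar R) (N3 : V3 -> \bar R) (op : V1 -> V2 -> V3) f1 f2 :
  strongly_measurable P N1 measurable f1 ->
  strongly_measurable P N2 measurable f2 ->
  (forall a b, N1 a < +oo -> N2 b < +oo -> N3 (op a b) < +oo)%E ->
  (forall (a : nat -> V1) (b : nat -> V2) x y,
    (forall k, N1 (a k) < +oo)%E -> (forall k, N2 (b k) < +oo)%E ->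
    (fun k => N1 (a k - x)) @ \oo --> 0%E -> (fun k => N2 (b k - y)) @ \oo --> 0%E ->
    (fun k => N3 (op (a k) (b k) - op x y)) @ \oo --> 0%E) ->
  strongly_measurable P N3 measurable (fun w => op (f1 w) (f2 w)).
Proof.
move=> [s [ss sf]] [t [st tf]] fin lim; exists (fun k w => op (s k w) (t k w)).
split=> [k|]; last first.
  apply: filterS2 sf tf => w h1 h2; apply: lim => // k; [by case: (ss k)|by case: (st k)].
have [s1 s2 s3] := ss k; have [t1 t2 t3] := st k.
have := simple_map_comp (fun z => op z.1 z.2)
  (simple_map_pair (conj s1 s2 : simple_map (s k)) (conj t1 t2 : simple_map (t k))).
by move=> [c1 c2]; split=> // w; exact: fin.
Qed.

Lemma strongly_measurableD (V : zmodType) (N : V -> \bar R) f g : seminorm N ->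
  strongly_measurable P N measurable f -> strongly_measurable P N measurable g ->
  strongly_measurable P N measurable (fun w => f w + g w).
Proof.
move=> sN mf mg; have [_ N0 _ ND] := sN.
apply: strongly_measurable_op mf mg _ _ => [a b a1 b1|a b x y _ _ ax yb].
  by apply: le_lt_trans (ND _ _) _; rewrite lte_add_pinfty.
apply: (@cvge0_le _ (fun k => N (a k - x)%R + N (b k - y)%R)%E) => //.
  by apply: nearW => k; rewrite opprD addrACA; exact: ND.
by rewrite -(adde0 0%E); apply: cvgeD.
Qed.

Lemma strongly_measurableN (V : zmodType) (N : V -> \bar R) f : seminorm N ->
  strongly_measurable P N measurable f ->
  strongly_measurable P N measurable (fun w => - f w).
Proof.
move=> sN mf; have [_ N0 NN ND] := sN.
apply: (strongly_measurable_op (op := fun a _ => - a) mf mf) => [a b|a b x y _ _ ax _].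
  by rewrite NN.
by under eq_fun do rewrite -opprD NN.
Qed.

Lemma strongly_measurableB (V : zmodType) (N : V -> \bar R) f g : seminorm N ->
  strongly_measurable P N measurable f -> strongly_measurable P N measurable g ->
  strongly_measurable P N measurable (fun w => f w - g w).
Proof.
by move=> sN mf mg; apply: strongly_measurableD => //; exact: strongly_measurableN.
Qed.

(** Applied with [L] multiplying a fixed vector by a scalar, or tensoring it with an element of
    [H]. *)
Lemma simple_limit_strongly_measurable (E : normedModType R) (V : zmodType)
    (N : V -> \bar R) (f : Omega -> E) (L : E -> V) (K : R) :
  seminorm N -> (forall x, N (L x) < +oo)%E ->
  (forall x y, N (L x - L y)%R <= (K * `|x - y|)%:E)%E ->
  simple_limit f -> strongly_measurable P N measurable (L \o f).
Proof.
move=> [_ N0 _ _] Lfin LK [s [ss sf]]; exists (fun k => L \o s k); split.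
  by move=> k; have [c1 c2] := simple_map_comp L (ss k); split=> // w; exact: Lfin.
apply: aeW => w; apply: (@cvge0_le _ (fun k => (K * `|s k w - f w|)%:E)) => //.
  by apply: nearW => k; exact: LK.
apply/fine_cvgP; split; first exact: nearW.
rewrite -[X in _ --> X](mulr0 K); apply: cvgM; first exact: cvg_cst.
have /cvgrPdist_lt sw := sf w; apply/cvgrPdist_lt => e /sw.
by apply: filterS => k; rewrite sub0r normrN normr_id distrC.
Qed.

Section Lp.
Context (p : R) (p_gt0 : 0 < p).

Lemma cvg_Lp_small (V : zmodType) (N : V -> \bar R) (u : nat -> Omega -> V) f :
  seminorm N -> (forall k, strongly_measurable P N measurable (u k)) ->
  strongly_measurable P N measurable f -> cvg_Lp P N p u f ->
  forall e, 0 < e -> \forall k \near \oo, small P p (fun w => N (u k w - f w)) e.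
Proof.
move=> sN mu mf uf e e0; have [_ N0 _ _] := sN.
have : \forall k \near \oo,
    ('N[P]_p%:E[(fun w => N (u k w - f w)%R)] < (e `^ p^-1)%:E)%E.
  by apply: (uf _ (open_ereal_lt' _)); rewrite lte_fin powR_gt0.
apply: filterS => k /ltW hk.
have [g [mg g0 fg]] := strongly_measurable_norm sN (strongly_measurableB sN (mu k) mf).
have -> : e = (e `^ p^-1) `^ p by rewrite -powRrM mulVf ?powRr1 ?gt_eqF// ltW.
by apply: (Lnorm_small p_gt0 mg g0 _ fg _ hk) => //; exact: powR_ge0.
Qed.

Lemma small_cvg_Lp (V : zmodType) (N : V -> \bar R) (u : nat -> Omega -> V) f :
  seminorm N ->
  (forall k, small P p (fun w => N (u k w - f w)) (k.+1%:R^-1 `^ p)) ->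
  cvg_Lp P N p u f.
Proof.
move=> [_ N0 _ _] h; apply: (@cvge0_le _ (fun k => (k.+1%:R^-1)%:E)).
- by move=> k; exact: Lnorm_ge0.
- apply: nearW => k; have k0 : 0 <= k.+1%:R^-1 :> R by rewrite invr_ge0.
  apply: (le_trans (small_Lnorm p_gt0 (fun w => N0 _) (powR_ge0 _ _) (h k))).
  by rewrite -powRrM mulfV ?powRr1 ?gt_eqF.
- apply/fine_cvgP; split; [exact: nearW|exact: cvg_harmonic].
Qed.

Lemma small_in_Lp (V : zmodType) (N : V -> \bar R) f e : seminorm N ->
  strongly_measurable P N measurable f -> 0 <= e ->
  small P p (N \o f) e -> in_Lp P N measurable p f.
Proof.
move=> [_ N0 _ _] mf e0 sf; split=> //.
by apply: (le_lt_trans (small_Lnorm p_gt0 (fun w => N0 _) e0 sf)); rewrite ltry.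
Qed.

Lemma in_Lp_small (V : zmodType) (N : V -> \bar R) f : seminorm N ->
  in_Lp P N measurable p f -> exists e, 0 <= e /\ small P p (N \o f) e.
Proof.
move=> sN [mf Nf]; have [_ N0 _ _] := sN.
have [g [mg g0 fg]] := strongly_measurable_norm sN mf.
have Nfin : ('N[P]_p%:E[N \o f])%E \is a fin_num by rewrite ge0_fin_numE ?Lnorm_ge0.
exists (fine ('N[P]_p%:E[N \o f])%E `^ p); split; first exact: powR_ge0.
apply: (Lnorm_small p_gt0 mg g0 _ fg) => //; first by rewrite fine_ge0 ?Lnorm_ge0.
by rewrite fineK.
Qed.

(** The integrals of the p-th powers are dominated by a geometric series, so the series of p-th
    powers is finite almost everywhere and its terms tend to 0. This yields almost sure convergence
    along a fast subsequence. *)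
Lemma small_summable_ae (f : nat -> Omega -> \bar R) :
  (forall k w, (0 <= f k w)%E) ->
  (forall k, small P p (f k) (2^-1 ^+ k)) ->
  {ae P, forall w, (fun k => f k w) @ \oo --> 0%E}.
Proof.
move=> f0 /choice[g Hg].
have mg k : measurable_fun setT (fun w => (g k w `^ p)%:E).
  by apply: measurable_powRp; case: (Hg k).
have gp0 k w : (0 <= (g k w `^ p)%:E)%E by rewrite lee_fin powR_ge0.
pose G w := (\sum_(k <oo) (g k w `^ p)%:E)%E.
have G0 w : (0 <= G w)%E by apply: nneseries_ge0.
have mG : measurable_fun setT G.
  by apply: ge0_emeasurable_sum => // k w _ _; exact: gp0.
have iG : P.-integrable setT G.
  apply/integrableP; split=> //.
  under eq_integral do rewrite gee0_abs//.
  rewrite integral_nneseries//.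
  apply: (@le_lt_trans _ _ (\sum_(k <oo) (2^-1 ^+ k)%:E)%E); last first.
    have g2 : (forall k, 0 <= (2^-1 ^+ k)%:E :> \bar R)%E.
      by move=> k; rewrite lee_fin exprn_ge0// invr_ge0.
    apply: (@le_lt_trans _ _ (1 * (1 - 2^-1)^-1)%:E); last exact: ltry.
    apply: lime_le; first exact: is_cvg_nneseries.
    apply: nearW => n; rewrite sumEFin lee_fin.
    have n2 : `|2^-1 : R| < 1 by rewrite ger0_norm ?invr_ge0// invf_lt1// ltr1n.
    have := @geometric_le_lim R n 1 2^-1 ler01 _ n2.
    rewrite invr_gt0 => /(_ (ltr0n _ _)); apply: le_trans.
    by rewrite /series/=; apply: ler_sum => i _; rewrite mul1r.
  by apply: lee_nneseries => [k _ _|k _]; [exact: integral_ge0|case: (Hg k)].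
have fg : {ae P, forall w, forall k, (f k w <= (g k w)%:E)%E}.
  by apply/ae_foralln => k; case: (Hg k).
apply: filterS2 (integrable_ae measurableT iG) fg => w /(_ I) Gw fgw.
have Gfin : (G w < +oo)%E by rewrite -ge0_fin_numE.
have tail := @nneseries_tail_cvg R (fun k => (g k w `^ p)%:E) xpredT Gfin (fun k _ => gp0 k w).
have : (fun k => (g k w `^ p)%:E) @ \oo --> 0%E.
  apply: (cvge0_le _ _ tail) => [k|]; first exact: gp0.
  apply: nearW => k; rewrite (@nneseries_split R _ k 1); last by move=> *; exact: gp0.
  rewrite addn1 big_nat1 leeDl//; apply: nneseries_ge0 => *; exact: gp0.
move=> /fine_cvgP[_ gp].
have g0 k : 0 <= g k w by case: (Hg k).
have g_cvg : (fun k => g k w) @ \oo --> (0 : R).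
  apply/cvgrPdist_lt => e e0.
  have /cvgrPdist_lt/(_ (e `^ p)) := gp; rewrite powR_gt0// => /(_ isT).
  apply: filterS => k /=; rewrite !sub0r !normrN (ger0_norm (powR_ge0 _ _)) ger0_norm//.
  move=> h; rewrite ltNge; apply/negP => eg.
  have := @ge0_ler_powR R p (ltW p_gt0) e (g k w).
  rewrite !nnegrE (ltW e0) g0 => /(_ isT isT eg).
  by rewrite leNgt h.
apply: (@cvge0_le _ (fun k => (g k w)%:E)) => //; first exact: nearW.
by apply/fine_cvgP; split; [exact: nearW|exact: g_cvg].
Qed.

(** Dominated convergence for the p-th powers of measurable versions of [f k], with the measurable
    majorant of [h] as the dominating function. *)
Lemma small_dominated (f : nat -> Omega -> \bar R) (h : Omega -> \bar R) e :
  (forall k w, (0 <= f k w)%E) ->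
  (forall k, exists g : Omega -> R, [/\ measurable_fun setT g, forall w, 0 <= g w &
    {ae P, forall w, f k w = (g w)%:E}]) ->
  {ae P, forall w, (fun k => f k w) @ \oo --> 0%E} ->
  (forall k w, (f k w <= h w)%E) -> small P p h e ->
  forall e', 0 < e' -> \forall k \near \oo, small P p (f k) e'.
Proof.
move=> f0 /choice[g Hg] fcvg fh [h' [mh h0 hh' ih]] e' e'0.
have mg k : measurable_fun setT (fun w => (g k w `^ p)%:E).
  by apply: measurable_powRp; case: (Hg k).
have fg : {ae P, forall w, forall k, f k w = (g k w)%:E}.
  by apply/ae_foralln => k; case: (Hg k).
have ihp : P.-integrable setT (fun w => (h' w `^ p)%:E).
  apply/integrableP; split; first exact: measurable_powRp.
  under eq_integral do rewrite gee0_abs ?lee_fin ?powR_ge0//.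
  by apply: le_lt_trans ih _; rewrite ltry.
have gcvg : {ae P, forall w, setT w -> (fun k => (g k w `^ p)%:E) @ \oo --> 0%E}.
  apply: filterS2 fcvg fg => w fw fgw _.
  have gw : (fun k => g k w) @ \oo --> (0 : R).
    suff : (fun k => (g k w)%:E) @ \oo --> 0%E by move=> /fine_cvgP[].
    by rewrite (_ : (fun k => (g k w)%:E) = f^~ w)//; apply/funext => k; rewrite fgw.
  apply/fine_cvgP; split; first exact: nearW.
  apply/cvgrPdist_lt => u u0.
  have /cvgrPdist_lt/(_ (u `^ p^-1)) := gw; rewrite powR_gt0// => /(_ isT).
  apply: filterS => k /=; rewrite !sub0r !normrN (ger0_norm (powR_ge0 _ _)).
  have gk0 : 0 <= g k w by case: (Hg k).
  rewrite ger0_norm// => hk.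
  have := @gt0_ltr_powR R p p_gt0 (g k w) (u `^ p^-1).
  by rewrite !nnegrE gk0 powR_ge0 -powRrM mulVf ?powRr1 ?gt_eqF ?(ltW u0)//; apply.
have gdom : {ae P, forall w n, setT w -> (`|(g n w `^ p)%:E| <= (h' w `^ p)%:E)%E}.
  apply: filterS2 fg hh' => w fgw hw n _.
  have gk0 : 0 <= g n w by case: (Hg n).
  rewrite gee0_abs ?lee_fin ?powR_ge0//.
  apply: ge0_ler_powR; rewrite ?nnegrE// ?(ltW p_gt0)//.
  by rewrite -lee_fin -fgw; apply: le_trans (fh _ _) hw.
have [_ _] := dominated_convergence measurableT mg (measurable_cst _) gcvg ihp gdom.
rewrite integral0 => lim0.
have : \forall k \near \oo, (\int[P]_w (g k w `^ p)%:E < e'%:E)%E.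
  by apply: (lim0 _ (open_ereal_lt' _)); rewrite lte_fin.
apply: filterS => k /ltW hk; exists (g k); split=> //.
- by case: (Hg k).
- by case: (Hg k).
- by apply: filterS fg => w ->.
Qed.

End Lp.
End StronglyMeasurable.
End Seminorms.
(** * Smooth scalar random variables *)

Section BoundedSmoothFunctions.
Context (R : realType).

Lemma Cb_infty_differentiable n (f : 'rV[R]_n -> R) x : Cb_infty f -> differentiable f x.
Proof. by move=> /(_ [::])[]. Qed.

Lemma Cb_infty_bounded n (f : 'rV[R]_n -> R) : Cb_infty f ->
  exists M, forall x, `|f x| <= M.
Proof. by move=> /(_ [::])[]. Qed.

Lemma Cb_infty_partial n (f : 'rV[R]_n -> R) i : Cb_infty f -> Cb_infty (partial i f).
Proof. by move=> cf s; have := cf (rcons s i); rewrite foldr_rcons. Qed.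

(** A coinduction principle: it replaces formulas for iterated derivatives by a class closed under
    one partial derivative. *)
Lemma Cb_infty_coind n (A : set ('rV[R]_n -> R)) :
  (forall f, A f -> [/\ forall x, differentiable f x,
    exists M, forall x, `|f x| <= M & forall i, A (partial i f)]) ->
  A `<=` @Cb_infty R n.
Proof.
move=> HA f Af s /=; suff /HA[] : A (foldr (@partial R n) f s) by [].
by elim: s => [//|i s /HA[_ _]]; exact.
Qed.

Lemma partialD n (f g : 'rV[R]_n -> R) i :
  (forall x, differentiable f x) -> (forall x, differentiable g x) ->
  partial i (fun x => f x + g x) = (fun x => partial i f x + partial i g x).
Proof.
move=> df dg; apply/funext => x; rewrite /partial.
by rewrite (@deriveD _ _ _ f g)//; exact: diff_derivable.
Qed.

Lemma partialM n (f g : 'rV[R]_n -> R) i :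
  (forall x, differentiable f x) -> (forall x, differentiable g x) ->
  partial i (fun x => f x * g x) = (fun x => f x * partial i g x + partial i f x * g x).
Proof.
move=> df dg; apply/funext => x; rewrite /partial.
rewrite (@deriveM _ _ f g)//; [|exact: diff_derivable..].
by rewrite [X in _ + X = _]mulrC.
Qed.

Lemma partial_cst n (c : R) (i : 'I_n) : partial i (fun=> c) = (fun=> 0).
Proof. by apply/funext => x; rewrite /partial derive_cst. Qed.

Lemma Cb_infty_cst n (c : R) : Cb_infty (fun _ : 'rV[R]_n => c).
Proof.
apply: (@Cb_infty_coind n [set f | exists c, f = fun=> c]); last by exists c.
move=> _ [k ->]; split=> [x||i]; first exact: differentiable_cst.
  by exists `|k|.
by exists 0; exact: partial_cst.
Qed.

(** Sums are included because the Leibniz rule takes a product out of the class of products. *)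
Inductive product_span n : ('rV[R]_n -> R) -> Prop :=
| ProductSpanM f g : Cb_infty f -> Cb_infty g -> product_span (fun x => f x * g x)
| ProductSpanD f g : product_span f -> product_span g ->
    product_span (fun x => f x + g x).

Lemma product_span_Cb_infty n : @product_span n `<=` @Cb_infty R n.
Proof.
apply: Cb_infty_coind => f; elim=> {f} [f g cf cg|f g _ [df [M fM] pf] _ [dg [M' gM] pg]].
  have df x := Cb_infty_differentiable x cf; have dg x := Cb_infty_differentiable x cg.
  have [M fM] := Cb_infty_bounded cf; have [M' gM] := Cb_infty_bounded cg.
  split=> [x||i]; first by apply: (@differentiableM _ _ f g).
    by exists (M * M') => x; rewrite normrM ler_pM.
  rewrite partialM//; apply: ProductSpanD; apply: ProductSpanM => //;
  exact: Cb_infty_partial.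
split=> [x||i]; first by apply: (@differentiableD _ _ _ f g).
  by exists (M + M') => x; apply: le_trans (ler_normD _ _) _; apply: lerD.
by rewrite partialD//; exact: ProductSpanD.
Qed.

Lemma Cb_inftyM n (f g : 'rV[R]_n -> R) : Cb_infty f -> Cb_infty g ->
  Cb_infty (fun x => f x * g x).
Proof. by move=> cf cg; apply: product_span_Cb_infty; exact: ProductSpanM. Qed.

Lemma Cb_inftyD n (f g : 'rV[R]_n -> R) : Cb_infty f -> Cb_infty g ->
  Cb_infty (fun x => f x + g x).
Proof.
move=> cf cg; have c1 := @Cb_infty_cst n 1.
have := product_span_Cb_infty (ProductSpanD (ProductSpanM cf c1) (ProductSpanM cg c1)).
by congr Cb_infty; apply/funext => x; rewrite !mulr1.
Qed.

Section Reindex.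
Context (m n : nat) (sigma : 'I_m -> 'I_n).

Definition reindex_row (x : 'rV[R]_n) : 'rV[R]_m := \row_i x 0 (sigma i).

Lemma differentiable_reindex_row x : differentiable reindex_row x.
Proof.
have -> : reindex_row = \sum_(i < m) (fun x : 'rV_n => x 0 (sigma i) *: delta_mx 0 i).
  apply/funext => y; rewrite fct_sumE; apply/rowP => i; rewrite mxE summxE.
  rewrite (bigD1 i)//= !mxE !eqxx mulr1 big1 ?addr0// => j ji.
  by rewrite !mxE eqxx/= eq_sym (negbTE ji) mulr0.
apply: differentiable_sum => i.
apply: (@differentiableZl _ _ _ (fun y : 'rV[R]_n => y 0 (sigma i)) (delta_mx 0 i)).
exact: differentiable_coord.
Qed.

(** The linear map [reindex_row] sends the direction [j] to the sum of the directions [i] with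
    [sigma i = j], and the differential of [f] is additive. *)
Lemma partial_reindex (f : 'rV[R]_m -> R) j : (forall x, differentiable f x) ->
  partial j (f \o reindex_row) =
  (fun x => \sum_(i < m | sigma i == j) partial i f (reindex_row x)).
Proof.
move=> df; apply/funext => x; rewrite /partial.
have -> : 'D_(delta_mx 0 j) (f \o reindex_row) x =
    'D_(reindex_row (delta_mx 0 j)) f (reindex_row x).
  have shiftE h : reindex_row (h *: delta_mx 0 j + x) =
      h *: reindex_row (delta_mx 0 j) + reindex_row x.
    by apply/rowP => i; rewrite !mxE.
  by rewrite /derive; under eq_fun do rewrite /= shiftE.
under eq_bigr do rewrite deriveE//.
rewrite deriveE// -linear_sum; congr ('d f _ _).
apply/rowP => i; rewrite !mxE eqxx/= summxE.
have [ij|ij] := eqVneq (sigma i) j.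
  rewrite (bigD1 i) ?ij//= !mxE !eqxx big1 ?addr0// => k /andP[_ ki].
  by rewrite mxE eqxx/= eq_sym (negbTE ki).
rewrite big1// => k /eqP kj; rewrite mxE eqxx/=.
by case: eqP => // ik; rewrite ik kj eqxx in ij.
Qed.

(** The closure of the reindexed functions under partial derivatives; 0 accounts for the empty sums
    of [partial_reindex]. *)
Inductive reindex_span : ('rV[R]_n -> R) -> Prop :=
| ReindexSpan0 : reindex_span (fun=> 0)
| ReindexSpanC f : Cb_infty f -> reindex_span (f \o reindex_row)
| ReindexSpanD f g : reindex_span f -> reindex_span g ->
    reindex_span (fun x => f x + g x).

Lemma reindex_span_Cb_infty : reindex_span `<=` @Cb_infty R n.
Proof.
apply: Cb_infty_coind => f; elim=> {f} [|f cf|f g _ [df [M fM] pf] _ [dg [M' gM] pg]].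
- split=> [x||i]; first exact: differentiable_cst.
    by exists 0 => _; rewrite normr0.
  by rewrite partial_cst; exact: ReindexSpan0.
- have df x := Cb_infty_differentiable x cf.
  have [M fM] := Cb_infty_bounded cf.
  split=> [x||j].
  + by apply: differentiable_comp; [exact: differentiable_reindex_row|exact: df].
  + by exists M => x; exact: fM.
  + rewrite partial_reindex//.
    elim: (index_enum _) => [|i r IH].
      rewrite (_ : (fun x => _) = fun=> 0); first exact: ReindexSpan0.
      by apply/funext => x; rewrite big_nil.
    rewrite (_ : (fun x => _) = (fun x =>
      (if sigma i == j then partial i f (reindex_row x) else 0) +
      \sum_(k <- r | sigma k == j) partial k f (reindex_row x))); last first.
      by apply/funext => x; rewrite big_cons; case: ifP => // _; rewrite add0r.
    apply: ReindexSpanD => //; case: (sigma i == j); last exact: ReindexSpan0.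
    by apply: (@ReindexSpanC (partial i f)); exact: Cb_infty_partial.
- split=> [x||i]; first by apply: (@differentiableD _ _ _ f g).
    by exists (M + M') => x; apply: le_trans (ler_normD _ _) _; apply: lerD.
  by rewrite partialD//; exact: ReindexSpanD.
Qed.

Lemma Cb_infty_reindex f : Cb_infty f -> Cb_infty (f \o reindex_row).
Proof. by move=> cf; apply: reindex_span_Cb_infty; exact: ReindexSpanC. Qed.

End Reindex.
End BoundedSmoothFunctions.

(** * Smooth scalars with their derivatives in [H] *)

Section SmoothScalars.
Context (R : realType) (H : completeNormedModType R).
Context (ip : {dot H for (@idfun R)}).
Context (d : measure_display) (Omega : measurableType d).
Context (P : probability Omega R) (W : H -> {RV P >-> R}).
Implicit Types (u v : Omega -> R) (Du Dv : Omega -> H).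

Definition smooth_over n (h : 'I_n -> H) u Du := exists f : 'rV[R]_n -> R,
  [/\ Cb_infty f, u = (fun w => f (process_vector W h w)) &
      Du = (fun w => \sum_(i < n) partial i f (process_vector W h w) *: h i)].

Definition smooth_scalar u Du := exists n (h : 'I_n -> H), smooth_over h u Du.

Lemma smooth_over_widen m n (sigma : 'I_m -> 'I_n) (k : 'I_n -> H) u Du :
  smooth_over (k \o sigma) u Du -> smooth_over k u Du.
Proof.
move=> [f [cf -> ->]]; exists (f \o reindex_row sigma).
have pk w : reindex_row sigma (process_vector W k w) = process_vector W (k \o sigma) w.
  by apply/rowP => i; rewrite !mxE.
split; first exact: Cb_infty_reindex.
  by apply/funext => w /=; rewrite pk.
apply/funext => w; rewrite (partition_big sigma xpredT)//=.
apply: eq_bigr => j _; rewrite partial_reindex; last first.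
  by move=> x; exact: Cb_infty_differentiable.
rewrite pk scaler_suml; apply: eq_bigr => i /eqP ij.
by rewrite /= ij.
Qed.

(** Concatenating the two families of vectors lets sums and products be formed on the underlying
    functions. *)
Lemma smooth_scalar_common u Du v Dv : smooth_scalar u Du -> smooth_scalar v Dv ->
  exists n (k : 'I_n -> H), smooth_over k u Du /\ smooth_over k v Dv.
Proof.
move=> [m [h su]] [n [h' sv]].
pose k (i : 'I_(m + n)) := match fintype.split i with inl j => h j | inr j => h' j end.
have kl : k \o lshift n = h.
  by apply/funext => i; rewrite /k /= (unsplitK (inl i : 'I_m + 'I_n)).
have kr : k \o @rshift m n = h'.
  by apply/funext => i; rewrite /k /= (unsplitK (inr i : 'I_m + 'I_n)).
exists (m + n)%N, k; split.
  by apply: (@smooth_over_widen _ _ (lshift n)); rewrite kl.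
by apply: (@smooth_over_widen _ _ (@rshift m n)); rewrite kr.
Qed.

Lemma smooth_scalar_cst (c : R) : smooth_scalar (fun=> c) (fun=> 0).
Proof.
exists 0%N, (fun=> 0), (fun=> c); split=> //; first exact: Cb_infty_cst.
by apply/funext => w; rewrite big_ord0.
Qed.

Lemma smooth_scalarM u Du v Dv : smooth_scalar u Du -> smooth_scalar v Dv ->
  smooth_scalar (fun w => u w * v w) (fun w => u w *: Dv w + v w *: Du w).
Proof.
move=> su sv; have [n [k [[f [cf -> ->]] [g [cg -> ->]]]]] := smooth_scalar_common su sv.
exists n, k, (fun x => f x * g x); split=> //; first exact: Cb_inftyM.
apply/funext => w; rewrite !scaler_sumr -big_split/=; apply: eq_bigr => i _.
rewrite partialM; [|by move=> x; exact: Cb_infty_differentiable..].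
by rewrite scalerDl !scalerA (mulrC (partial i f _)).
Qed.

Lemma smooth_scalarD u Du v Dv : smooth_scalar u Du -> smooth_scalar v Dv ->
  smooth_scalar (fun w => u w + v w) (fun w => Du w + Dv w).
Proof.
move=> su sv; have [n [k [[f [cf -> ->]] [g [cg -> ->]]]]] := smooth_scalar_common su sv.
exists n, k, (fun x => f x + g x); split=> //; first exact: Cb_inftyD.
apply/funext => w; rewrite -big_split/=; apply: eq_bigr => i _.
rewrite partialD; [|by move=> x; exact: Cb_infty_differentiable..].
by rewrite scalerDl.
Qed.

Lemma smooth_scalar_bounded u Du : smooth_scalar u Du ->
  exists M, forall w, `|u w| <= M /\ `|Du w| <= M.
Proof.
move=> [n [h [f [cf -> ->]]]]; have [M fM] := Cb_infty_bounded cf.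
have /choice[M' pM] := fun i => Cb_infty_bounded (Cb_infty_partial i cf).
exists (Num.max M (\sum_(i < n) M' i * `|h i|)) => w; rewrite !le_max fM; split=> //.
apply/orP; right; apply: le_trans (ler_norm_sum _ _ _) _; apply: ler_sum => i _.
by rewrite normrZ ler_wpM2r.
Qed.

Section Values.
Context (E : normedModType R).

Lemma tensor_suml n (h : 'I_n -> H) (c : 'I_n -> R) (x : E) :
  tensor ip (\sum_(i < n) c i *: h i) x = \sum_(i < n) c i *: tensor ip (h i) x.
Proof.
apply/funext => k; rewrite fct_sumE /tensor.
elim/big_rec2: _ => [|i y1 y2 _ <-]; first by rewrite linear0l scale0r.
by rewrite ipDl scalerDl ipZl -scalerA.
Qed.

Lemma tensorZ (c : R) (h : H) (x : E) : tensor ip (c *: h) x = c *: tensor ip h x.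
Proof. by apply/funext => k; rewrite /tensor ipZl -scalerA. Qed.

Lemma tensorZr (c : R) (h : H) (x : E) : tensor ip h (c *: x) = c *: tensor ip h x.
Proof. by apply/funext => k; rewrite /tensor scalerA mulrC -scalerA. Qed.

Lemma smooth_scalar_derivative u Du (x : E) : smooth_scalar u Du ->
  smooth_derivative ip W (fun w => u w *: x) (fun w => tensor ip (Du w) x).
Proof.
move=> [n [h [f [cf -> ->]]]]; have := SmoothElementary ip W h x cf.
congr smooth_derivative; apply/funext => w.
by rewrite tensor_suml.
Qed.

(** The normal form on which [phi] is expanded one scalar at a time. *)
Lemma smooth_derivative_scalars (F : Omega -> E) (DF : Omega -> H -> E) :
  smooth_derivative ip W F DF ->
  exists l : seq ((Omega -> R) * (Omega -> H) * E),
    [/\ forall t, List.In t l -> smooth_scalar t.1.1 t.1.2,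
        F = (fun w => \sum_(t <- l) t.1.1 w *: t.2) &
        DF = (fun w => \sum_(t <- l) tensor ip (t.1.2 w) t.2)].
Proof.
elim=> {F DF} [n f h x cf|a F F' DF DF' _ [l [sl -> ->]] _ [l' [sl' -> ->]]].
  exists [:: ((fun w => f (process_vector W h w),
    fun w => \sum_(i < n) partial i f (process_vector W h w) *: h i), x)]; split.
  - by move=> t [<-|//]; exists n, h, f.
  - by apply/funext => w; rewrite big_seq1.
  - by apply/funext => w; rewrite big_seq1/= tensor_suml.
exists ([seq ((fun w => a * t.1.1 w, fun w => a *: t.1.2 w), t.2) | t <- l] ++ l').
split.
- move=> t tl; have [] := List.in_app_or _ _ _ tl; last exact: sl'.
  rewrite List.in_map_iff => -[t' [<- /sl st']] /=.
  have := smooth_scalarM (smooth_scalar_cst a) st'.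
  by congr smooth_scalar; apply/funext => w; rewrite scaler0 addr0.
- apply/funext => w; rewrite big_cat big_map scaler_sumr/=; congr (_ + _).
  by apply: eq_bigr => t _; rewrite scalerA.
- apply/funext => w; rewrite big_cat big_map scaler_sumr/=; congr (_ + _).
  by apply: eq_bigr => t _; rewrite tensorZ.
Qed.

End Values.
End SmoothScalars.
(** * Calculus in normed spaces *)

Section MeanValue.
Context (R : realType).

(** Continuous induction: the points up to which the increments from 0 have slope at most [C + e]
    contain their supremum, and the local bound extends them beyond any supremum less than 1. *)
Lemma mean_value_unit_interval (E : normedModType R) (h : R -> E) (C : R) :
  0 <= C ->
  (forall s e : R, 0 <= s <= 1 -> 0 < e ->
    \forall r \near s, `|h r - h s| <= (C + e) * `|r - s|) ->
  `|h 1 - h 0| <= C.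
Proof.
move=> C0 hC; apply/ler_addgt0Pr => e e0; pose D := C + e.
have D0 : 0 <= D by rewrite addr_ge0// ltW.
pose S := [set s : R | 0 <= s <= 1 /\ forall r : R, 0 <= r <= s -> `|h r - h 0| <= D * r].
have S0 : S 0.
  split=> [|r]; first by rewrite lexx ler01.
  by move=> /le_anti <-; rewrite subrr normr0 mulr0.
have supS : has_sup S.
  by split; [exists 0|exists 1 => s [/andP[]]].
pose T := sup S.
have T01 : 0 <= T <= 1.
  apply/andP; split; first by apply: ub_le_sup => //; case: supS.
  by apply: ge_sup => [|s [/andP[]]]//; exists 0.
have ST : S T.
  split=> // r /andP[r0]; rewrite le_eqVlt => /predU1P[->|rT]; last first.
    have [s [s01 Ss] rs] := sup_gt (ex_intro _ _ S0) rT.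
    by apply: Ss; rewrite r0 ltW.
  have /nbhs_ballP[eta /= eta0 hT] := hC T e T01 e0.
  have [s Ss sT] := sup_adherent eta0 supS.
  have sT' : s <= T by apply: ub_le_sup => //; case: supS.
  have : `|h s - h T| <= D * `|s - T|.
    by apply: hT; rewrite /ball/= ger0_norm ?subr_ge0// ltrBlDr -ltrBlDl.
  rewrite (distrC s) (ger0_norm (_ : 0 <= T - s)) ?subr_ge0// => h1.
  have h2 : `|h s - h 0| <= D * s.
    by case: Ss => /andP[s0 _]; apply; rewrite s0 lexx.
  rewrite (_ : h T - h 0 = (h s - h 0) - (h s - h T)); last first.
    by rewrite opprB [RHS]addrC subrKA.
  apply: le_trans (ler_normB _ _) _; apply: le_trans (lerD h2 h1) _.
  by rewrite -mulrDr addrC subrK.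
have T1 : T = 1.
  apply/eqP; rewrite eq_le; case/andP: (T01) => T0 -> /=.
  rewrite leNgt; apply/negP => Tlt1.
  have /nbhs_ballP[eta /= eta0 hT] := hC T e T01 e0.
  pose s := Num.min 1 (T + eta / 2).
  have Ts : T < s by rewrite lt_min Tlt1 ltrDl divr_gt0.
  have s1 : s <= 1 by rewrite ge_min lexx.
  have seta : s <= T + eta / 2 by rewrite ge_min lexx orbT.
  suff /(ub_le_sup supS.2) : S s by rewrite leNgt Ts.
  split=> [|r /andP[r0 rs]]; first by rewrite s1 (le_trans T0 (ltW Ts)).
  have [rT|Tr] := leP r T; first by case: ST => _; apply; rewrite r0.
  have : `|h r - h T| <= D * `|r - T|.
    apply: hT; rewrite /ball/= distrC ger0_norm ?subr_ge0 ?(ltW Tr)//; lra.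
  rewrite (ger0_norm (_ : 0 <= r - T)) ?subr_ge0 ?(ltW Tr)// => h1.
  have h2 : `|h T - h 0| <= D * T by case: ST => _; apply; rewrite T0 lexx.
  rewrite (_ : h r - h 0 = (h T - h 0) + (h r - h T)); last first.
    by rewrite [RHS]addrC subrKA.
  apply: le_trans (ler_normD _ _) _; apply: le_trans (lerD h2 h1) _.
  by rewrite -mulrDr addrC subrK.
by case: ST => _; rewrite T1 => /(_ 1); rewrite mulr1; apply; rewrite ler01 lexx.
Qed.

Section Frechet.
Context (E0 E1 : normedModType R) (f : E0 -> E1).
Hypothesis df : forall x, differentiable f x.

(** Subtracting the linear path [s *: L] yields the Lipschitz bound for [L = 0] and the error of a
    difference quotient for [L] close to the derivative. *)
Lemma mean_value_segment (L : E1) (a v : E0) (C : R) : 0 <= C ->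
  (forall s, 0 <= s <= 1 -> `|'d f (a + s *: v) v - L| <= C) ->
  `|f (a + v) - f a - L| <= C.
Proof.
move=> C0 HC; pose h (s : R) := f (a + s *: v) - s *: L.
have -> : f (a + v) - f a - L = h 1 - h 0.
  by rewrite /h !scale1r !scale0r addr0 subr0 addrAC.
apply: mean_value_unit_interval => // s e s01 e0.
set x := a + s *: v.
have dxv : derivable f x v by apply: diff_derivable.
have /cvgrPdist_le/(_ e e0) : h^-1 *: ((f \o shift x) (h *: v) - f x) @[h --> 0^'] --> 'd f x v.
  have -> : 'd f x v = 'D_v f x by rewrite deriveE.
  by move: dxv => /cvg_ex[l hl]; rewrite /derive (cvg_lim _ hl).
move=> /nbhs_ballP[eta /= eta0 H].
apply/nbhs_ballP; exists eta => //= r sr.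
have [->|rs] := eqVneq r s; first by rewrite !subrr !normr0 mulr0.
have rs0 : r - s != 0 by rewrite subr_eq0.
have := H (r - s); rewrite /ball/= sub0r normrN distrC => /(_ sr rs0).
have -> : (r - s) *: v + x = a + r *: v by rewrite /x addrCA -scalerDl subrK.
set q := f (a + r *: v) - f x => Hq.
have -> : h r - h s = (r - s) *: ((r - s)^-1 *: q - L).
  rewrite scalerBr scalerA divff// scale1r /h /q -/x scalerBl.
  by rewrite !opprD !opprK addrACA.
rewrite normrZ (distrC s) mulrC ler_wpM2r// -(subrK ('d f x v) ((r - s)^-1 *: q)) -addrA.
rewrite addrC; apply: le_trans (ler_normD _ _) _; apply: lerD; first exact: HC.
by rewrite distrC.
Qed.

End Frechet.

Section UniformContinuity.
Context (E0 E1 : normedModType R) (f : E0 -> E1).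
Hypothesis f'_continuous : forall (x : E0) (e : R), 0 < e ->
  \forall y \near x, forall v : E0, `|'d f y v - 'd f x v| <= e * `|v|.

(** Only [x] is confined to the compact set: the Bernstein nodes, in the role of [y], may lead
    outside it. *)
Lemma derivative_unif_continuous (A : set E0) (e : R) : compact A -> 0 < e ->
  exists2 delta, 0 < delta & forall x y, A x -> `|y - x| < delta ->
    forall v, `|'d f y v - 'd f x v| <= e * `|v|.
Proof.
move=> /compact_near_coveringP cA e0.
have e20 : 0 < e / 2 by rewrite divr_gt0.
pose Q (delta : R) x := forall y, `|y - x| < delta ->
  forall v, `|'d f y v - 'd f x v| <= e * `|v|.
have : \forall delta \near (0 : R)^'+, A `<=` Q delta.
  apply: cA => x Ax.
  have /nbhs_ballP[r /= r0 hr] := f'_continuous x e20.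
  have r20 : 0 < r / 2 by rewrite divr_gt0.
  exists (ball x (r / 2), [set delta | delta < r / 2]).
    split=> /=; first exact: nbhsx_ballx.
    exact: nbhs_right_lt.
  move=> [z delta] [/= xz dr] y yz v.
  have hz : ball x r z by apply: le_ball xz; rewrite ler_pdivrMr// ler_peMr ?ltW// ltr1n.
  have hy : ball x r y.
    rewrite (splitr r); apply: ball_triangle xz _.
    by rewrite -ball_normE /ball_/= distrC (lt_trans yz).
  have -> : 'd f y v - 'd f z v = ('d f y v - 'd f x v) - ('d f z v - 'd f x v).
    by rewrite opprB addrC subrKA addrC.
  apply: le_trans (ler_normB _ _) _; apply: le_trans (lerD (hr y hy v) (hr z hz v)) _.
  by rewrite -mulrDl -splitr.
move=> H; have [delta [d0 Hd]] := filter_ex (filterI (nbhs_right_gt (0 : R)) H).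
by exists delta => // x y Ax; exact: Hd.
Qed.

End UniformContinuity.

End MeanValue.

(** * Bernstein polynomials *)

Section DeCasteljau.
Context (R : realType).

(* The Bernstein polynomial of degree [m] with control points [c 0, ..., c m],
   by de Casteljau's recursion, and its derivative. *)
Fixpoint casteljau (V : lmodType R) (m : nat) (c : nat -> V) (t : R) : V :=
  if m is m'.+1 then
    (1 - t) *: casteljau m' c t + t *: casteljau m' (fun k => c k.+1) t
  else c 0.

Fixpoint dcasteljau (V : lmodType R) (m : nat) (c : nat -> V) (t : R) : V :=
  if m is m'.+1 then
    (casteljau m' (fun k => c k.+1) t - casteljau m' c t) +
    ((1 - t) *: dcasteljau m' c t + t *: dcasteljau m' (fun k => c k.+1) t)
  else 0.

Lemma casteljauB (V : lmodType R) m (c c' : nat -> V) t :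
  casteljau m (fun k => c k - c' k) t = casteljau m c t - casteljau m c' t.
Proof.
elim: m c c' => [//|m IH] c c' /=; rewrite IH (IH (fun k => c k.+1)).
by rewrite !scalerBr opprD addrACA.
Qed.

Lemma casteljauZ (V : lmodType R) m (a : R) (c : nat -> V) t :
  casteljau m (fun k => a *: c k) t = a *: casteljau m c t.
Proof.
elim: m c => [//|m IH] c /=; rewrite IH (IH (fun k => c k.+1)) scalerDr !scalerA.
by rewrite ![_ * a]mulrC.
Qed.

(** The derivative is again a Bernstein polynomial, with scaled differences as control points, so
    [casteljau_approx] also applies to it. *)
Lemma dcasteljauS (V : lmodType R) m (c : nat -> V) t :
  dcasteljau m.+1 c t = m.+1%:R *: casteljau m (fun k => c k.+1 - c k) t.
Proof.
elim: m c => [|m IH] c; first by rewrite /= !scaler0 !addr0 scale1r.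
pose D := casteljau m.+1 (fun k => c k.+1 - c k) t.
transitivity (D + m.+1%:R *: D); last by rewrite -[in RHS]natr1 scalerDl scale1r addrC.
transitivity ((casteljau m.+1 (fun k => c k.+1) t - casteljau m.+1 c t) +
  ((1 - t) *: dcasteljau m.+1 c t + t *: dcasteljau m.+1 (fun k => c k.+1) t)) => //.
rewrite -casteljauB !IH; congr (_ + _).
by rewrite /D [casteljau m.+1 _ t]/= scalerDr !scalerA ![_ * m.+1%:R]mulrC.
Qed.

(** The second moment of a binomial variable with parameters [m] and [t], shifted by [a]; the shift
    absorbs the index change of the recursion. *)
Lemma casteljau_sqdev m (a t : R) :
  casteljau m (fun k => (k%:R + a) ^+ 2 : R^o) t = (m%:R * t + a) ^+ 2 + m%:R * t * (1 - t).
Proof.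
elim: m a => [|m IH] a /=; first by rewrite !mul0r addr0.
rewrite IH (_ : (fun k => (k.+1%:R + a) ^+ 2) = (fun k => (k%:R + (a + 1)) ^+ 2)); last first.
  by apply/funext => k; rewrite -natr1 -addrA (addrC 1).
rewrite IH -natr1 /GRing.scale/=; ring.
Qed.

Lemma casteljau_affine m (c : nat -> R^o) (a b t : R) :
  casteljau m (fun k => a + b * c k : R^o) t = a + b * casteljau m c t.
Proof.
elim: m c => [//|m IH] c; rewrite [LHS]/= IH (IH (fun k => c k.+1)) [in RHS]/=.
set x : R := casteljau m c t; set y : R := casteljau m _ t.
by rewrite /GRing.scale/=; ring.
Qed.

(** Each step of the recursion is a convex combination, so error bounds at the control points
    propagate through the same recursion. *)
Lemma casteljau_seminorm (V : lmodType R) (N : V -> \bar R) m (c : nat -> V) L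
    (r : nat -> R) (t : R) :
  (forall x y, (N (x + y)%R <= N x + N y)%E) ->
  (forall a x, 0 <= a -> (N (a *: x)%R <= a%:E * N x)%E) ->
  0 <= t <= 1 -> (forall k, (k <= m)%N -> (N (c k - L)%R <= (r k)%:E)%E) ->
  (N (casteljau m c t - L)%R <= (casteljau m (r : nat -> R^o) t)%:E)%E.
Proof.
move=> ND NZ /andP[t0 t1]; elim: m c r => [|m IH] c r Hr /=; first exact: Hr.
have H1 k : (k <= m)%N -> (N (c k - L)%R <= (r k)%:E)%E by move=> km; exact/Hr/leqW.
have H2 k : (k <= m)%N -> (N (c k.+1 - L)%R <= (r k.+1)%:E)%E by move=> km; exact: Hr.
have -> : (1 - t) *: casteljau m c t + t *: casteljau m (fun k => c k.+1) t - L =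
  (1 - t) *: (casteljau m c t - L) + t *: (casteljau m (fun k => c k.+1) t - L).
  by rewrite !scalerBr addrACA -opprD -scalerDl subrK scale1r.
have t1' : 0 <= 1 - t by rewrite subr_ge0.
apply: le_trans (ND _ _) _; rewrite /GRing.scale/= EFinD !EFinM; apply: leeD.
  by apply: le_trans (NZ _ _ t1') _; apply: lee_wpmul2l; [rewrite lee_fin|exact: (IH c r)].
apply: le_trans (NZ _ _ t0) _; apply: lee_wpmul2l; first by rewrite lee_fin.
exact: (IH (fun k => c k.+1) (fun k => r k.+1)).
Qed.

(* Both for the [n + 1] nodes of degree [n] and for the [n] nodes of the
   derivative, the mean squared distance of [k/n] to [t] is at most [1/n]. *)
Lemma casteljau_approx (V : lmodType R) (N : V -> \bar R) m n (c : nat -> V) L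
    (t e B delta : R) :
  (forall x y, (N (x + y)%R <= N x + N y)%E) ->
  (forall a x, 0 <= a -> (N (a *: x)%R <= a%:E * N x)%E) ->
  0 <= t <= 1 -> 0 <= e -> 0 <= B -> 0 < delta -> (m <= n.+1)%N -> (n <= m)%N ->
  (forall k, (k <= m)%N -> `|k%:R / n.+1%:R - t| <= delta ->
    (N (c k - L)%R <= e%:E)%E) ->
  (forall k, (k <= m)%N -> (N (c k - L)%R <= B%:E)%E) ->
  (N (casteljau m c t - L)%R <= (e + B / delta ^+ 2 / n.+1%:R)%:E)%E.
Proof.
move=> ND NZ t01 e0 B0 d0 mn nm near all; have /andP[t0 t1] := t01.
have n0 : 0 < n.+1%:R :> R by [].
have nn0 : n.+1%:R != 0 :> R by rewrite gt_eqF.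
pose b := B / delta ^+ 2.
have b0 : 0 <= b by rewrite divr_ge0// sqr_ge0.
pose s k : R := (k%:R / n.+1%:R - t) ^+ 2.
(* As in Chebyshev's inequality, a node farther than [delta] from [t] has [b * s k >= B], so
   [e + b * s k] bounds the error at all nodes. *)
apply: (@le_trans _ _ (casteljau m (fun k => e + b * s k : R^o) t)%:E).
  apply: casteljau_seminorm => // k km.
  have [h|h] := leP `|k%:R / n.+1%:R - t| delta.
    by apply: le_trans (near k km h) _; rewrite lee_fin lerDl mulr_ge0// sqr_ge0.
  apply: le_trans (all k km) _; rewrite lee_fin.
  apply: (@le_trans _ _ (b * s k)); last by rewrite lerDr.
  rewrite /b mulrAC -mulrA ler_peMr// ler_pdivlMr ?exprn_gt0// mul1r /s.
  by rewrite -[leRHS]real_normK ?num_real// ler_sqr ?nnegrE ?(ltW d0)// ltW.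
rewrite casteljau_affine lee_fin lerD2l ler_wpM2l//.
have -> : casteljau m (s : nat -> R^o) t =
    0 + n.+1%:R^-1 ^+ 2 * casteljau m (fun k => (k%:R + - (n.+1%:R * t)) ^+ 2 : R^o) t.
  rewrite -casteljau_affine; congr casteljau; apply/funext => k.
  by rewrite add0r -exprMn mulrDr mulrN mulKf// mulrC.
rewrite casteljau_sqdev add0r expr2 -mulrA ler_piMr ?invr_ge0// mulrC ler_pdivrMr// mul1r.
(* For [m = n] the mean of the nodes differs from [t] by [t / n.+1], whose square the bound also
   absorbs. *)
have : m = n \/ m = n.+1.
  by have := nm; rewrite leq_eqVlt => /predU1P[|nm']; [left|right; apply/eqP; rewrite eqn_leq mn].
have n'0 : 0 <= n%:R :> R by [].
case=> ->; rewrite -natr1; nra.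
Qed.

End DeCasteljau.
(** * The chain rule for smooth random variables *)

Section Approximable.
Context (R : realType) (H : completeNormedModType R).
Context (ip : {dot H for (@idfun R)}).
Hypothesis H_hilbert : forall h : H, `|h| ^+ 2 = ip h h.
Context (d : measure_display) (Omega : measurableType d).
Context (P : probability Omega R) (W : H -> {RV P >-> R}).
Context (p : R) (p_gt0 : 0 < p).

Lemma gamma_norm_tensor_le : exists K : R, 0 < K /\
  forall (E : normedModType R) (h : H) (x : E),
    (gamma_norm ip (tensor ip h x) <= (K * (`|h| * `|x|))%:E)%E.
Proof.
have [K [K0 HK]] := gamma_norm_tensor ip; exists K; split=> // E h x.
by have := HK E h x; rewrite -H_hilbert sqrtr_sqr normr_id.
Qed.

Section Fixed.
Context (E : normedModType R).
Implicit Types (G c : Omega -> E) (DG Dc : Omega -> H -> E).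

(** Closure of the graph of the derivative, with measurable majorants in place of L^p norms so that
    [G] and [DG] are arbitrary functions. *)
Definition approximable G DG : Prop := forall e, 0 < e ->
  exists F DF, [/\ smooth_derivative ip W F DF,
    small P p (fun w => @enorm R E (F w - G w)) e &
    small P p (fun w => gamma_norm ip (DF w - DG w)) e].

Lemma small_le_cst (f : Omega -> \bar R) (a e : R) : 0 <= a -> a `^ p <= e ->
  (forall w, (f w <= a%:E)%E) -> small P p f e.
Proof. by move=> a0 ae fa; apply: small_le fa ae (small_cst P p a0). Qed.

Lemma approximable_limit G DG :
  (forall e, 0 < e -> exists G' DG', [/\ approximable G' DG',
    small P p (fun w => @enorm R E (G' w - G w)) e &
    small P p (fun w => gamma_norm ip (DG' w - DG w)) e]) ->
  approximable G DG.
Proof.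
move=> HG e e0; pose e' := e / (2 `^ p * 2).
have k0 : 0 < 2 `^ p * 2 :> R by rewrite mulr_gt0// powR_gt0.
have e'0 : 0 < e' by rewrite divr_gt0.
have ee' : 2 `^ p * (e' + e') <= e.
  rewrite (_ : 2 `^ p * (e' + e') = e' * (2 `^ p * 2)); last by ring.
  by rewrite divfK ?gt_eqF.
have [G' [DG' [aG sG sDG]]] := HG e' e'0.
have [F [DF [sF sFG sDF]]] := aG e' e'0.
exists F, DF; split=> //.
  apply: small_le ee' (smallD p_gt0 sFG sG) => w.
  by rewrite /enorm -EFinD lee_fin -{1}(subrK (G' w) (F w)) -addrA ler_normD.
apply: small_le ee' (smallD p_gt0 sDF sDG) => w.
by rewrite -{1}(subrK (DG' w) (DF w)) -addrA; exact: gamma_normD.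
Qed.

Lemma approximable_smooth F DF : smooth_derivative ip W F DF -> approximable F DF.
Proof.
move=> sF e e0; exists F, DF; split=> //.
  apply: (@small_le_cst _ 0) => [//||w]; first by rewrite powR0 ?gt_eqF// ltW.
  by rewrite /enorm subrr normr0.
apply: (@small_le_cst _ 0) => [//||w]; first by rewrite powR0 ?gt_eqF// ltW.
by rewrite subrr gamma_norm0.
Qed.

Lemma approximableD G DG G' DG' : approximable G DG -> approximable G' DG' ->
  approximable (fun w => G w + G' w) (fun w => DG w + DG' w).
Proof.
move=> aG aG' e e0; pose e' := e / (2 `^ p * 2).
have k0 : 0 < 2 `^ p * 2 :> R by rewrite mulr_gt0// powR_gt0.
have e'0 : 0 < e' by rewrite divr_gt0.
have ee' : 2 `^ p * (e' + e') <= e.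
  rewrite (_ : 2 `^ p * (e' + e') = e' * (2 `^ p * 2)); last by ring.
  by rewrite divfK ?gt_eqF.
have [F [DF [sF sG sDG]]] := aG e' e'0.
have [F' [DF' [sF' sG' sDG']]] := aG' e' e'0.
exists (fun w => 1 *: F w + F' w), (fun w => 1 *: DF w + DF' w).
split; first exact: SmoothLinear.
  apply: small_le ee' (smallD p_gt0 sG sG') => w.
  by rewrite /enorm -EFinD lee_fin scale1r opprD addrACA ler_normD.
apply: small_le ee' (smallD p_gt0 sDG sDG') => w.
by rewrite scale1r opprD addrACA; exact: gamma_normD.
Qed.

(* Smooth scalar factors are built in, so that the class is stable under de
   Casteljau's recursion at a smooth scalar. *)
Definition module_approximable c Dc : Prop := forall u Du, smooth_scalar W u Du ->
  approximable (fun w => u w *: c w)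
    (fun w => tensor ip (Du w) (c w) + u w *: Dc w).

Lemma module_approximable_cst (y : E) : module_approximable (fun=> y) (fun=> 0).
Proof.
move=> u Du su; apply: approximable_smooth.
have := smooth_scalar_derivative ip y su.
by congr smooth_derivative; apply/funext => w; rewrite scaler0 addr0.
Qed.

Lemma module_approximableD c Dc c' Dc' :
  module_approximable c Dc -> module_approximable c' Dc' ->
  module_approximable (fun w => c w + c' w) (fun w => Dc w + Dc' w).
Proof.
move=> mc mc' u Du su; have := approximableD (mc u Du su) (mc' u Du su).
congr approximable; apply/funext => w; first by rewrite scalerDr.
rewrite scalerDr addrACA; congr (_ + _).
by apply/funext => k; rewrite /tensor !fctE scalerDr.
Qed.

Lemma module_approximableM c Dc v Dv : smooth_scalar W v Dv ->
  module_approximable c Dc ->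
  module_approximable (fun w => v w *: c w)
    (fun w => tensor ip (Dv w) (c w) + v w *: Dc w).
Proof.
move=> sv mc u Du su; have := mc _ _ (smooth_scalarM su sv).
congr approximable; apply/funext => w; first by rewrite scalerA.
apply/funext => k; rewrite /tensor !fctE ipDl !ipZl scalerDl !scalerDr !scalerA.
by rewrite addrA [v w * _]mulrC; congr (_ + _); exact: addrC.
Qed.

Lemma module_approximable_casteljau m (c : nat -> Omega -> E)
    (Dc : nat -> Omega -> H -> E) v Dv : smooth_scalar W v Dv ->
  (forall k, module_approximable (c k) (Dc k)) ->
  module_approximable (fun w => casteljau m (c^~ w) (v w))
    (fun w => tensor ip (Dv w) (dcasteljau m (c^~ w) (v w)) +
              casteljau m (Dc^~ w) (v w)).
Proof.
move=> sv; elim: m c Dc => [|m IH] c Dc mc.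
  have := mc 0%N; congr module_approximable; apply/funext => w /=.
  rewrite (_ : tensor _ _ _ = 0) ?add0r//.
  by apply/funext => k; rewrite /tensor scaler0.
have sv1 : smooth_scalar W (fun w => 1 - v w) (fun w => - Dv w).
  have := smooth_scalarD (smooth_scalar_cst W 1) (smooth_scalarM (smooth_scalar_cst W (-1)) sv).
  congr smooth_scalar; apply/funext => w; first by rewrite mulN1r.
  by rewrite scaler0 addr0 scaleN1r add0r.
have := module_approximableD (module_approximableM sv1 (IH c Dc mc))
  (module_approximableM sv (IH (fun k => c k.+1) (fun k => Dc k.+1) (fun k => mc k.+1))).
congr module_approximable; apply/funext => w; apply/funext => k.
rewrite /= /tensor !fctE ipNl scaleNr; set a := ip (Dv w) k.
have sa t (x : E) : t *: (a *: x) = a *: (t *: x) by rewrite !scalerA mulrC.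
rewrite !scalerDr scalerN !sa addrACA [X in _ + X]addrACA.
by rewrite [X in X + _]addrC addrA.
Qed.

Lemma gamma_normZ_le (a C : R) (T : H -> E) : `|a| <= C -> 0 < C ->
  (gamma_norm ip (a *: T) <= C%:E * gamma_norm ip T)%E.
Proof.
move=> aC C0; apply: (@gamma_norm_comp R H ip E E (fun x => a *: x) C T) => //.
  by move=> t x y; rewrite scalerDr !scalerA mulrC.
by move=> x; rewrite normrZ ler_wpM2r.
Qed.

(** Uniform errors survive multiplication because a smooth scalar and its derivative are bounded,
    and constants are L^p-small on a probability space. *)
Lemma module_approximable_uniform c Dc :
  (forall e, 0 < e -> exists c' Dc', [/\ module_approximable c' Dc',
    forall w, `|c' w - c w| <= e &
    forall w, (gamma_norm ip (Dc' w - Dc w)%R <= e%:E)%E]) ->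
  module_approximable c Dc.
Proof.
move=> Hc u Du su; apply: approximable_limit => e e0.
have [K [K0 HK]] := gamma_norm_tensor_le.
have [M0 HM0] := smooth_scalar_bounded su.
pose M := Num.max M0 1.
have M1 : 1 <= M by rewrite le_max lexx orbT.
have M00 : 0 < M by exact: lt_le_trans M1.
have uM w : `|u w| <= M by rewrite le_max (HM0 w).1.
have DuM w : `|Du w| <= M by rewrite le_max (HM0 w).2.
(* [K * M] accounts for the tensor with [Du], and [M] for multiplication by [u]. *)
pose L := K * M + M.
have L0 : 0 < L by rewrite addr_gt0// mulr_gt0.
pose eta := e `^ p^-1 / L.
have eta0 : 0 < eta by rewrite divr_gt0// powR_gt0.
have Leta : (L * eta) `^ p = e.
  by rewrite /eta mulrC divfK ?gt_eqF// -powRrM mulVf ?powRr1 ?gt_eqF// ltW.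
have Leta0 : 0 <= L * eta by rewrite mulr_ge0// ltW.
have [c' [Dc' [mc' cc' Dcc']]] := Hc eta eta0.
exists (fun w => u w *: c' w), (fun w => tensor ip (Du w) (c' w) + u w *: Dc' w).
split; first exact: mc'.
  apply: (small_le_cst Leta0); first by rewrite Leta.
  move=> w; rewrite /enorm lee_fin -scalerBr normrZ.
  apply: (@le_trans _ _ (M * eta)); first exact: ler_pM.
  by apply: ler_wpM2r; [exact: ltW|rewrite lerDr mulr_ge0// ltW].
apply: (small_le_cst Leta0); first by rewrite Leta.
move=> w; rewrite (_ : _ - _ =
    tensor ip (Du w) (c' w - c w) + u w *: (Dc' w - Dc w)); last first.
  rewrite opprD addrACA scalerBr; congr (_ + _).
  by apply/funext => k; rewrite /tensor !fctE scalerBr.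
apply: le_trans (gamma_normD _ _ _) _; rewrite mulrDl EFinD; apply: leeD.
  apply: le_trans (HK _ _ _) _; rewrite lee_fin -mulrA ler_wpM2l ?(ltW K0)//.
  exact: ler_pM.
apply: le_trans (gamma_normZ_le _ (uM w) M00) _.
by rewrite EFinM; apply: lee_wpmul2l; [rewrite lee_fin ltW|exact: Dcc'].
Qed.

End Fixed.

(** * Bernstein replacement, one scalar at a time *)

Section ChainRule.
Context (E0 E1 : normedModType R) (phi : E0 -> E1) (C : R).
Hypothesis phi_differentiable : forall x : E0, differentiable phi x.
Hypothesis phi'_continuous : forall (x : E0) (e : R), 0 < e ->
  \forall y \near x, forall v : E0, `|'d phi y v - 'd phi x v| <= e * `|v|.
Hypothesis C_gt0 : 0 < C.
Hypothesis phi'_bounded : forall x v : E0, `|'d phi x v| <= C * `|v|.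
Implicit Types (l : seq ((Omega -> R) * (Omega -> H) * E0)) (y : E0).

(** The offset [y] receives the replaced variable, frozen at a node. *)
Definition combination l y w := y + \sum_(t <- l) t.1.1 w *: t.2.

Definition combination_derivative l y w : H -> E1 :=
  \sum_(t <- l) tensor ip (t.1.2 w) ('d phi (combination l y w) t.2).

(** The values lie in a continuous image of a product of segments; this compactness supplies uniform
    continuity of the derivative in infinite dimension. *)
Lemma combination_compact l y : (forall t, List.In t l -> smooth_scalar W t.1.1 t.1.2) ->
  exists A : set E0, compact A /\ forall w, A (combination l y w).
Proof.
elim: l y => [|t l IH] y sl.
  exists [set y]; split; first exact: compact_set1.
  by move=> w; rewrite /combination big_nil addr0.
have [A [cA HA]] := IH y (fun t' h => sl t' (or_intror h)).
have [M HM] := smooth_scalar_bounded (sl t (or_introl erefl)).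
exists ((fun z : E0 * R => z.1 + z.2 *: t.2) @` (A `*` `[- M, M]%classic)); split.
  apply: continuous_compact; last first.
    by apply: compact_setX => //; exact: segment_compact.
  apply: continuous_subspaceT => z; apply: continuousD; first exact: cvg_fst.
  by apply: continuousZr_tmp; exact: cvg_snd.
move=> w; exists (combination l y w, t.1.1 w).
  by split => //=; rewrite in_itv/= -ler_norml; exact: (HM w).1.
by rewrite /combination big_cons/= addrAC addrA.
Qed.

(** [Q] is uniform in [w] and [A], so [A] can be a difference of derivatives of [phi] at random
    points. *)
Lemma combination_derivative_bound l :
  (forall t, List.In t l -> smooth_scalar W t.1.1 t.1.2) ->
  exists2 Q, 0 <= Q & forall w (A : E0 -> E1) eta, 0 <= eta ->
    (forall x, `|A x| <= eta * `|x|) ->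
    (gamma_norm ip (\sum_(t <- l) tensor ip (t.1.2 w) (A t.2))%R <= (Q * eta)%:E)%E.
Proof.
have [K [K0 HK]] := gamma_norm_tensor_le.
elim: l => [|t l IH] sl.
  by exists 0 => // w A eta _ _; rewrite big_nil gamma_norm0 mul0r.
have [Q Q0 HQ] := IH (fun t' h => sl t' (or_intror h)).
have [M HM] := smooth_scalar_bounded (sl t (or_introl erefl)).
exists (K * (`|M| * `|t.2|) + Q) => [|w A eta eta0 HA].
  by rewrite addr_ge0// !mulr_ge0// ltW.
rewrite big_cons; apply: le_trans (gamma_normD _ _ _) _.
rewrite mulrDl EFinD; apply: leeD; last exact: HQ.
apply: le_trans (HK _ _ _) _; rewrite lee_fin -!mulrA ler_wpM2l ?(ltW K0)//.
apply: ler_pM => //; last by rewrite mulrC.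
exact: le_trans (HM w).2 (ler_norm _).
Qed.

Lemma lipschitz_phi a v : `|phi (a + v) - phi a| <= C * `|v|.
Proof.
have := @mean_value_segment R E0 E1 phi phi_differentiable 0 a v (C * `|v|).
rewrite subr0; apply; first by rewrite mulr_ge0// ltW.
by move=> s _; rewrite subr0.
Qed.

(** At a node the first variable is deterministic, so the induction hypothesis applies to each
    control point. Values ([est1]), the derivative in the replaced variable ([est2]) and the
    derivative in the others ([est3]) all come from [casteljau_approx]. *)
Lemma module_approximable_chain l y :
  (forall t, List.In t l -> smooth_scalar W t.1.1 t.1.2) ->
  module_approximable (fun w => phi (combination l y w)) (combination_derivative l y).
Proof.
elim: l y => [|[[u Du] x] l IH] y sl.
  have := module_approximable_cst (phi y).
  congr module_approximable; apply/funext => w.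
    by rewrite /combination big_nil addr0.
  by rewrite /combination_derivative big_nil.
have [A [cA HA]] := combination_compact y sl.
have su : smooth_scalar W u Du := sl _ (or_introl erefl).
have {}sl t : List.In t l -> smooth_scalar W t.1.1 t.1.2.
  by move=> h; exact: (sl t (or_intror h)).
have [M0 HM0] := smooth_scalar_bounded su.
pose M := Num.max M0 1.
have M1 : 1 <= M by rewrite le_max lexx orbT.
have uM w : `|u w| <= M by rewrite le_max (HM0 w).1.
have M20 : 0 < 2 * M by rewrite mulr_gt0// (lt_le_trans _ M1).
(* An affine change of variable from [[-M, M]] to [[0, 1]], compensated by [x'] and [y'] below:
   [y + u *: x = y' + v *: x']. *)
pose v w := (2 * M)^-1 * (u w + M); pose Dv w := (2 * M)^-1 *: Du w.
have sv : smooth_scalar W v Dv.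
  have := smooth_scalarM (smooth_scalar_cst W (2 * M)^-1)
    (smooth_scalarD su (smooth_scalar_cst W M)).
  by congr smooth_scalar; apply/funext => w; rewrite addr0 scaler0 addr0.
have v01 w : 0 <= v w <= 1.
  have := uM w; rewrite ler_norml => /andP[uM1 uM2].
  rewrite /v mulrC divr_ge0 ?(ltW M20)//=; last by lra.
  by rewrite ler_pdivrMr// mul1r; lra.
pose x' := (2 * M) *: x; pose y' := y - M *: x.
pose pt s w := combination l (y' + s *: x') w.
have ptE w : combination ((u, Du, x) :: l) y w = pt (v w) w.
  rewrite /pt /combination big_cons/= addrA; congr (_ + _).
  rewrite /y' /x' scalerA mulrAC mulVf ?gt_eqF// mul1r scalerDl.
  by rewrite [u w *: x + _]addrC addrA subrK.
have pt_shift s r w : pt r w = pt s w + (r - s) *: x'.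
  by rewrite /pt /combination [RHS]addrAC -[in RHS](addrA y') -scalerDl (addrC s) subrK.
have -> : (fun w => phi (combination ((u, Du, x) :: l) y w)) = (fun w => phi (pt (v w) w)).
  by apply/funext => w; rewrite ptE.
pose Dl w s := \sum_(t <- l) tensor ip (t.1.2 w) ('d phi (pt s w) t.2).
have -> : combination_derivative ((u, Du, x) :: l) y =
    (fun w => tensor ip (Dv w) ('d phi (pt (v w) w) x') + Dl w (v w)).
  apply/funext => w; rewrite /combination_derivative big_cons/= /Dl !ptE; congr (_ + _).
  by rewrite /x' linearZ tensorZ/= tensorZr scalerA mulVf ?scale1r// gt_eqF.
have {}HA w : A (pt (v w) w) by rewrite -ptE.
have [K [K0 HK]] := gamma_norm_tensor_le.
have [D0 HD0] := smooth_scalar_bounded sv.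
have [Q Q0 HQ] := combination_derivative_bound sl.
have DvD w : `|Dv w| <= `|D0| := le_trans (HD0 w).2 (ler_norm _).
pose X := `|x'|; have X0 : 0 <= X by exact: normr_ge0.
pose KD := K * `|D0|; have KD0 : 0 <= KD by rewrite mulr_ge0// ltW.
apply: module_approximable_uniform => e e0.
(* [Z] bounds the total weight of [eta] in the estimates, as [B] below does for the Chebyshev
   remainder; each contributes at most [e / 2]. *)
pose Z := 1 + KD * X + Q.
have Z1 : 1 <= Z by rewrite /Z -addrA lerDl addr_ge0// mulr_ge0.
have Z0 : 0 < Z by exact: lt_le_trans Z1.
pose eta := e / 2 / Z.
have eta0 : 0 < eta by rewrite !divr_gt0.
have [delta0 delta00 HU] := derivative_unif_continuous phi'_continuous cA eta0.
(* The first bound keeps parameters within [2 * delta] inside the range of uniform continuity, the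
   factor 2 leaving room for one mesh step in a difference quotient; the second makes the Lipschitz
   error at most [eta]. *)
pose delta := Num.min (delta0 / (2 * (X + 1))) (eta / (C * X + 1)).
have X10 : 0 < X + 1 by rewrite ltr_wpDl.
have CX0 : 0 <= C * X by rewrite mulr_ge0// ltW.
have CX10 : 0 < C * X + 1 by rewrite ltr_wpDl.
have delta_gt0 : 0 < delta by rewrite lt_min !divr_gt0// mulr_gt0.
have delta_delta0 : 2 * delta * X < delta0.
  have : delta <= delta0 / (2 * (X + 1)) by rewrite ge_min lexx.
  rewrite ler_pdivlMr ?mulr_gt0// => h; apply: lt_le_trans h.
  rewrite (_ : delta * (2 * (X + 1)) = 2 * delta * X + 2 * delta); last by ring.
  by rewrite ltrDl mulr_gt0.
have delta_eta : C * X * delta <= eta.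
  have : delta <= eta / (C * X + 1) by rewrite ge_min lexx orbT.
  rewrite ler_pdivlMr// => h; apply: le_trans h.
  by rewrite mulrC ler_wpM2l ?(ltW delta_gt0)// lerDl.
pose B := C * X + KD * (2 * C * X) + Q * (2 * C).
have B0 : 0 <= B by rewrite !addr_ge0// !mulr_ge0// ltW.
have [n [nd nB]] : exists n : nat, n.+1%:R^-1 <= delta /\ B / delta ^+ 2 / n.+1%:R <= e / 2.
  pose a := Num.min delta (e / 2 / (B / delta ^+ 2 + 1)).
  have b0 : 0 <= B / delta ^+ 2 by rewrite divr_ge0// sqr_ge0.
  have b10 : 0 < B / delta ^+ 2 + 1 by rewrite ltr_wpDl.
  have a0 : 0 < a by rewrite lt_min delta_gt0 !divr_gt0.
  have /cvgrPdist_lt/(_ a a0)[n _ /(_ n (leqnn _))/=] := @cvg_harmonic R.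
  rewrite sub0r normrN ger0_norm ?invr_ge0// lt_min => /andP[/ltW h1 /ltW h2].
  exists n; split=> //; apply: le_trans (ler_wpM2l b0 h2) _.
  rewrite mulrCA ler_piMr ?divr_ge0 ?(ltW e0)// ler_pdivrMr// mul1r lerDl.
  exact: ler01.
pose beta := (delta ^+ 2)^-1 / n.+1%:R.
have beta0 : 0 <= beta by rewrite divr_ge0// invr_ge0 sqr_ge0.
have BE : B / delta ^+ 2 / n.+1%:R = B * beta by rewrite -mulrA.
rewrite BE in nB.
pose node k : R := k%:R / n.+1%:R.
have node_le k w : (k <= n.+1)%N -> `|node k - v w| <= 1.
  move=> kn; have /andP[v0 v1] := v01 w.
  have k0 : 0 <= node k by rewrite divr_ge0.
  have k1 : node k <= 1 by rewrite ler_pdivrMr// mul1r ler_nat.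
  by rewrite ler_norml; apply/andP; split; lra.
pose c k w := phi (pt (node k) w); pose Dc k := combination_derivative l (y' + node k *: x').
have mc k : module_approximable (c k) (Dc k) by exact: IH.
pose c' w := casteljau n.+1 (c^~ w) (v w).
pose dc' w := dcasteljau n.+1 (c^~ w) (v w).
pose Dc' w := casteljau n.+1 (Dc^~ w) (v w).
have [_ N0 _ ND] := seminorm_enorm E1.
have NZ (a : R) (z : E1) : 0 <= a -> (enorm (a *: z)%R <= a%:E * enorm z)%E.
  by move=> a0; rewrite /enorm normrZ ger0_norm.
have near_pt s w : `|s - v w| <= 2 * delta -> forall h,
    `|'d phi (pt s w) h - 'd phi (pt (v w) w) h| <= eta * `|h|.
  move=> sv' h; apply: HU (HA w) _ _.
  rewrite (pt_shift (v w) s) addrAC subrr add0r normrZ.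
  by apply: le_lt_trans delta_delta0; rewrite ler_wpM2r.
have est1 w : `|c' w - phi (pt (v w) w)| <= eta + C * X * beta.
  rewrite -lee_fin -/(enorm _) /beta mulrA.
  apply: casteljau_approx => //; first exact: ltW.
    move=> k kn kd; rewrite /enorm lee_fin /c (pt_shift (v w)).
    apply: le_trans (lipschitz_phi _ _) _; apply: le_trans delta_eta.
    by rewrite normrZ [`|node k - _| * _]mulrC mulrA ler_wpM2l.
  move=> k kn; rewrite /enorm lee_fin /c (pt_shift (v w)).
  apply: le_trans (lipschitz_phi _ _) _; rewrite ler_wpM2l ?(ltW C_gt0)//.
  by rewrite normrZ ler_piMl// node_le.
have est2 w : `|dc' w - 'd phi (pt (v w) w) x'| <= eta * X + 2 * C * X * beta.
  rewrite -lee_fin -/(enorm _) /beta mulrA /dc' dcasteljauS -casteljauZ.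
  (* The mean value inequality between adjacent nodes: a scaled difference is as close to [L] as the
     derivatives along the segment. *)
  have step k (L : E1) (a : R) : 0 <= a -> (forall s, 0 <= s <= 1 ->
      `|'d phi (pt (node k + s / n.+1%:R) w) x' - L| <= a) ->
      `|n.+1%:R *: (c k.+1 w - c k w) - L| <= a.
    move=> a0 Ha; have nn : n.+1%:R != 0 :> R by rewrite pnatr_eq0.
    have node1 : node k.+1 - node k = n.+1%:R^-1.
      by rewrite /node -mulrBl -natr1 addrAC subrr add0r mul1r.
    have -> : n.+1%:R *: (c k.+1 w - c k w) - L =
        n.+1%:R *: (phi (pt (node k) w + n.+1%:R^-1 *: x') - phi (pt (node k) w)
          - n.+1%:R^-1 *: L).
      rewrite /c (pt_shift (node k)) node1 [RHS]scalerBr.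
      by rewrite (scalerA n.+1%:R _ L) divff// scale1r.
    rewrite normrZ ger0_norm// mulrC -ler_pdivlMr//.
    apply: mean_value_segment => //; first by rewrite divr_ge0.
    move=> s s01; rewrite linearZ/= -scalerBr normrZ ger0_norm ?invr_ge0// mulrC.
    rewrite ler_wpM2r ?invr_ge0//; have := Ha s s01.
    rewrite (pt_shift (node k) (node k + _)) (addrC (node k)) addrK.
    by rewrite (scalerA s n.+1%:R^-1 x').
  apply: casteljau_approx => //.
  - by rewrite mulr_ge0// ltW.
  - by rewrite !mulr_ge0// ltW.
  - move=> k kn kd; rewrite /enorm lee_fin; apply: step; first by rewrite mulr_ge0// ltW.
    move=> s /andP[s0 s1]; apply: near_pt.
    rewrite addrAC; apply: le_trans (ler_normD _ _) _.
    rewrite mulr2n mulrDl mul1r; apply: lerD => //.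
    rewrite ger0_norm ?divr_ge0//; apply: le_trans nd.
    by rewrite ler_piMl// invr_ge0.
  - move=> k kn; rewrite /enorm lee_fin; apply: step; first by rewrite !mulr_ge0// ltW.
    move=> s _; apply: le_trans (ler_normB _ _) _.
    by rewrite -mulrA mulr_natl mulr2n; apply: lerD; exact: phi'_bounded.
have est3 w : (gamma_norm ip (Dc' w - Dl w (v w))%R <= (Q * eta + Q * (2 * C) * beta)%:E)%E.
  have DcE k : Dc k w - Dl w (v w) = \sum_(t <- l) tensor ip (t.1.2 w)
      ('d phi (pt (node k) w) t.2 - 'd phi (pt (v w) w) t.2).
    rewrite /Dc /combination_derivative /Dl -sumrB; apply: eq_bigr => t _.
    by apply/funext => h; rewrite /tensor !fctE scalerBr.
  rewrite /beta (mulrA (Q * (2 * C))); apply: casteljau_approx => //.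
  - by move=> *; exact: gamma_normD.
  - move=> a T; rewrite le_eqVlt => /predU1P[<-|a0].
      by rewrite scale0r gamma_norm0 mul0e.
    by apply: gamma_normZ_le; rewrite ?ger0_norm ?(ltW a0).
  - by rewrite mulr_ge0// ltW.
  - by rewrite !mulr_ge0// ltW.
  - move=> k kn kd; rewrite DcE.
    apply: (HQ w (fun z => 'd phi (pt (node k) w) z - 'd phi (pt (v w) w) z)); first exact: ltW.
    by apply: near_pt; apply: le_trans kd _; rewrite ler_peMl ?ler1n// ltW.
  - move=> k kn; rewrite DcE.
    apply: (HQ w (fun z => 'd phi (pt (node k) w) z - 'd phi (pt (v w) w) z)).
      by rewrite mulr_ge0// ltW.
    move=> z; apply: le_trans (ler_normB _ _) _.
    by rewrite -mulrA mulr_natl mulr2n; apply: lerD; exact: phi'_bounded.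
exists c', (fun w => tensor ip (Dv w) (dc' w) + Dc' w); split.
- exact: module_approximable_casteljau.
- move=> w; apply: le_trans (est1 w) _; rewrite (splitr e); apply: lerD.
    by rewrite /eta ler_pdivrMr// ler_peMr// divr_ge0// ltW.
  by apply: le_trans nB; rewrite ler_wpM2r// /B -addrA lerDl addr_ge0// !mulr_ge0// ltW.
- move=> w; rewrite (_ : _ - _ = tensor ip (Dv w) (dc' w - 'd phi (pt (v w) w) x') +
    (Dc' w - Dl w (v w))); last first.
    rewrite opprD addrACA; congr (_ + _).
    by apply/funext => h; rewrite /tensor !fctE scalerBr.
  apply: le_trans (gamma_normD _ _ _) _.
  apply: le_trans (leeD (HK _ _ _) (est3 w)) _; rewrite -EFinD lee_fin.
  apply: (@le_trans _ _ (KD * (eta * X + 2 * C * X * beta) + (Q * eta + Q * (2 * C) * beta))).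
    rewrite lerD2r /KD -mulrA ler_wpM2l ?(ltW K0)//.
    by apply: ler_pM => //; exact: est2.
  apply: (@le_trans _ _ (eta * Z + B * beta)).
    have h1 : 0 <= C * X * beta by rewrite mulr_ge0.
    by rewrite /Z /B; nra.
  by rewrite (splitr e); apply: lerD => //; rewrite /eta divfK// gt_eqF.
Qed.

End ChainRule.
End Approximable.
(** * The chain rule *)

Section SmoothMeasurability.
Context (R : realType) (H : completeNormedModType R).
Context (ip : {dot H for (@idfun R)}).
Hypothesis H_hilbert : forall h : H, `|h| ^+ 2 = ip h h.
Context (d : measure_display) (Omega : measurableType d).
Context (P : probability Omega R) (W : H -> {RV P >-> R}).

Lemma simple_limit_smooth_scalar (u : Omega -> R) (Du : Omega -> H) :
  smooth_scalar W u Du -> simple_limit u /\ simple_limit Du.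
Proof.
move=> [n [h [f [cf -> ->]]]].
have sW : simple_limit (process_vector W h : Omega -> 'rV[R]_n).
  by apply: simple_limit_row => i; exact: measurable_funPT.
have cont g : Cb_infty g -> continuous (g : 'rV[R]_n -> R).
  by move=> cg x; apply: differentiable_continuous; exact: Cb_infty_differentiable.
split; first exact: simple_limit_comp (cont _ cf) sW.
apply: (@simple_limit_comp _ _ _ _ (fun x => \sum_(i < n) partial i f x *: h i)) sW => x.
elim: (index_enum _) => [|i r IH].
  rewrite (_ : (fun y => _) = fun=> 0); first exact: cst_continuous.
  by apply/funext => y; rewrite big_nil.
rewrite (_ : (fun y => _) = (fun y => partial i f y *: h i +
  \sum_(j <- r) partial j f y *: h j)); last by apply/funext => y; rewrite big_cons.
apply: continuousD IH; apply: continuousZr_tmp.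
exact: (cont _ (Cb_infty_partial i cf)).
Qed.

Lemma strongly_measurable_sum (V : zmodType) (N : V -> \bar R) (I : Type)
    (l : seq I) (f : I -> Omega -> V) : seminorm N ->
  (forall i, List.In i l -> strongly_measurable P N measurable (f i)) ->
  strongly_measurable P N measurable (fun w => \sum_(i <- l) f i w).
Proof.
move=> sN; elim: l => [|i l IH] mf.
  under eq_fun do rewrite big_nil.
  exists (fun _ _ => 0); case: sN => N0 _ _ _; split=> [k|].
    by have [c1 c2] := @simple_map_cst _ Omega V 0; split=> // w; rewrite /= N0 ltry.
  by apply: aeW => w; rewrite subrr N0; exact: cvg_cst.
under eq_fun do rewrite big_cons.
apply: strongly_measurableD => //; first by apply: mf; left.
by apply: IH => j jl; apply: mf; right.
Qed.

Lemma strongly_measurable_smooth (E : normedModType R) (F : Omega -> E)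
    (DF : Omega -> H -> E) : smooth_derivative ip W F DF ->
  strongly_measurable P (@enorm R E) measurable F /\
  strongly_measurable P (@gamma_norm R H ip E) measurable DF.
Proof.
move=> /smooth_derivative_scalars[l [sl -> ->]]; split.
  apply: strongly_measurable_sum; first exact: seminorm_enorm.
  move=> t /sl /simple_limit_smooth_scalar[su _].
  apply: (@simple_limit_strongly_measurable R _ _ P R^o E _ t.1.1 (fun r => r *: t.2) `|t.2|) su.
  - exact: seminorm_enorm.
  - by move=> x; rewrite /enorm ltry.
  - by move=> x y; rewrite /enorm lee_fin -scalerBl normrZ mulrC.
apply: strongly_measurable_sum; first exact: seminorm_gamma_norm.
move=> t /sl /simple_limit_smooth_scalar[_ sDu].
have [K [K0 HK]] := gamma_norm_tensor_le H_hilbert.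
apply: (@simple_limit_strongly_measurable R _ _ P H _ _ t.1.2
  (fun h => tensor ip h t.2) (K * `|t.2|)) sDu.
- exact: seminorm_gamma_norm.
- by move=> h; apply: le_lt_trans (HK _ _ _) _; rewrite ltry.
- move=> h h'; rewrite (_ : _ - _ = tensor ip (h - h') t.2).
    by apply: le_trans (HK _ _ _) _; rewrite lee_fin -mulrA ler_wpM2l ?(ltW K0)// mulrC.
  by apply/funext => k; rewrite /tensor !fctE ipDl ipNl scalerBl.
Qed.

End SmoothMeasurability.

(** * From smooth variables to the domain of the closure *)

Section Composition.
Context (R : realType) (H : completeNormedModType R).
Context (ip : {dot H for (@idfun R)}).
Hypothesis H_hilbert : forall h : H, `|h| ^+ 2 = ip h h.
Context (d : measure_display) (Omega : measurableType d).
Context (P : probability Omega R) (W : H -> {RV P >-> R}).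
Context (p : R) (p_gt0 : 0 < p).
Context (E0 E1 : normedModType R) (phi : E0 -> E1) (C : R).
Hypothesis phi_differentiable : forall x : E0, differentiable phi x.
Hypothesis phi'_continuous : forall (x : E0) (e : R), 0 < e ->
  \forall y \near x, forall v : E0, `|'d phi y v - 'd phi x v| <= e * `|v|.
Hypothesis C_gt0 : 0 < C.
Hypothesis phi'_bounded : forall x v : E0, `|'d phi x v| <= C * `|v|.
Local Notation N0 := (@gamma_norm R H ip E0).
Local Notation N1 := (@gamma_norm R H ip E1).

Lemma phi_dist x y : `|phi x - phi y| <= C * `|x - y|.
Proof.
have := lipschitz_phi phi_differentiable C_gt0 phi'_bounded y (x - y).
by rewrite (addrC y) subrK.
Qed.

Lemma gamma_norm_derivative x (T : H -> E0) : (N1 ('d phi x \o T) <= C%:E * N0 T)%E.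
Proof. by apply: gamma_norm_comp => // t y z; rewrite linearP. Qed.

Lemma gamma_norm_derivative_dist x y (T : H -> E0) :
  (N1 (('d phi x \o T) - ('d phi y \o T))%R <= (2 * C)%:E * N0 T)%E.
Proof.
apply: le_trans (seminormB (@seminorm_gamma_norm R H ip E1) _ _) _.
rewrite (_ : 2 * C = C + C) ?EFinD ?ge0_muleDl ?lee_fin ?(ltW C_gt0)//.
  by apply: leeD; exact: gamma_norm_derivative.
by rewrite mulr_natl mulr2n.
Qed.

Lemma cvg_enorm (E : normedModType R) (a : nat -> E) x :
  (fun k => enorm (a k - x)) @ \oo --> 0%E -> a @ \oo --> x.
Proof.
move=> ax; apply/cvgrPdist_lt => e e0.
have : \forall k \near \oo, (enorm (a k - x)%R < e%:E)%E.
  by apply: (ax _ (open_ereal_lt' _)); rewrite lte_fin.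
by apply: filterS => k; rewrite /enorm lte_fin distrC.
Qed.

(** The ideal property, applied to the difference of the two derivatives, turns operator norm
    continuity into convergence in the gamma-norm. *)
Lemma gamma_norm_derivative_cvg (a : nat -> E0) x (T : H -> E0) :
  (N0 T < +oo)%E -> (fun k => enorm (a k - x)) @ \oo --> 0%E ->
  (fun k => N1 (('d phi (a k) \o T) - ('d phi x \o T))) @ \oo --> 0%E.
Proof.
move=> Tfin /cvg_enorm ax.
have N1ge0 S : (0 <= N1 S)%E by exact: gamma_norm_ge0.
have Tn : N0 T \is a fin_num by rewrite ge0_fin_numE// gamma_norm_ge0.
pose b := fine (N0 T); have TE : N0 T = b%:E by rewrite fineK.
have b0 : 0 <= b by rewrite fine_ge0// gamma_norm_ge0.
have small e : 0 < e -> \forall k \near \oo,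
    (N1 (('d phi (a k) \o T) - ('d phi x \o T))%R <= e%:E)%E.
  move=> e0; have eb : 0 < e / (b + 1) by rewrite divr_gt0// ltr_wpDl.
  have : \forall k \near \oo, forall v, `|'d phi (a k) v - 'd phi x v| <= e / (b + 1) * `|v|.
    exact: (ax _ (phi'_continuous x eb)).
  apply: filterS => k hk.
  have := @gamma_norm_comp R H ip E0 E1 (fun v => 'd phi (a k) v - 'd phi x v) _ T _ eb hk.
  move=> /(_ _)/le_trans; apply.
    by move=> t y z; rewrite [X in X - _]linearP [X in _ - X]linearP scalerBr opprD addrACA.
  by rewrite TE -EFinM lee_fin mulrAC ler_pdivrMr ?ltr_wpDl// ler_wpM2l ?(ltW e0)// lerDl.
apply/fine_cvgP; split.
  by apply: filterS (small 1 ltr01) => k hk; rewrite ge0_fin_numE// (le_lt_trans hk)// ltry.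
apply/cvgrPdist_le => e e0; apply: filterS (small e e0) => k hk /=.
rewrite sub0r normrN ger0_norm ?fine_ge0// -lee_fin fineK//.
by rewrite ge0_fin_numE// (le_lt_trans hk)// ltry.
Qed.

Lemma strongly_measurable_phi (F : Omega -> E0) :
  strongly_measurable P (@enorm R E0) measurable F ->
  strongly_measurable P (@enorm R E1) measurable (phi \o F).
Proof.
move=> mF; apply: (strongly_measurable_op (op := fun a _ => phi a) mF mF).
  by move=> a b _ _; rewrite /enorm ltry.
move=> a b x y _ _ ax _.
apply: (@cvge0_le _ _ (fun k => C%:E * enorm (a k - x)%R)%E).
- by move=> k; rewrite /enorm lee_fin.
- by apply: nearW => k; rewrite /enorm -EFinM lee_fin phi_dist.
- by rewrite -(mule0 C%:E); apply: cvgeZl.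
Qed.

Lemma strongly_measurable_derivative (F : Omega -> E0) (DF : Omega -> H -> E0) :
  strongly_measurable P (@enorm R E0) measurable F ->
  strongly_measurable P N0 measurable DF ->
  strongly_measurable P N1 measurable (fun w => 'd phi (F w) \o DF w).
Proof.
move=> mF mDF.
apply: (strongly_measurable_op (op := fun a (T : H -> E0) => 'd phi a \o T) mF mDF).
  move=> a T _ Tfin; apply: le_lt_trans (gamma_norm_derivative _ _) _.
  by rewrite lte_mul_pinfty// lee_fin ltW.
move=> a T x S _ Tfin ax TS.
have Sfin : (N0 S < +oo)%E.
  have := seminorm_cvg_fin (@seminorm_gamma_norm R H ip E0) Tfin TS.
  by rewrite ge0_fin_numE ?gamma_norm_ge0.
(* The first term uses the bound on the derivative, uniform in [a k]; in the second the operator [S]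
   is fixed. *)
apply: (@cvge0_le _ _ (fun k => C%:E * N0 (T k - S)%R +
    N1 (('d phi (a k) \o S) - ('d phi x \o S))%R)%E).
- by move=> k; exact: gamma_norm_ge0.
- apply: nearW => k.
  apply: le_trans (seminorm_split (@seminorm_gamma_norm R H ip E1) _
    (('d phi (a k) \o S) - ('d phi x \o S))) _.
  apply: leeD => //; rewrite opprB addrA subrK.
  have -> : ('d phi (a k) \o T k) - ('d phi (a k) \o S) = 'd phi (a k) \o (T k - S).
    by apply/funext => h; rewrite /= !fctE/= linearB.
  exact: gamma_norm_derivative.
- rewrite -(adde0 0%E); apply: cvgeD => //; last exact: gamma_norm_derivative_cvg.
  by rewrite -[X in _ --> X](mule0 C%:E); apply: cvgeZl.
Qed.

Lemma approximable_phi_smooth (F : Omega -> E0) (DF : Omega -> H -> E0) :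
  smooth_derivative ip W F DF ->
  approximable ip W p (phi \o F) (fun w => 'd phi (F w) \o DF w).
Proof.
move=> /smooth_derivative_scalars[l [sl -> ->]].
have := module_approximable_chain H_hilbert p_gt0 phi_differentiable phi'_continuous
  C_gt0 phi'_bounded 0 sl (smooth_scalar_cst W 1).
have combE w : combination l 0 w = \sum_(t <- l) t.1.1 w *: t.2.
  by rewrite /combination add0r.
congr approximable; apply/funext => w /=; first by rewrite scale1r combE.
rewrite scale1r /combination_derivative (_ : tensor ip 0 _ = 0); last first.
  by apply/funext => k; rewrite /tensor linear0l scale0r.
rewrite add0r; apply/funext => h; rewrite combE /= !fct_sumE linear_sum.
by apply: eq_bigr => t _; rewrite /tensor linearZ.
Qed.

Lemma approximable_phi (F : Omega -> E0) (DF : Omega -> H -> E0) :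
  malliavin_derivative ip W p F DF ->
  approximable ip W p (phi \o F) (fun w => 'd phi (F w) \o DF w).
Proof.
move=> [inF inDF [Fn [DFn [sF cF cDF]]]].
have [mF _] := inF; have [mDF _] := inDF.
have mFn k := (strongly_measurable_smooth H_hilbert (sF k)).1.
have mDFn k := (strongly_measurable_smooth H_hilbert (sF k)).2.
have sE0 := seminorm_enorm E0; have sN0 := @seminorm_gamma_norm R H ip E0.
have sN1 := @seminorm_gamma_norm R H ip E1.
have smallF := cvg_Lp_small p_gt0 sE0 mFn mF cF.
have smallDF := cvg_Lp_small p_gt0 sN0 mDFn mDF cDF.
have half k : 0 < 2^-1 ^+ k :> R by rewrite exprn_gt0// invr_gt0.
(* Geometric errors make the chosen subsequence converge almost surely. *)
have /choice[sub Hsub] : forall k, exists n,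
    small P p (fun w => enorm (Fn n w - F w)) (2^-1 ^+ k) /\
    small P p (fun w => N0 (DFn n w - DF w)) (2^-1 ^+ k).
  by move=> k; exact: (filter_ex (filterI (smallF _ (half k)) (smallDF _ (half k)))).
have aeF : {ae P, forall w, (fun k => enorm (Fn (sub k) w - F w)) @ \oo --> 0%E}.
  apply: (small_summable_ae p_gt0) => [k w|k]; last by case: (Hsub k).
  by rewrite /enorm lee_fin.
have [M [M0 sDF]] := in_Lp_small p_gt0 sN0 inDF.
have DFfin : {ae P, forall w, (N0 (DF w) < +oo)%E}.
  have [g [_ _ hg _]] := sDF.
  by apply: filterS hg => w hw; apply: le_lt_trans hw _; rewrite ltry.
(* Only the derivative of [phi] varies with [k], so [f] has the dominating function [2 * C] times
   the norm of [DF]. *)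
pose f k w := N1 (('d phi (Fn (sub k) w) \o DF w) - ('d phi (F w) \o DF w)).
have smallf : forall e, 0 < e -> \forall k \near \oo, small P p (f k) e.
  apply: (@small_dominated _ _ _ _ _ p_gt0 f (fun w => (2 * C)%:E * N0 (DF w))%E).
  - by move=> k w; exact: gamma_norm_ge0.
  - move=> k; apply: (strongly_measurable_norm sN1); apply: strongly_measurableB => //;
    exact: strongly_measurable_derivative.
  - by apply: filterS2 DFfin aeF => w h1 h2; exact: gamma_norm_derivative_cvg.
  - by move=> k w; exact: gamma_norm_derivative_dist.
  - by apply: smallZ sDF => //; rewrite mulr_ge0// ltW.
apply: (approximable_limit p_gt0) => e e0.
pose a := C `^ p + 1.
have Cp0 : 0 <= C `^ p by exact: powR_ge0.
have a0 : 0 < a by rewrite ltr_wpDl.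
have p2 : 1 <= 2 `^ p :> R.
  have two : 1 <= 2 :> R by rewrite ler1n.
  by have := ler_powR two (ltW p_gt0); rewrite powRr0.
have p20 : 0 < 2 `^ p :> R by exact: lt_le_trans p2.
(* [smallD] costs the factor [2 ^ p] and [smallZ] the factor [C ^ p]; with [e1] for both errors the
   total is [e]. *)
pose e1 := e / (2 `^ p * a).
have e10 : 0 < e1 by rewrite divr_gt0// mulr_gt0.
have e1E : 2 `^ p * (C `^ p * e1 + e1) = e.
  rewrite (_ : _ * _ = e1 * (2 `^ p * a)); last by rewrite /a; ring.
  by rewrite divfK// gt_eqF// mulr_gt0.
have e1C : C `^ p * e1 <= e.
  rewrite -e1E; apply: (@le_trans _ _ (C `^ p * e1 + e1)); first by rewrite lerDl ltW.
  by rewrite ler_peMl//; apply: addr_ge0; [apply: mulr_ge0 => //|]; exact: ltW.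
have halfe1 : \forall k \near \oo, 2^-1 ^+ k <= e1.
  have h2 : `|2^-1 : R| < 1 by rewrite ger0_norm ?invr_ge0// invf_lt1// ltr1n.
  have /cvgrPdist_le/(_ e1 e10) := @cvg_expr R 2^-1 h2.
  by apply: filterS => k; rewrite sub0r normrN ger0_norm// exprn_ge0// invr_ge0.
have [k [hk1 hk2]] := filter_ex (filterI (smallf _ e10) halfe1).
have [sFk sDFk] := Hsub k.
exists (phi \o Fn (sub k)), (fun w => 'd phi (Fn (sub k) w) \o DFn (sub k) w).
split; first exact: approximable_phi_smooth.
  apply: small_le (smallZ (ltW C_gt0) sFk) => [w|].
    by rewrite /enorm -EFinM lee_fin; exact: phi_dist.
  by apply: le_trans e1C; exact: ler_wpM2l.
apply: small_le (smallD p_gt0 (smallZ (ltW C_gt0) sDFk) hk1) => [w|].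
  rewrite /f; set A := 'd phi (Fn (sub k) w).
  rewrite (_ : (A \o DFn (sub k) w) - ('d phi (F w) \o DF w) =
    (A \o (DFn (sub k) w - DF w)) + ((A \o DF w) - ('d phi (F w) \o DF w))); last first.
    by apply/funext => h; rewrite /= !fctE/= linearB addrA subrK.
  apply: le_trans (gamma_normD _ _ _) _; apply: leeD => //.
  exact: gamma_norm_derivative.
by rewrite -e1E ler_wpM2l ?(ltW p20)// lerD2r ler_wpM2l.
Qed.

Lemma malliavin_derivative_comp (F : Omega -> E0) (DF : Omega -> H -> E0) :
  malliavin_derivative ip W p F DF ->
  malliavin_derivative ip W p (phi \o F) (fun w => 'd phi (F w) \o DF w).
Proof.
move=> DFF; have aphi := approximable_phi DFF.
have [inF inDF _] := DFF; have [mF _] := inF; have [mDF _] := inDF.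
have sE0 := seminorm_enorm E0; have sE1 := seminorm_enorm E1.
have sN0 := @seminorm_gamma_norm R H ip E0; have sN1 := @seminorm_gamma_norm R H ip E1.
have [M [M0 sF]] := in_Lp_small p_gt0 sE0 inF.
have [M' [M'0 sDF]] := in_Lp_small p_gt0 sN0 inDF.
split.
(* Being Lipschitz, [phi] has at most linear growth, and constants lie in L^p of a probability
   space. *)
- have c0 : 0 <= `|phi 0| by [].
  apply: (@small_in_Lp _ _ _ _ _ p_gt0 _ _ _ (2 `^ p * (`|phi 0| `^ p + C `^ p * M))) => //.
  + exact: strongly_measurable_phi.
  + by rewrite mulr_ge0 ?powR_ge0// addr_ge0 ?powR_ge0// mulr_ge0 ?powR_ge0.
  apply: small_le (smallD p_gt0 (small_cst P p c0) (smallZ (ltW C_gt0) sF)) => // w.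
  rewrite /= /enorm -EFinM -EFinD lee_fin.
  have -> : phi (F w) = phi 0 + (phi (F w) - phi 0) by rewrite addrC subrK.
  apply: le_trans (ler_normD _ _) _.
  by rewrite lerD2l; have := phi_dist (F w) 0; rewrite subr0.
- apply: (@small_in_Lp _ _ _ _ _ p_gt0 _ _ _ (C `^ p * M')) => //.
  + exact: strongly_measurable_derivative.
  + by rewrite mulr_ge0 ?powR_ge0.
  apply: small_le (smallZ (ltW C_gt0) sDF) => // w.
  exact: gamma_norm_derivative.
have e0 k : 0 < k.+1%:R^-1 `^ p :> R by rewrite powR_gt0// invr_gt0.
have /choice[G HG] : forall k, exists GDG : (Omega -> E1) * (Omega -> H -> E1),
  [/\ smooth_derivative ip W GDG.1 GDG.2,
    small P p (fun w => @enorm R E1 (GDG.1 w - phi (F w))) (k.+1%:R^-1 `^ p) &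
    small P p (fun w => N1 (GDG.2 w - ('d phi (F w) \o DF w))) (k.+1%:R^-1 `^ p)].
  by move=> k; have [G [DG HG]] := aphi _ (e0 k); exists (G, DG).
exists (fun k => (G k).1), (fun k => (G k).2); split.
- by move=> k; case: (HG k).
- by apply: small_cvg_Lp => // k; case: (HG k).
- by apply: small_cvg_Lp => // k; case: (HG k).
Qed.

End Composition.

Theorem proposition3p8 (R : realType)
    (H : completeNormedModType R) (ip : {dot H for (@idfun R)})
    (H_hilbert : forall h : H, `|h| ^+ 2 = ip h h)
    (H_separable : separable_space H)
    (d : measure_display) (Omega : measurableType d) (P : probability Omega R)
    (W : H -> {RV P >-> R})
    (W_isonormal : isonormal ip W)
    (W_generates : generated_by_process W)
    (E0 E1 : completeNormedModType R) (E1_UMD : UMD E1)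
    (p : R) (p_gt1 : 1 < p)
    (phi : E0 -> E1)
    (phi_differentiable : forall x : E0, differentiable phi x)
    (phi'_continuous : forall (x : E0) (e : R), 0 < e ->
       \forall y \near x, forall v : E0,
         `|'d phi y v - 'd phi x v| <= e * `|v|)
    (phi'_bounded : exists C : R, forall x v : E0, `|'d phi x v| <= C * `|v|)
    (F : Omega -> E0) :
  malliavin_domain ip W p F ->
  malliavin_domain ip W p (phi \o F) /\
  forall DF : Omega -> H -> E0, malliavin_derivative ip W p F DF ->
    malliavin_derivative ip W p (phi \o F) (fun w => 'd phi (F w) \o DF w).
Proof.
have p_gt0 : 0 < p by exact: lt_trans p_gt1.
(* The bound is enlarged to a positive one, because the ideal property is proved by dividing by
   it. *)
have [C0 HC0] := phi'_bounded; pose C := Num.max C0 1.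
have C_gt0 : 0 < C by rewrite lt_max ltr01 orbT.
have HC x v : `|'d phi x v| <= C * `|v|.
  by apply: le_trans (HC0 x v) _; rewrite ler_wpM2r// le_max lexx.
have chain DF : malliavin_derivative ip W p F DF ->
    malliavin_derivative ip W p (phi \o F) (fun w => 'd phi (F w) \o DF w).
  exact: (malliavin_derivative_comp H_hilbert p_gt0 phi_differentiable
    phi'_continuous C_gt0 HC).
move=> [DF DFF]; split; last exact: chain.
by exists (fun w => 'd phi (F w) \o DF w); exact: chain.
Qed.
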